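(* Let $(X^n)_{n\in\omega}$ be a sequence of reals (subsets of $\omega$) of strictly increasing Turing degree such that (i) whenever $T$ is a binary tree computable in $X^n$ whose set of infinite branches has positive measure, some infinite path through $T$ is computable in $X^{n+1}$; and (ii) no infinite path through the Kleene tree is computable in any $X^n$. Let $M$, $R$ and $M[\mathrm{App}]$ be constructed from the sequence $R_n := X^n$ as described in the context. Then $$\langle\rangle \models_{App} \text{W-D-FAN}.$$
   Context: The meta-theory is ZFC, with ground universe $V$. Trees and principles. A binary tree is a set $T$ of finite 0-1 sequences closed under initial segments; an infinite path (branch) through $T$ is an infinite 0-1 sequence all of whose finite initial segments are in $T$. Measure is the usual coin-tossing measure on infinite binary sequences. The Kleene tree is the standard computable, infinite binary tree with no computable infinite path (e.g. $s\in K$ iff there is no $e<|s|$ such that the $e$-th Turing machine on input $e$ halts within $|s|$ steps with output $s(e)$). $T$ is decidable if for all finite binary sequences $b$, $b\in T$ or $b\notin T$. W-D-FAN (Weak Decidable Fan Theorem) is the statement: if a decidable binary tree $T$ has no infinite path, then there is an $n$ such that at least half of the sequences in $\{0,1\}^n$ are not in $T$. (A sequence $(X^n)$ as in the claim was constructed by Yu and Simpson.) The Kripke model $M$. $M$ is the full Kripke model over the partial order $\omega^{<\omega}$ (ordered by extension, root $\langle\rangle$). Inductively, a set of $M$ is a function $f$ from $\omega^{<\omega}$ to sets of sets of $M$ with $f(\sigma)\subseteq f(\tau)$ whenever $\sigma\subseteq\tau$. By mutual induction, $\sigma\models h\in f$ iff there is $h'\in f(\sigma)$ with $\sigma\models h=h'$,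 and $\sigma\models f=g$ iff for all $\tau\supseteq\sigma$, every $h\in f(\tau)$ satisfies $\tau\models h\in g$ and every $h\in g(\tau)$ satisfies $\tau\models h\in f$. The other connectives and quantifiers are interpreted by the usual Kripke forcing clauses. $M\models$ IZF. Each $x\in V$ has a canonical image $\check x\in M$, $\check x(\sigma)=\{\check y\mid y\in x\}$, often identified with $x$. The oracle $R$. Given reals $R_n$ ($n\in\omega$) of strictly increasing Turing degree, let $(R_n^i)_{i\in\omega}$ list all reals differing from $R_n$ in only finitely many places. In $M$ define the set of natural numbers $R$ by $R(\langle\rangle)=\emptyset$ and, for $\sigma$ of length $n$, $R(\sigma^\frown i)=R(\sigma)\cup\{\langle n,s\rangle\mid s\in R_n^i\}$ (numbers identified with their images in $M$). The realizability model $M[\mathrm{App}]$. In $M$, let App be the applicative structure of indices of functions Turing computable in the oracle $R$: its elements are the natural numbers, and $e\cdot m\simeq k$ iff there is a finite correct computation of the $e$-th oracle machine on input $m$ with output $k$, where an oracle query ''$s\in R$?'' may be passed only if $s\in R$ or $s\notin R$ holds and the corresponding answer is used. $M[\mathrm{App}]$ is the induced realizability model of set theory, built inside $M$: its elements are, inductively, sets of pairs $(e,a)$ with $e\in\omega$ and $a$ an element of $M[\mathrm{App}]$. Realizability $e\Vdash_r\phi$ is: $e\Vdash_r a\in b$ iff there is $c$ with $((e)_0,c)\in b$ and $(e)_1\Vdash_r a=c$; $e\Vdash_r a=b$ iff for all $(f,c)\in a$, $(e)_0\cdot f\Vdash_r c\in b$ and for all $(f,c)\in b$, $(e)_1\cdot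 f\Vdash_r c\in a$; the usual Kleene clauses for $\wedge,\vee,\to,\bot$; and $e\Vdash_r\forall x\phi$ (resp. $\exists x\phi$) iff $e\Vdash_r\phi(a)$ for all (resp. some) $a$. $M[\mathrm{App}]\models\phi$ means some $e$ realizes $\phi$. $M[\mathrm{App}]\models$ IZF. The number $n$ is represented by $\bar n=\{(m,\bar m)\mid m<n\}$ and $\omega$ by $\{(n,\bar n)\mid n\in\omega\}$. Notation: $\sigma\models_{App}\phi$ abbreviates $\sigma\models$ ''$M[\mathrm{App}]\models\phi$'' (forcing in $M$ at node $\sigma$). *)

(* Defs.v *)
From Stdlib Require Cantor.
From mathcomp Require Import all_boot all_order all_algebra.
From mathcomp Require Import boolp classical_sets functions cardinality.
From mathcomp Require Import constructive_ereal ereal sequences.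
From mathcomp Require Import Rstruct.

Set Implicit Arguments.
Unset Strict Implicit.
Unset Printing Implicit Defensive.

Local Open Scope nat_scope.

Definition npair (a b : nat) : nat := Cantor.to_nat (a, b).
Definition proj0 (e : nat) : nat := (Cantor.of_nat e).1.
Definition proj1 (e : nat) : nat := (Cantor.of_nat e).2.

(* Oracle Turing machines have countably many two-way infinite tapes over the alphabet
  {blank, 1} = bool, of which a given machine uses finitely many.  Each state
  has one active tape, whose scanned symbol determines the symbol written, the
  head move and the next state.  In a query state the machine asks whether [s]
  is in the oracle, where [s] is the number of 1s on tape 1.  The input [m] is
  given as [m] consecutive 1s on tape 0, head on the leftmost one, all other
  tapes being blank; the output is the number of 1s on tape 0. *)

(* (symbols left of the head, nearest first; scanned symbol; symbols to the
   right); missing symbols are blank *)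
Definition tape : Type := (seq bool * bool * seq bool)%type.

Definition blank_tape : tape := ([::], false, [::]).
Definition unary_tape (m : nat) : tape :=
  ([::], head false (nseq m true), behead (nseq m true)).
Definition ones (w : tape) : nat :=
  let: (l, a, r) := w in count id l + a + count id r.
Definition scanned (w : tape) : bool := w.1.2.

Inductive move : Type := ToLeft | ToRight.

Definition write_move (b : bool) (d : move) (w : tape) : tape :=
  let: (l, _, r) := w in
  match d with
  | ToLeft => (behead l, head false l, b :: r)
  | ToRight => (b :: l, head false r, behead r)
  end.

Definition action : Type := (bool * move * nat)%type.

(* [Act t x y] uses tape [t] and does [x] on a blank, [y] on a 1; [Ask y n]
   continues in state [y] or [n] according to the answer *)
Inductive instr : Type :=
  | Act (t : nat) (on_blank on_one : action)
  | Ask (yes no : nat)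
  | Stop.

(* the states are the positions in the list; any other number is a halting
   state *)
Definition machine : Type := seq instr.

Definition config : Type := (nat * (nat -> tape))%type.

Definition init (m : nat) : config :=
  (0, fun t => if t == 0 then unary_tape m else blank_tape).

(* [ans s b] says that the query "is s in the oracle?" may be passed with
   answer [b]; both answers may be unavailable *)
Definition oracle_answer : Type := nat -> bool -> Prop.

Definition step (P : machine) (ans : oracle_answer) (c c' : config) : Prop :=
  match nth Stop P c.1 with
  | Act t x y =>
      let: (b, d, q) := if scanned (c.2 t) then y else x in
      c' = (q, fun u => if u == t then write_move b d (c.2 t) else c.2 u)
  | Ask y n => exists2 b : bool,
      ans (ones (c.2 1)) b & c' = (if b then y else n, c.2)
  | Stop => False
  end.

Fixpoint steps (P : machine) (ans : oracle_answer) (t : nat) (c c' : config) :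
    Prop :=
  if t is t'.+1 then exists2 c1, step P ans c c1 & steps P ans t' c1 c'
  else c = c'.

Definition decode_action (b d q : nat) : action :=
  (odd b, if odd d then ToRight else ToLeft, q).

Definition decode_instr (n : nat) : instr :=
  match CodeSeq.decode n with
  | [:: t; b0; d0; q0; b1; d1; q1] =>
      Act t (decode_action b0 d0 q0) (decode_action b1 d1 q1)
  | [:: y; n'] => Ask y n'
  | _ => Stop
  end.

Definition machine_of (e : nat) : machine :=
  map decode_instr (CodeSeq.decode e).

Definition computes_in (t : nat) (ans : oracle_answer) (e m k : nat) : Prop :=
  exists c : config,
    [/\ steps (machine_of e) ans t (init m) c,
        nth Stop (machine_of e) c.1 = Stop & ones (c.2 0) = k].

Definition computes (ans : oracle_answer) (e m k : nat) : Prop :=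
  exists t : nat, computes_in t ans e m k.

Definition answer (X : set nat) : oracle_answer :=
  fun s b => if b then X s else ~ X s.

Definition computable_from (X : set nat) (f : nat -> nat) : Prop :=
  exists e : nat, forall m : nat, computes (answer X) e m (f m).

Definition turing_le (A B : set nat) : Prop :=
  computable_from B (fun m => m \in A).

Definition turing_lt (A B : set nat) : Prop :=
  turing_le A B /\ ~ turing_le B A.

Definition binary_tree (T : set (seq bool)) : Prop :=
  forall s t : seq bool, prefix s t -> T t -> T s.

Definition branches (T : set (seq bool)) : set (nat -> bool) :=
  [set p | forall n, T (mkseq p n)].

Definition seq_code (s : seq bool) : nat := CodeSeq.code (map nat_of_bool s).

Definition computable_tree (X : set nat) (T : set (seq bool)) : Prop :=
  exists e : nat, forall s : seq bool,
    computes (answer X) e (seq_code s) (s \in T).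

Definition computable_path (X : set nat) (p : nat -> bool) : Prop :=
  computable_from X (fun m => p m).

Definition cylinder (s : seq bool) : set (nat -> bool) :=
  [set p | mkseq p (size s) = s].

(* As for Lebesgue measure: the Caratheodory (outer) extension of the function
   giving the cylinder of a sequence of length n the value 2^-n.  Sets of
   branches are closed, hence measurable. *)
Definition coin_measure (A : set (nat -> bool)) : \bar Rdefinitions.R :=
  ereal_inf
    [set (\sum_(0 <= k <oo) (((2%:R^-1) ^+ size (s k))%R)%:E)%E
      | s in [set s : nat -> seq bool |
                (A `<=` \bigcup_k cylinder (s k))%classic]]%classic.

(* the e-th Turing machine is the e-th oracle machine with empty oracle *)
Definition kleene_tree : set (seq bool) :=
  [set s | ~ exists e : nat, e < size s /\
     exists2 t, t <= size s &
       computes_in t (answer set0) e e (nth false s e)]%classic.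

Definition node : Type := seq nat.

(* [KSet el dom _] is the function taking the node s to the set of all [el i]
   with [dom i s] *)
Inductive kset : Type := KSet (J : Type) (el : J -> kset)
  (dom : J -> node -> Prop)
  (dom_mono : forall i s t, prefix s t -> dom i s -> dom i t).

Definition val_at (f : kset) (s : node) (h : kset) : Prop :=
  let: KSet J el dom _ := f in exists2 i : J, dom i s & h = el i.

(* the recursion defining forced membership and equality only uses its
   recursive calls positively and is well-founded, so it is captured by an
   inductive predicate; the same applies to [rmem] and [req] below *)
Inductive kmem : node -> kset -> kset -> Prop :=
  | KMem s h f h' : val_at f s h' -> keq s h h' -> kmem s h f
with keq : node -> kset -> kset -> Prop :=
  | KEq s f g :
      (forall t, prefix s t -> forall h, val_at f t h -> kmem t h g) ->
      (forall t, prefix s t -> forall h, val_at g t h -> kmem t h f) ->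
      keq s f g.

Definition kconst (J : Type) (el : J -> kset) : kset :=
  @KSet J el (fun _ _ => True) (fun _ _ _ _ h => h).

Definition kempty : kset := kconst (fun v : void => match v with end).

Definition kupair (a b : kset) : kset :=
  kconst (fun x : bool => if x then a else b).

Definition kpair (a b : kset) : kset := kupair (kupair a a) (kupair a b).

Lemma kadjoin_mono (J : Type) (dom : J -> node -> Prop)
    (mono : forall i s t, prefix s t -> dom i s -> dom i t)
    (i : option J) (s t : node) :
  prefix s t -> (if i is Some j then dom j s else True) ->
  (if i is Some j then dom j t else True).
Proof. by case: i => // i; exact: mono. Qed.

Definition kadjoin (a x : kset) : kset :=
  let: KSet J el dom mono := a in
  KSet (fun i => if i is Some j then el j else x) (kadjoin_mono mono).

(* the canonical image of the von Neumann numeral n *)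
Fixpoint knat (n : nat) : kset :=
  if n is m.+1 then kadjoin (knat m) (knat m) else kempty.

Inductive oracle_dom (Xi : nat -> nat -> set nat) : nat -> node -> Prop :=
  | OracleOld p s i : oracle_dom Xi p s -> oracle_dom Xi p (rcons s i)
  | OracleNew x s i :
      Xi (size s) i x -> oracle_dom Xi (npair (size s) x) (rcons s i).

Lemma oracle_dom_mono Xi p s t :
  prefix s t -> oracle_dom Xi p s -> oracle_dom Xi p t.
Proof.
move=> /prefixP[u ->]; elim/last_ind: u => [|u i IHu]; first by rewrite cats0.
by rewrite -rcons_cat => /IHu; exact: OracleOld.
Qed.

Definition oracle (Xi : nat -> nat -> set nat) : kset :=
  KSet knat (oracle_dom_mono (Xi := Xi)).

(* Below, quantifiers of the Kripke model that range over its set of natural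
   numbers, such as those over realizers, are taken over [nat]: that set is the
   constant one with elements [knat n]. *)

Definition kanswer (R : kset) (s : node) : oracle_answer := fun p b =>
  if b then kmem s (knat p) R else forall t, prefix s t -> ~ kmem t (knat p) R.

Definition kapp (R : kset) (s : node) (e m k : nat) : Prop :=
  computes (kanswer R s) e m k.

Inductive is_name : node -> kset -> Prop :=
  | IsName s a :
      (forall t, prefix s t -> forall x, kmem t x a ->
         exists e c, keq t x (kpair (knat e) c) /\ is_name t c) ->
      is_name s a.

Inductive rmem (R : kset) : node -> nat -> kset -> kset -> Prop :=
  | RMem s e a b c :
      kmem s (kpair (knat (proj0 e)) c) b -> req R s (proj1 e) a c ->
      rmem R s e a b
with req (R : kset) : node -> nat -> kset -> kset -> Prop :=
  | REq s e a b :
      (forall t, prefix s t -> forall f c, kmem t (kpair (knat f) c) a ->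
         exists k, kapp R t (proj0 e) f k /\ rmem R t k c b) ->
      (forall t, prefix s t -> forall f c, kmem t (kpair (knat f) c) b ->
         exists k, kapp R t (proj1 e) f k /\ rmem R t k c a) ->
      req R s e a b.

(* first-order formulas of set theory in parametric higher-order abstract
   syntax; [V] is the type of variables *)
Inductive fml (V : Type) : Type :=
  | Mem (x y : V)
  | Eq (x y : V)
  | Bot
  | And (p q : fml V)
  | Or (p q : fml V)
  | Imp (p q : fml V)
  | All (p : V -> fml V)
  | Ex (p : V -> fml V).
Arguments Bot {V}.

(* [realizes R p e s]: the node s forces that e realizes p *)
Fixpoint realizes (R : kset) (p : fml kset) (e : nat) (s : node) : Prop :=
  match p with
  | Mem a b => rmem R s e a b
  | Eq a b => req R s e a b
  | Bot => False
  | And p1 p2 => realizes R p1 (proj0 e) s /\ realizes R p2 (proj1 e) s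
  | Or p1 p2 => (proj0 e = 0 /\ realizes R p1 (proj1 e) s) \/
                (proj0 e <> 0 /\ realizes R p2 (proj1 e) s)
  | Imp p1 p2 => forall t, prefix s t -> forall f, realizes R p1 f t ->
                   exists k, kapp R t e f k /\ realizes R p2 k t
  | All p1 => forall t, prefix s t -> forall a, is_name t a ->
                realizes R (p1 a) e t
  | Ex p1 => exists a, is_name s a /\ realizes R (p1 a) e s
  end.

Definition forces_app (R : kset) (s : node) (p : fml kset) : Prop :=
  exists e : nat, realizes R p e s.

(* the names {(m, name of m) | m < n} of n and {(n, name of n)} of omega *)
Fixpoint nat_name (n : nat) : kset :=
  if n is m.+1 then kadjoin (nat_name m) (kpair (knat m) (nat_name m))
  else kempty.

Definition omega_name : kset := kconst (fun n => kpair (knat n) (nat_name n)).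

Declare Scope fml_scope.
Delimit Scope fml_scope with fml.
Notation "x ∈' y" := (Mem x y) (at level 70, no associativity) : fml_scope.
Notation "x =' y" := (Eq x y) (at level 70, no associativity) : fml_scope.
Notation "p ∧' q" := (And p q) (at level 80, right associativity) : fml_scope.
Notation "p ∨' q" := (Or p q) (at level 85, right associativity) : fml_scope.
Notation "p ⇒' q" := (Imp p q) (at level 90, right associativity) : fml_scope.
Notation "¬' p" := (Imp p Bot) (at level 75, right associativity) : fml_scope.
Notation "p ⇔' q" := (And (Imp p q) (Imp q p))
  (at level 95, no associativity) : fml_scope.
Notation "∀' x , p" := (All (fun x => p))
  (at level 200, x name, right associativity) : fml_scope.
Notation "∃' x , p" := (Ex (fun x => p))
  (at level 200, x name, right associativity) : fml_scope.

Section SetTheory.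
Variable V : Type.
Implicit Types (x y z d f g n s t T om : V).
Local Open Scope fml_scope.

Definition f_empty x : fml V := ∀' z, ¬' (z ∈' x).

Definition f_succ y x : fml V := ∀' z, (z ∈' y ⇔' (z ∈' x ∨' z =' x)).

Definition f_bit x : fml V :=
  f_empty x ∨' (∃' z, f_empty z ∧' f_succ x z).

Definition f_upair z x y : fml V := ∀' w, (w ∈' z ⇔' (w =' x ∨' w =' y)).

Definition f_pair z x y : fml V :=
  ∃' u, ∃' v, f_upair u x x ∧' f_upair v x y ∧' f_upair z u v.

Definition f_pair_in x y g : fml V := ∃' p, f_pair p x y ∧' p ∈' g.

Definition f_single_valued g : fml V :=
  ∀' x, ∀' y, ∀' z, f_pair_in x y g ∧' f_pair_in x z g ⇒' y =' z.

Definition f_injective g : fml V :=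
  ∀' x, ∀' y, ∀' z, f_pair_in x z g ∧' f_pair_in y z g ⇒' x =' y.

Definition f_binary_fun f d : fml V :=
  (∀' p, p ∈' f ⇒' (∃' x, ∃' y, x ∈' d ∧' f_bit y ∧' f_pair p x y)) ∧'
  (∀' x, x ∈' d ⇒' (∃' y, f_pair_in x y f)) ∧'
  f_single_valued f.

Definition f_finite_seq om s : fml V := ∃' n, n ∈' om ∧' f_binary_fun s n.

Definition f_subset x y : fml V := ∀' z, z ∈' x ⇒' z ∈' y.

(* a finite sequence included in s is the same as an initial segment of s *)
Definition f_binary_tree om T : fml V :=
  (∀' s, s ∈' T ⇒' f_finite_seq om s) ∧'
  (∀' s, ∀' t,
     s ∈' T ⇒' f_finite_seq om t ⇒' f_subset t s ⇒' t ∈' T).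

Definition f_decidable om T : fml V :=
  ∀' s, f_finite_seq om s ⇒' (s ∈' T ∨' ¬' s ∈' T).

Definition f_path om T f : fml V :=
  f_binary_fun f om ∧'
  (∀' s, f_finite_seq om s ⇒' f_subset s f ⇒' s ∈' T).

(* At least half of {0,1}^n lies outside T: the cardinality of {0,1}^n is at
   most twice that of {0,1}^n \ T, i.e., some g is an injective function from
   {0,1}^n to {0,1} x ({0,1}^n \ T). *)
Definition f_half_outside T n : fml V :=
  ∃' g,
    (∀' p, p ∈' g ⇒'
       (∃' s, ∃' i, ∃' t, ∃' q,
          f_binary_fun s n ∧' f_bit i ∧' f_binary_fun t n ∧' ¬' t ∈' T ∧'
          f_pair q i t ∧' f_pair p s q)) ∧'
    (∀' s, f_binary_fun s n ⇒' (∃' q, f_pair_in s q g)) ∧'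
    f_single_valued g ∧'
    f_injective g.

(* om stands for the set of natural numbers *)
Definition WDFAN om : fml V :=
  ∀' T, f_binary_tree om T ⇒' f_decidable om T ⇒'
    ¬' (∃' f, f_path om T f) ⇒'
    (∃' n, n ∈' om ∧' f_half_outside T n).

End SetTheory.

(* Main.v *)
Require Import Defs.
From mathcomp Require Import all_boot all_order all_algebra.
From mathcomp Require Import boolp classical_sets functions cardinality.
From mathcomp Require Import constructive_ereal ereal sequences Rstruct.
From mathcomp Require Import zify.

(** The realizer of W-D-FAN receives a realizer [g] of the decidability of T
    and looks for the least n such that [g] rejects at least half of the binary
    sequences of length n. The rejected sequences that it has listed then
    provide the injection from all sequences of length n into two copies of
    the rejected ones ([half_realized]).

    The search stops. Let it take place at a node s of length n. At s the
    oracle answers the queries about its first n columns and no others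
    ([kanswer_oracle]), and these columns are finite changes of X 0, ...,
    X (n - 1). So the sequences that [g] accepts form a tree computable from X n
    ([tree_computable]). If more than half of every level were accepted then the
    branches of this tree would have measure at least 1/2 ([coin_measure_pos]),
    and there would be a branch p computable from X (n + 1). Extend s by two
    steps, the second of which makes X (n + 1) a column of the oracle. At this
    node p is computable from the oracle, so p is a path of T in the
    realizability model: a sequence s' included in p is standard, hence [g]
    cannot reject it ([path_realized]). This contradicts the realizer of the
    statement that T has no path ([search_terminates]).

    All realizers are indices of Turing machines, so the rest of the work is to
    make the indices at a node a partial combinatory algebra in which programs
    can be written. Turing machines simulate register programs ([exec_runs]),
    and these simulate the point-free language [fn] ([wp_exec]), whose semantics
    [wp] is a predicate transformer. Three facts about [fn] suffice: indices
    with a parameter are computable from the parameter ([wp_clos], [pure_lam]);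
    there is a universal program ([wp_univ]); an oracle may be replaced by a
    subroutine ([wp_relativize]). Realizers are then written as programs with
    [Lam] and [App], and verified by evaluating [wp].

    In the model, Kuratowski pairs and binary functions are handled through
    standard names: [f_pair p x y] amounts to equality of p with [pair_name x y],
    pairs are injective with computable realizers ([wp_inj1], [wp_inj2]), and
    every binary function on n equals the standard name of an actual sequence,
    which can be read off from its realizer ([binary_fun_eq], [wp_read]). *)

Set Implicit Arguments.
Unset Strict Implicit.
Unset Printing Implicit Defensive.
Local Open Scope nat_scope.

(** * Register programs on Turing machine tapes *)

Definition upd (T : Type) (f : nat -> T) (r : nat) (v : T) : nat -> T :=
  fun i => if i == r then v else f i.

(** Every tape serves as a unary counter, so that increments, decrements and
    tests for zero take a few head moves each, and a query about register 1 is
    a query of the machine, which counts the 1s on tape 1. *)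
Inductive cmd : Type :=
  | RSkip
  | RInc (r : nat)
  | RDec (r : nat)
  | RAsk (r : nat)
  | RSeq (c d : cmd)
  | RWhile (r : nat) (c : cmd).

Notation "c ;; d" := (RSeq c d) (at level 60, right associativity).

Inductive exec (ans : oracle_answer) :
    cmd -> (nat -> nat) -> (nat -> nat) -> Prop :=
  | ESkip s : exec ans RSkip s s
  | EInc r s : exec ans (RInc r) s (upd s r (s r).+1)
  | EDec r s : exec ans (RDec r) s (upd s r (s r).-1)
  | EAsk r s b : ans (s 1) b -> exec ans (RAsk r) s (upd s r (b + s r))
  | ESeq c d s s1 s2 :
      exec ans c s s1 -> exec ans d s1 s2 -> exec ans (c ;; d) s s2
  | EStop r c s : s r = 0 -> exec ans (RWhile r c) s s
  | ELoop r c s s1 s2 : s r <> 0 -> exec ans c s s1 ->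
      exec ans (RWhile r c) s1 s2 -> exec ans (RWhile r c) s s2.

Definition act (t : nat) (b : bool) (d : move) (q : nat) : instr :=
  Act t (b, d, q) (b, d, q).

(** States are absolute positions, whence the offset [o]. An instruction
    always moves the head, so the jump closing a loop is a move to the right
    followed by one to the left. *)
Fixpoint code_of (c : cmd) (o : nat) : seq instr :=
  match c with
  | RSkip => [::]
  | RInc r => [:: act r true ToRight o.+1]
  | RDec r =>
      [:: act r false ToLeft o.+1;
          Act r (false, ToRight, o.+3) (false, ToRight, o.+2);
          act r false ToLeft o.+3]
  | RAsk r => [:: Ask o.+1 o.+2; act r true ToRight o.+2]
  | RSeq c d => let p := code_of c o in p ++ code_of d (o + size p)
  | RWhile r c =>
      let p := code_of c o.+2 in
      [:: act r false ToLeft o.+1;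
          Act r (false, ToRight, o.+2 + (size p).+2) (true, ToRight, o.+2)]
      ++ p ++ [:: act r false ToRight (o.+2 + size p).+1; act r false ToLeft o]
  end.

Definition placed (P : machine) (o : nat) (p : seq instr) : Prop :=
  forall i, i < size p -> nth Stop P (o + i) = nth Stop p i.

Lemma placed_cat P o p q :
  placed P o (p ++ q) -> placed P o p /\ placed P (o + size p) q.
Proof.
move=> H; split=> i ip.
  by rewrite H ?nth_cat ?ip // size_cat ltn_addr.
by rewrite -addnA H ?size_cat ?ltn_add2l // nth_cat ltnNge leq_addr /= addKn.
Qed.

Definition runs (P : machine) (ans : oracle_answer) (c c' : config) : Prop :=
  exists t, steps P ans t c c'.

Lemma runs_refl P ans c : runs P ans c c.
Proof. by exists 0. Qed.

Lemma runs_step P ans c1 c2 c3 :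
  step P ans c1 c2 -> runs P ans c2 c3 -> runs P ans c1 c3.
Proof. by move=> s12 [t s23]; exists t.+1; exists c2. Qed.

Lemma runs_trans P ans c1 c2 c3 :
  runs P ans c1 c2 -> runs P ans c2 c3 -> runs P ans c1 c3.
Proof.
move=> [t]; elim: t c1 => [|t IHt] c1 /=; first by move=> ->.
by move=> [c s1 /IHt st] /st; apply: runs_step.
Qed.

(** The head rests on the blank just after the 1s. The lengths [j] and [k] of
    the blank paddings depend on the history of the moves and stay arbitrary. *)
Definition counter (n : nat) (w : tape) : Prop :=
  exists j k, w = (nseq n true ++ nseq j false, false, nseq k false).

Definition counters (s : nat -> nat) (T : nat -> tape) : Prop :=
  forall t, counter (s t) (T t).

Lemma counter_ones n w : counter n w -> ones w = n.
Proof.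
by move=> [j [k ->]] /=; rewrite count_cat !count_nseq /= mul1n !mul0n !addn0.
Qed.

Lemma counters_upd s T r n w :
  counters s T -> counter n w -> counters (upd s r n) (upd T r w).
Proof. by move=> sT nw t; rewrite /upd; case: eqP. Qed.

Lemma step_act P ans q T t x y b d q' :
  nth Stop P q = Act t x y ->
  (if scanned (T t) then y else x) = (b, d, q') ->
  step P ans (q, T) (q', upd T t (write_move b d (T t))).
Proof. by rewrite /step /= => -> /= ->. Qed.

Lemma upd_upd (A : Type) (f : nat -> A) r u v : upd (upd f r u) r v = upd f r v.
Proof. by apply/funext => i; rewrite /upd; case: eqP. Qed.

Lemma upd_id (A : Type) (f : nat -> A) r : upd f r (f r) = f.
Proof. by apply/funext => i; rewrite /upd; case: eqP => // ->. Qed.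

Lemma upd_same (A : Type) (f : nat -> A) r u : upd f r u r = u.
Proof. by rewrite /upd eqxx. Qed.

Lemma counter_right n w : counter n w -> counter n.+1 (write_move true ToRight w).
Proof.
move=> [j [k ->]]; exists j, k.-1; rewrite /=.
by case: k.
Qed.

(** One move to the left is the test for zero: from the position it reaches,
    the counter is either restored or decremented. *)
Lemma counter_left n w : counter n w ->
  let w' := write_move false ToLeft w in
  scanned w' = (0 < n) /\
  counter n (write_move (0 < n) ToRight w') /\
  counter n.-1 (write_move false ToLeft (write_move false ToRight w')).
Proof.
case: n => [|n] [j [k ->]] /=.
  split; first by case: j.
  by split; [exists j.-1.+1, k | exists j.-1, k.+1]; case: j.
split=> //; split; first by exists j, k.
by exists j, k.+1.
Qed.

Lemma counter_jump n w : counter n w ->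
  counter n (write_move false ToLeft (write_move false ToRight w)).
Proof. by move=> [j [k ->]]; exists j, k.-1.+1; case: k. Qed.

Lemma runs_act P ans q T r x y b d q' c :
  nth Stop P q = Act r x y ->
  (if scanned (T r) then y else x) = (b, d, q') ->
  runs P ans (q', upd T r (write_move b d (T r))) c -> runs P ans (q, T) c.
Proof. by move=> E1 E2; apply: runs_step; apply: step_act E1 E2. Qed.

Lemma runs_act_upd P ans q T r w x y b d q' c :
  nth Stop P q = Act r x y ->
  (if scanned w then y else x) = (b, d, q') ->
  runs P ans (q', upd T r (write_move b d w)) c ->
  runs P ans (q, upd T r w) c.
Proof.
move=> E1 E2 rc; apply: (runs_act E1 (b := b) (d := d) (q' := q')).
  by rewrite upd_same.
by rewrite upd_same upd_upd.
Qed.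

(** By induction on the execution; [placed] makes the induction hypotheses
    speak of the same machine as the conclusion. *)
Lemma exec_runs ans c s s' : exec ans c s s' ->
  forall P o T, placed P o (code_of c o) -> counters s T ->
  exists2 T', runs P ans (o, T) (o + size (code_of c o), T') & counters s' T'.
Proof.
elim=> {c s s'} [s|r s|r s|r s b rb|c d s s1 s2 _ IHc _ IHd|r c s s0|
    r c s s1 s2 s0 _ IHc _ IHw] P o T pl sT.
- by exists T; rewrite //= addn0; apply: runs_refl.
- have c1 := counter_right (sT r).
  exists (upd T r (write_move true ToRight (T r))); last exact: counters_upd.
  have := pl 0 isT; rewrite addn0 addn1 => E.
  apply: (runs_act E (b := true) (d := ToRight) (q' := o.+1)).
    by case: (scanned _).
  exact: runs_refl.
- have [sc [c1 c2]] := counter_left (sT r).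
  have E0 := pl 0 isT; have E1 := pl 1 isT; have E2 := pl 2 isT.
  rewrite /= ?addn0 ?addn1 ?addn2 in E0 E1 E2.
  rewrite /= addn3.
  case: (posnP (s r)) sc c1 c2 => [s0|s0] sc c1 c2.
    exists (upd T r (write_move false ToRight (write_move false ToLeft (T r)))).
      apply: (runs_act E0 (b := false) (d := ToLeft) (q' := o.+1)).
        by case: (scanned _).
      apply: (runs_act_upd E1 (b := false) (d := ToRight) (q' := o.+3)).
        by rewrite sc.
      exact: runs_refl.
    by apply: counters_upd => //; move: c1; rewrite s0.
  eexists; last by apply: counters_upd sT c2.
  apply: (runs_act E0 (b := false) (d := ToLeft) (q' := o.+1)).
    by case: (scanned _).
  apply: (runs_act_upd E1 (b := false) (d := ToRight) (q' := o.+2)).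
    by rewrite sc.
  apply: (runs_act_upd E2 (b := false) (d := ToLeft) (q' := o.+3)).
    by case: (scanned _).
  exact: runs_refl.
- have E0 := pl 0 isT; have E1 := pl 1 isT.
  rewrite /= ?addn0 ?addn1 in E0 E1; rewrite /= addn2.
  have S1 : step P ans (o, T) (if b then o.+1 else o.+2, T).
    by rewrite /step /= E0; exists b => //; rewrite (counter_ones (sT 1)).
  case: b rb S1 => _ S1.
    exists (upd T r (write_move true ToRight (T r))).
      apply: runs_step S1 _.
      apply: (runs_act E1 (b := true) (d := ToRight) (q' := o.+2)).
        by case: (scanned _).
      exact: runs_refl.
    exact: counters_upd sT (counter_right (sT r)).
  exists T; first exact: runs_step S1 (runs_refl _ _ _).
  by rewrite add0n upd_id.
- have /= /placed_cat[plc pld] := pl.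
  have [T1 r1 sT1] := IHc P o T plc sT.
  have [T2 r2 sT2] := IHd P _ T1 pld sT1.
  exists T2 => //; apply: runs_trans r1 _.
  by rewrite size_cat addnA.
- have [sc [c1 c2]] := counter_left (sT r).
  have E0 := pl 0 isT; have E1 := pl 1 isT.
  rewrite /= ?addn0 ?addn1 in E0 E1.
  exists (upd T r (write_move false ToRight (write_move false ToLeft (T r)))).
    apply: (runs_act E0 (b := false) (d := ToLeft) (q' := o.+1)).
      by case: (scanned _).
    apply: (runs_act_upd E1 (b := false) (d := ToRight)
              (q' := o.+2 + (size (code_of c o.+2)).+2)).
      by rewrite sc s0.
    by rewrite /= size_cat /= addn2 !addnS -!addSn; apply: runs_refl.
  rewrite s0 /= in c1; rewrite -(upd_id s r) s0.
  exact: counters_upd.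
- have E0 := pl 0 isT; have E1 := pl 1 isT.
  rewrite /= ?addn0 ?addn1 in E0 E1.
  have /= /(@placed_cat P o [:: _; _])[_ /placed_cat[plc ple]] := pl.
  rewrite /= addn2 in plc ple.
  have F0 := ple 0 isT; have F1 := ple 1 isT.
  rewrite /= ?addn0 ?addn1 in F0 F1.
  have [sc [c1 _]] := counter_left (sT r).
  have s0' : (0 < s r) by rewrite lt0n; apply/eqP.
  rewrite s0' in sc c1.
  have sT1 : counters s
      (upd T r (write_move true ToRight (write_move false ToLeft (T r)))).
    by rewrite -(upd_id s r); apply: counters_upd.
  have [T2 r2 sT2] := IHc P _ _ plc sT1.
  have sT2' : counters s1
      (upd T2 r (write_move false ToLeft (write_move false ToRight (T2 r)))).
    by rewrite -(upd_id s1 r); apply: counters_upd => //; apply: counter_jump.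
  have [T3 r3 sT3] := IHw P o _ pl sT2'.
  exists T3 => //.
  apply: (runs_act E0 (b := false) (d := ToLeft) (q' := o.+1)).
    by case: (scanned _).
  apply: (runs_act_upd E1 (b := true) (d := ToRight) (q' := o.+2)).
    by rewrite sc.
  apply: runs_trans r2 _.
  apply: (runs_act F0 (b := false) (d := ToRight)
            (q' := (o.+2 + size (code_of c o.+2)).+1)).
    by case: (scanned _).
  apply: (runs_act_upd F1 (b := false) (d := ToLeft) (q' := o)).
    by case: (scanned _).
  exact: r3.
Qed.

(** * Pairing and unpairing in registers *)

Arguments npair : simpl never.
Arguments proj0 : simpl never.
Arguments proj1 : simpl never.

Lemma proj0K a b : proj0 (npair a b) = a.
Proof. by rewrite /proj0 /npair Cantor.cancel_of_to. Qed.

Lemma proj1K a b : proj1 (npair a b) = b.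
Proof. by rewrite /proj1 /npair Cantor.cancel_of_to. Qed.

Lemma npairK n : npair (proj0 n) (proj1 n) = n.
Proof. by rewrite /npair /proj0 /proj1 -surjective_pairing Cantor.cancel_to_of.
  Qed.

Definition projE := (proj0K, proj1K).

(** The formula behind [rpair]: repeated addition of s, s - 1, ..., 1 to y,
    for s the sum of both coordinates. *)
Lemma npairE a b : npair a b = b + \sum_(i < (a + b).+1) i.
Proof.
rewrite /npair /Cantor.to_nat -plusE (PeanoNat.Nat.add_comm b a) plusE.
congr (_ + _); elim: (a + b) => [|n IHn]; first by rewrite big_ord_recr big_ord0.
by rewrite big_ord_recr /= -IHn addnC.
Qed.

(** Unpairing walks along the antidiagonals; this is one step. *)
Lemma projS n :
  (proj0 n.+1, proj1 n.+1) =
    if proj0 n is x.+1 then (x, (proj1 n).+1) else ((proj1 n).+1, 0).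
Proof.
by rewrite /proj0 /proj1 /=; case: (Cantor.of_nat n) => [[|x] y].
Qed.

Lemma exec_eq ans c s1 s1' s2 s2' :
  exec ans c s1 s2 -> s1 = s1' -> s2 = s2' -> exec ans c s1' s2'.
Proof. by move=> ? <- <-. Qed.

(** [S k] is the state after [k] rounds. *)
Lemma exec_loop ans r c n (S : nat -> nat -> nat) :
  (forall k, k < n -> S k r <> 0 /\ exec ans c (S k) (S k.+1)) ->
  S n r = 0 -> exec ans (RWhile r c) (S 0) (S n).
Proof.
elim: n S => [|n IHn] S H S0; first exact: EStop.
have [s0 e0] := H 0 isT; apply: ELoop s0 e0 _.
by apply: (IHn (fun k => S k.+1)) => // k kn; apply: H.
Qed.

Ltac upd_eq := apply/funext => ?; rewrite /upd /=;
  repeat (case: eqP => ? /=); try (subst; lia).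

Ltac upd_red := rewrite /upd /=;
  repeat match goal with
  | |- context [?a == ?b] =>
      first [ have -> : (a == b) = true by apply/eqP; lia
            | have -> : (a == b) = false by apply/negbTE/eqP; lia ]; cbn [andb]
  end.

Definition rclear r := RWhile r (RDec r).

Lemma exec_clear ans r s : exec ans (rclear r) s (upd s r 0).
Proof.
apply: (exec_eq (exec_loop (n := s r) (S := fun k => upd s r (s r - k)) _ _)).
- move=> k ks; rewrite upd_same; split; first lia.
  by apply: (exec_eq (EDec _ _ _)); first reflexivity; upd_eq.
- by rewrite upd_same subnn.
- by upd_eq.
- by upd_eq.
Qed.

Definition rmove r t := RWhile r (RDec r ;; RInc t).

Lemma exec_move ans r t s : r <> t ->
  exec ans (rmove r t) s (upd (upd s r 0) t (s t + s r)).
Proof.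
move=> rt.
apply: (exec_eq (exec_loop (n := s r)
  (S := fun k => upd (upd s r (s r - k)) t (s t + k)) _ _)).
- move=> k ks; split; first by rewrite /upd eqxx; case: eqP => //; lia.
  apply: ESeq; first exact: EDec.
  by apply: (exec_eq (EInc _ _ _)); first reflexivity; upd_eq.
- by rewrite /upd eqxx; case: eqP => //; lia.
- by upd_eq.
- by upd_eq.
Qed.

Definition rcopy r t u := RWhile r (RDec r ;; RInc t ;; RInc u) ;; rmove u r.

Lemma exec_copy ans r t u s : r <> t -> r <> u -> t <> u -> s u = 0 ->
  exec ans (rcopy r t u) s (upd s t (s t + s r)).
Proof.
move=> rt ru tu su; apply: ESeq.
  apply: (exec_eq (exec_loop (n := s r)
    (S := fun k => upd (upd (upd s r (s r - k)) t (s t + k)) u k) _ _)).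
  - move=> k ks; split.
      by rewrite /upd eqxx; repeat (case: eqP => ? //); lia.
    apply: ESeq; first exact: EDec.
    apply: ESeq; first exact: EInc.
    by apply: (exec_eq (EInc _ _ _)); first reflexivity; upd_eq.
  - by rewrite /upd eqxx; repeat (case: eqP => ? //); lia.
  - by upd_eq.
  - reflexivity.
apply: (exec_eq (exec_move _ _ _)); [|reflexivity|by upd_eq].
by move=> E; apply: ru.
Qed.

Definition rpair p q o :=
  RWhile q (RDec q ;; RInc o ;; RInc p) ;;
  RWhile p (RWhile p (RDec p ;; RInc o ;; RInc q) ;; RDec q ;; rmove q p).

Lemma exec_pair ans p q o s : p <> q -> p <> o -> q <> o -> s o = 0 ->
  exec ans (rpair p q o) s
    (upd (upd (upd s p 0) q 0) o (npair (s p) (s q))).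
Proof.
move=> pq po qo so; apply: ESeq.
  apply: (exec_eq (exec_loop (n := s q)
    (S := fun k => upd (upd (upd s p (s p + k)) q (s q - k)) o k) _ _)).
  - move=> k ks; split.
      by rewrite /upd eqxx; repeat (case: eqP => ? //); lia.
    apply: ESeq; first exact: EDec.
    apply: ESeq; first exact: EInc.
    by apply: (exec_eq (EInc _ _ _)); first reflexivity; upd_eq.
  - by rewrite /upd eqxx; repeat (case: eqP => ? //); lia.
  - by upd_eq.
  - reflexivity.
rewrite npairE; move: (s q) (s p) => y x; rewrite subnn.
have -> : upd (upd (upd s p (x + y)) q 0) o y =
          upd (upd (upd s p (x + y)) q 0) o (y + \sum_(i < (x + y).+1) i -
             \sum_(i < (x + y).+1) i) by upd_eq.
have : \sum_(i < (x + y).+1) i <= y + \sum_(i < (x + y).+1) i by rewrite leq_addl.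
move: {x}(x + y) (y + _) => n m.
elim: n m => [|n IHn] m nm.
  apply: (exec_eq (EStop _ _ _)); [|reflexivity|].
    by rewrite /upd eqxx; repeat (case: eqP => ? //); lia.
  by rewrite big_ord_recr big_ord0 /=; upd_eq.
apply: ELoop; first by rewrite /upd eqxx; repeat (case: eqP => ? //); lia.
  apply: ESeq.
    apply: (exec_eq (exec_loop (n := n.+1)
      (S := fun k => upd (upd (upd s p (n.+1 - k)) q k) o
           (m - \sum_(i < n.+2) i + k)) _ _)).
    - move=> k ks; split.
        by rewrite /upd eqxx; repeat (case: eqP => ? //); lia.
      apply: ESeq; first exact: EDec.
      apply: ESeq; first exact: EInc.
      by apply: (exec_eq (EInc _ _ _)); first reflexivity; upd_eq.
    - by rewrite /upd eqxx; repeat (case: eqP => ? //); lia.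
    - by upd_eq.
    - reflexivity.
  apply: ESeq; first exact: EDec.
  by apply: exec_move => E; apply: pq.
apply: (exec_eq (IHn m _)); last reflexivity.
  by apply: leq_trans nm; rewrite [leqRHS]big_ord_recr leq_addr.
move: nm; rewrite [\sum_(i < n.+2) _]big_ord_recr /=.
move: (\sum_(i < n.+1) _) => a nm.
by upd_eq.
Qed.

(** The walk along the antidiagonals, with the coordinates in [x] and [y];
    the flag [f] survives exactly when the next antidiagonal begins, and [t]
    keeps [x] while it serves as the loop test. *)
Definition runpair r :=
  let x := r.+1 in let y := r.+2 in let f := r.+3 in let t := r.+4 in
  RWhile r (RDec r ;; RInc f ;;
    RWhile x (RDec x ;; RDec f ;; RInc y ;; rmove x t) ;; rmove t x ;;
    RWhile f (RDec f ;; rmove y x ;; RInc x)).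

Lemma exec_unpair ans r s : (forall i, r < i -> s i = 0) ->
  exec ans (runpair r) s
    (upd (upd (upd s r 0) r.+1 (proj0 (s r))) r.+2 (proj1 (s r))).
Proof.
move=> s0.
apply: (exec_eq (exec_loop (n := s r)
    (S := fun k => upd (upd (upd s r (s r - k)) r.+1 (proj0 k)) r.+2 (proj1 k))
    _ _)).
- move=> k ks; split.
    by rewrite /upd eqxx; repeat (case: eqP => ? //); lia.
  have := projS k; case: (proj0 k) => [|x] [-> ->]; move: (proj1 k) => y.
    apply: ESeq; first exact: EDec.
    apply: ESeq; first exact: EInc.
    apply: ESeq; first by apply: EStop; upd_red.
    apply: ESeq; first by apply: exec_move; lia.
    apply: ELoop; first by upd_red.
      apply: ESeq; first exact: EDec.
      by apply: ESeq; [apply: exec_move; lia | apply: EInc].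
    apply: (exec_eq (EStop _ _ _)); [|reflexivity|].
      by upd_red; rewrite s0; lia.
    apply/funext => i; upd_red; rewrite (s0 r.+3) ?(s0 r.+4); [|lia..].
    by have := s0 r.+3; have := s0 r.+4; repeat (case: eqP => ? /=); subst; lia.
  apply: ESeq; first exact: EDec.
  apply: ESeq; first exact: EInc.
  apply: ESeq; first apply: ELoop; first by upd_red.
      apply: ESeq; first exact: EDec.
      apply: ESeq; first exact: EDec.
      by apply: ESeq; [apply: EInc | apply: exec_move; lia].
    by apply: EStop; upd_red.
  apply: ESeq; first by apply: exec_move; lia.
  apply: (exec_eq (EStop _ _ _)); [|reflexivity|].
    by upd_red; rewrite s0; lia.
  apply/funext => i; upd_red; rewrite (s0 r.+3) ?(s0 r.+4); [|lia..].
  by have := s0 r.+3; have := s0 r.+4; repeat (case: eqP => ? /=); subst; lia.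
- by upd_red; rewrite subnn.
- have [p0 p1] : proj0 0 = 0 /\ proj1 0 = 0 by [].
  rewrite p0 p1 subn0 upd_id; apply/funext => i; rewrite /upd.
  case: eqP => [->|_]; first by rewrite s0; lia.
  by case: eqP => [->|_] //; rewrite s0; lia.
- by rewrite subnn.
Qed.

(** * A language of partial functions relative to an oracle *)

(** One argument is enough: several arguments, and later the environments of
    closures, are nested pairs. *)
Inductive fn : Type :=
  | Id
  | Const (n : nat)
  | Succ
  | Pred
  | Fst
  | Snd
  | Pair (f g : fn)
  | Comp (f g : fn)
  | Iter (f : fn)
  | While (c f : fn)
  | Ora.

(** [wp ans f x P]: some run of [f] on [x] has an output satisfying [P]. Being
    a predicate transformer, it reduces on a concrete program to a statement
    about numbers; a run need not be unique, since an oracle may be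
    inconsistent. *)
Fixpoint wp (ans : oracle_answer) (f : fn) (x : nat) (P : nat -> Prop) : Prop :=
  match f with
  | Id => P x
  | Const n => P n
  | Succ => P x.+1
  | Pred => P x.-1
  | Fst => P (proj0 x)
  | Snd => P (proj1 x)
  | Pair f g => wp ans f x (fun a => wp ans g x (fun b => P (npair a b)))
  | Comp f g => wp ans g x (fun y => wp ans f y P)
  | Iter f =>
      (fix it n y := if n is n'.+1 then wp ans f y (it n') else P y)
        (proj0 x) (proj1 x)
  | While c f => exists n,
      (fix loop n y := wp ans c y (fun b =>
         if b is 0 then P y else
         if n is n'.+1 then wp ans f y (loop n') else False)) n x
  | Ora => exists2 b : bool, ans x b & P b
  end.

(** Input and output are in register [r]. The registers above it are zero
    before and after, so a subprogram may use them freely. *)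
Fixpoint cmd_of (f : fn) (r : nat) : cmd :=
  match f with
  | Id => RSkip
  | Const n => rclear r ;; iter n (RSeq (RInc r)) RSkip
  | Succ => RInc r
  | Pred => RDec r
  | Fst => runpair r ;; rclear r.+2 ;; rmove r.+1 r
  | Snd => runpair r ;; rclear r.+1 ;; rmove r.+2 r
  | Pair f g => rcopy r r.+1 r.+2 ;; cmd_of f r.+1 ;; rmove r r.+2 ;;
      cmd_of g r.+2 ;; rpair r.+1 r.+2 r
  | Comp f g => cmd_of g r ;; cmd_of f r
  | Iter f => runpair r ;; rmove r.+1 r ;; rmove r.+2 r.+1 ;;
      RWhile r (RDec r ;; cmd_of f r.+1) ;; rmove r.+1 r
  | While c f =>
      let test := rcopy r.+1 r.+2 r.+3 ;; cmd_of c r.+2 ;; rmove r.+2 r in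
      rmove r r.+1 ;; test ;;
      RWhile r (rclear r ;; cmd_of f r.+1 ;; test) ;; rmove r.+1 r
  | Ora => rmove r 1 ;; RAsk r ;; rclear 1
  end.

(** Register 0 is kept for the input and register 1 for the queries. *)
Definition clean (s : nat -> nat) (r : nat) : Prop :=
  [/\ 1 < r, s 1 = 0 & forall i, r < i -> s i = 0].

Lemma clean_upd s r v : clean s r -> clean (upd s r v) r.
Proof.
move=> [r1 s1 s0]; split=> [//||i ri]; rewrite /upd; case: eqP => [?|_] //.
- by lia.
- by lia.
- exact: s0.
Qed.

Lemma clean_push s r v : clean s r -> clean (upd s r.+1 v) r.+1.
Proof.
move=> [r1 s1 s0]; split=> [||i ri]; first exact: leqW; rewrite /upd;
  case: eqP => [?|_] //.
- by lia.
- by lia.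
- by apply: s0; lia.
Qed.

Ltac frame_eq s0 r :=
  let i := fresh "i" in
  apply/funext => i; upd_red;
  move: (s0 i) (s0 r.+1) (s0 r.+2) (s0 r.+3);
  repeat (case: eqP => ? /=); subst; lia.

Lemma exec_fst ans r s : clean s r ->
  exec ans (cmd_of Fst r) s (upd s r (proj0 (s r))).
Proof.
move=> [r1 s1 s0]; apply: ESeq; first exact: exec_unpair.
apply: ESeq; first exact: exec_clear.
apply: (exec_eq (exec_move _ _ _)); [lia|reflexivity|].
move: (proj0 _) (proj1 _) => a b.
frame_eq s0 r.
Qed.

Lemma exec_snd ans r s : clean s r ->
  exec ans (cmd_of Snd r) s (upd s r (proj1 (s r))).
Proof.
move=> [r1 s1 s0]; apply: ESeq; first exact: exec_unpair.
apply: ESeq; first exact: exec_clear.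
apply: (exec_eq (exec_move _ _ _)); [lia|reflexivity|].
move: (proj0 _) (proj1 _) => a b.
frame_eq s0 r.
Qed.

Lemma exec_const ans n r s : exec ans (cmd_of (Const n) r) s (upd s r n).
Proof.
apply: ESeq; first exact: exec_clear.
suff : forall m, exec ans (iter n (RSeq (RInc r)) RSkip) (upd s r m) (upd s r
  (m + n)).
  exact.
elim: n => [|n IHn] m /=; first by rewrite addn0; apply: ESkip.
apply: ESeq; first exact: EInc.
by rewrite upd_upd upd_same -addSnnS; apply: IHn.
Qed.

Lemma exec_seq ans c d s s2 : exec ans (c ;; d) s s2 ->
  exists2 s1, exec ans c s s1 & exec ans d s1 s2.
Proof. by move=> e; inversion e as [| | | |? ? ? t ? ec ed| |]; exists t. Qed.

Definition frame (s : nat -> nat) r x y := upd (upd s r x) r.+1 y.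

Lemma wp_exec ans f r s P : wp ans f (s r) P -> clean s r ->
  exists2 v, P v & exec ans (cmd_of f r) s (upd s r v).
Proof.
elim: f r s P => [|n|||||f IHf g IHg|f IHf g IHg|f IHf|c IHc f IHf|] r s P /=.
- by move=> Px _; exists (s r) => //; rewrite upd_id; apply: ESkip.
- by move=> Px _; exists n => //; apply: exec_const.
- by move=> Px _; exists (s r).+1 => //; apply: EInc.
- by move=> Px _; exists (s r).-1 => //; apply: EDec.
- by move=> Px cl; exists (proj0 (s r)) => //; apply: exec_fst.
- by move=> Px cl; exists (proj1 (s r)) => //; apply: exec_snd.
- move=> H cl; have [r1 s1 s0] := cl.
  have := IHf r.+1 (upd s r.+1 (s r)).
  rewrite upd_same => /(_ _ H (clean_push _ cl))[a Ha ea].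
  have cl2 : clean (upd (upd (upd s r 0) r.+1 a) r.+2 (s r)) r.+2.
    by do 2 apply: clean_push; apply: clean_upd.
  have := IHg r.+2 (upd (upd (upd s r 0) r.+1 a) r.+2 (s r)).
  rewrite upd_same => /(_ _ Ha cl2)[b Hb eb].
  exists (npair a b) => //.
  apply: ESeq; first by apply: exec_copy; rewrite ?s0; lia.
  rewrite s0 // add0n.
  apply: ESeq; first exact: ea.
  apply: ESeq; first by apply: exec_move; lia.
  apply: ESeq.
    apply: (exec_eq eb); last reflexivity.
    by rewrite upd_upd; frame_eq s0 r.
  apply: (exec_eq (exec_pair _ _ _ _ _)); [lia|lia|lia| |reflexivity|].
    by upd_red.
  rewrite upd_upd; upd_red; frame_eq s0 r.
- move=> H cl.
  have [b Hb eb] := IHg r s _ H cl.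
  have := IHf r (upd s r b) P.
  rewrite upd_same => /(_ Hb (clean_upd _ cl))[v Hv ev].
  by exists v => //; apply: ESeq eb _; rewrite upd_upd in ev.
- move=> H cl; have [r1 s1 s0] := cl.
  move: H; set n := proj0 _; set y := proj1 _ => H.
  have [v Pv ev] : exists2 v, P v &
      exec ans (RWhile r (RDec r ;;
        cmd_of f r.+1)) (frame s r n y) (frame s r 0 v).
    elim: n y H => [|n IHn] y H.
      by exists y => //; apply: EStop; rewrite /frame; upd_red.
    have := IHf r.+1 (frame s r n y).
    rewrite /frame upd_same.
    move=> /(_ _ H (clean_push _ (clean_upd _ cl)))[z Hz ez].
    have [v Pv ev] := IHn z Hz; exists v => //.
    apply: ELoop; last exact: ev; first by rewrite /frame; upd_red.
    apply: ESeq; first exact: EDec.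
    apply: (exec_eq ez); rewrite /frame ?upd_upd //.
    by frame_eq s0 r.
  exists v => //.
  apply: ESeq; first exact: exec_unpair.
  apply: ESeq; first by apply: exec_move; lia.
  apply: ESeq; first by apply: exec_move; lia.
  apply: ESeq.
    apply: (exec_eq ev); last reflexivity.
    rewrite /frame -/n -/y; frame_eq s0 r.
  apply: (exec_eq (exec_move _ _ _)); [lia|reflexivity|].
  rewrite /frame; frame_eq s0 r.
- move=> [n H] cl; have [r1 s1 s0] := cl.
  set test := (X in rmove r r.+1 ;; X ;; _).
  have etest y Q : wp ans c y Q -> exists2 b, Q b &
      exec ans test (frame s r 0 y) (frame s r b y).
    move=> Hc; have := IHc r.+2 (upd (frame s r 0 y) r.+2 y) Q.
    rewrite upd_same /frame.
    move=> /(_ Hc (clean_push _ (clean_push _ (clean_upd _ cl))))[b Qb eb].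
    exists b => //; apply: ESeq.
      apply: exec_copy; try lia.
      by rewrite /frame; upd_red; rewrite s0; lia.
    apply: ESeq.
      apply: (exec_eq eb); last reflexivity.
      by rewrite /frame; frame_eq s0 r.
    apply: (exec_eq (exec_move _ _ _)); [lia|reflexivity|].
    rewrite /frame; frame_eq s0 r.
  set body := (rclear r ;; _).
  suff [v Pv ev] : exists2 v, P v &
      exec ans (test ;; RWhile r body) (frame s r 0 (s r)) (frame s r 0 v).
    exists v => //.
    apply: ESeq; first by apply: exec_move; lia.
    have [s2 e1 e2] := exec_seq ev.
    apply: ESeq; first apply: (exec_eq e1); [|reflexivity|].
      rewrite /frame; frame_eq s0 r.
    apply: ESeq; first exact: e2.
    apply: (exec_eq (exec_move _ _ _)); [lia|reflexivity|].
    rewrite /frame; frame_eq s0 r.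
  elim: n (s r) H => [|n IHn] y /etest[b Qb eb].
    case: b Qb eb => // Py eb; exists y => //.
    by apply: ESeq eb _; apply: EStop; rewrite /frame; upd_red.
  case: b Qb eb => [|b] Qb eb.
    exists y => //.
    by apply: ESeq eb _; apply: EStop; rewrite /frame; upd_red.
  have := IHf r.+1 (frame s r 0 y); rewrite /frame upd_same.
  move=> /(_ _ Qb (clean_push _ (clean_upd _ cl)))[z Hz ez].
  have [v Pv ev] := IHn z Hz; exists v => //.
  have [s2 e1 e2] := exec_seq ev.
  apply: ESeq; first exact: eb.
  apply: ELoop; last exact: e2; first by rewrite /frame; upd_red.
  apply: ESeq; first exact: exec_clear.
  apply: ESeq.
    apply: (exec_eq ez); last reflexivity.
    rewrite /frame; frame_eq s0 r.
  by apply: (exec_eq e1); rewrite /frame ?upd_upd.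
- move=> [b ab Pb] [r1 s1 s0]; exists (nat_of_bool b) => //.
  apply: ESeq; first by apply: exec_move; lia.
  apply: ESeq; first apply: (EAsk _ (b := b)).
    by rewrite upd_same s1.
  apply: (exec_eq (exec_clear _ _ _)); first reflexivity.
  apply/funext => i; upd_red.
  by repeat (case: eqP => ? /=); subst; lia.
Qed.

Lemma wp_mono ans f x P Q : (forall v, P v -> Q v) -> wp ans f x P -> wp ans f
  x Q.
Proof.
elim: f x P Q => [|n|||||f IHf g IHg|f IHf g IHg|f IHf|c IHc f IHf|] x P Q PQ /=;
  try exact: PQ.
- by apply: IHf => a; apply: IHg => b; apply: PQ.
- by apply: IHg => y; apply: IHf.
- elim: (proj0 x) (proj1 x) => [|n IHn] y; first exact: PQ.
  by apply: IHf => z; apply: IHn.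
- move=> [n H]; exists n; elim: n x H => [|n IHn] x; apply: IHc => -[|b] //.
  + exact: PQ.
  + exact: PQ.
  + by apply: IHf => z; apply: IHn.
- by move=> [b ab /PQ Pb]; exists b.
Qed.

Fixpoint relativize (g f : fn) : fn :=
  match f with
  | Pair f1 f2 => Pair (relativize g f1) (relativize g f2)
  | Comp f1 f2 => Comp (relativize g f1) (relativize g f2)
  | Iter f1 => Iter (relativize g f1)
  | While f1 f2 => While (relativize g f1) (relativize g f2)
  | Ora => g
  | _ => f
  end.

(** An oracle may be replaced by a subroutine that gives the answers it gives;
    at the queries which the oracle leaves open the subroutine may do anything. *)
Lemma wp_relativize (ans ans' : oracle_answer) g f x P :
  (forall p (b : bool), ans p b -> wp ans' g p (fun v => v = b)) ->
  wp ans f x P -> wp ans' (relativize g f) x P.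
Proof.
move=> H; elim: f x P =>
  [|n|||||f IHf h IHh|f IHf h IHh|f IHf|c IHc f IHf|] x P //=.
- by move/IHf; apply: wp_mono => a; apply: IHh.
- by move/IHh; apply: wp_mono => y; apply: IHf.
- elim: (proj0 x) (proj1 x) => [|n IHn] y //.
  by move/IHf; apply: wp_mono => z; apply: IHn.
- move=> [n Hn]; exists n; elim: n x Hn => [|n IHn] x /IHc;
  apply: wp_mono => -[|b] //.
  by move/IHf; apply: wp_mono => z; apply: IHn.
- by move=> [b /H gx Pb]; apply: wp_mono gx => _ ->.
Qed.

(** * Indices computed from parameters *)

(** For a program that halts without queries one reasons about the function
    [F] only, which the hints of the database [pure] build along the program. *)
Definition pure (f : fn) (F : nat -> nat) : Prop :=
  forall ans x (P : nat -> Prop), P (F x) -> wp ans f x P.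

Lemma pure_eq f F G : pure f F -> F =1 G -> pure f G.
Proof. by move=> fF FG ans x P; rewrite -FG; apply: fF. Qed.

Lemma pure_id : pure Id id. Proof. by []. Qed.
Lemma pure_const n : pure (Const n) (fun=> n). Proof. by []. Qed.
Lemma pure_succ : pure Succ succn. Proof. by []. Qed.
Lemma pure_pred : pure Pred predn. Proof. by []. Qed.
Lemma pure_fst : pure Fst proj0. Proof. by []. Qed.
Lemma pure_snd : pure Snd proj1. Proof. by []. Qed.

Lemma pure_pair f g F G : pure f F -> pure g G ->
  pure (Pair f g) (fun x => npair (F x) (G x)).
Proof. by move=> fF gG ans x P H; apply: fF; apply: gG. Qed.

Lemma pure_comp f g F G : pure f F -> pure g G ->
  pure (Comp f g) (fun x => F (G x)).
Proof. by move=> fF gG ans x P H; apply: gG; apply: fF. Qed.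

Lemma pure_iter f F : pure f F ->
  pure (Iter f) (fun x => iter (proj0 x) F (proj1 x)).
Proof.
move=> fF ans x P /=; elim: (proj0 x) (proj1 x) => [|n IHn] y //.
by rewrite iterSr => H; apply: fF; apply: IHn.
Qed.

Create HintDb pure.
Hint Resolve pure_id pure_const pure_succ pure_pred pure_fst pure_snd
  pure_pair pure_comp pure_iter : pure.

Ltac pure_by x := eapply pure_eq; [solve [eauto 100 with pure] | intro x].

Lemma wp_of_pure ans f F x (P : nat -> Prop) : pure f F -> P (F x) -> wp ans f
  x P.
Proof. by move=> fF; apply: fF. Qed.

Ltac wp_pure := eapply wp_of_pure; [solve [eauto 100 with pure] | cbv beta].

Definition Double := Comp (Iter (Comp Succ Succ)) (Pair Id (Const 0)).

Lemma pure_double : pure Double double.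
Proof.
rewrite /Double; pure_by x; rewrite !projE.
by elim: x => //= n ->; rewrite doubleS.
Qed.
Hint Resolve pure_double : pure.

Definition Cons := Comp (Iter Double) (Pair Fst (Comp Succ (Comp Double Snd))).

Definition codecons (a m : nat) := CodeSeq.code (a :: CodeSeq.decode m).

Lemma pure_cons : pure Cons (fun x => codecons (proj0 x) (proj1 x)).
Proof.
rewrite /Cons; pure_by x; rewrite !projE /codecons /= CodeSeq.decodeK.
move: (_.+1) => m; elim: (proj0 x) => [|n IHn] /=; first by rewrite mul1n.
by rewrite IHn -mul2n expnS mulnA.
Qed.

Definition ConsOf f g := Comp Cons (Pair f g).

Lemma pure_cons_of f g F G : pure f F -> pure g G ->
  pure (ConsOf f g) (fun x => codecons (F x) (G x)).
Proof.
move=> fF gG.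
eapply pure_eq; first exact: pure_comp pure_cons (pure_pair fF gG).
by move=> x; rewrite !projE.
Qed.
Hint Resolve pure_cons_of : pure.

Lemma code_cons a s : CodeSeq.code (a :: s) = codecons a (CodeSeq.code s).
Proof. by rewrite /codecons CodeSeq.codeK. Qed.

Lemma code_nil : CodeSeq.code [::] = 0. Proof. by []. Qed.

Lemma code_consE a s : CodeSeq.code (a :: s) = 2 ^ a * (CodeSeq.code s).*2.+1.
Proof. by []. Qed.

Lemma proj00 : proj0 0 = 0. Proof. by []. Qed.
Lemma proj10 : proj1 0 = 0. Proof. by []. Qed.
Lemma npair00 : npair 0 0 = 0. Proof. by []. Qed.

(** Closed terms made of these functions are unary numbers of astronomical
    size; reduction must not touch them. *)
Opaque CodeSeq.code npair proj0 proj1.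

Definition enc_move (d : move) : nat := if d is ToRight then 1 else 0.

Definition enc_instr (i : instr) : nat :=
  match i with
  | Act t (b0, d0, q0) (b1, d1, q1) =>
      CodeSeq.code
        [:: t; nat_of_bool b0; enc_move d0; q0; nat_of_bool b1; enc_move d1; q1]
  | Ask y n => CodeSeq.code [:: y; n]
  | Stop => 0
  end.

Lemma enc_instrK : cancel enc_instr decode_instr.
Proof.
case=> [t [[b0 d0] q0] [[b1 d1] q1]|y n|] //; rewrite /decode_instr;
  last by rewrite CodeSeq.codeK.
rewrite CodeSeq.codeK /decode_action !oddb.
by case: d0; case: d1.
Qed.

Lemma machine_of_code P : machine_of (CodeSeq.code (map enc_instr P)) = P.
Proof. by rewrite /machine_of CodeSeq.codeK (mapK enc_instrK). Qed.

(** The machine with parameter k is a front part, the same for all k, followed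
    by k + 1 increments of register 2, the last of which jumps back into the
    front part. Only the tail depends on k, and regularly so; this makes the
    code of the machine a computable function of k. States 0 and 1 turn the
    input into a counter, the tail begins at state [L] and leads to state 2,
    where [body] begins. *)
Section Layout.
Variable body : cmd.

Let L := (2 + size (code_of body 2)).+1.
Let front :=
  [:: Act 0 (false, ToRight, 1) (true, ToRight, 0); act 0 false ToLeft L]
  ++ code_of body 2 ++ [:: Stop].
Let inc q := act 2 true ToRight q.
Let tail j i := [seq inc (L + t.+1) | t <- iota j i] ++ [:: inc 2].
Let prog k := front ++ tail 0 k.

Lemma size_front : size front = L.
Proof. by rewrite /front !size_cat /= addn1. Qed.

Lemma run_input ans P m :
  placed P 0 [:: Act 0 (false, ToRight, 1) (true, ToRight, 0);
    act 0 false ToLeft L] ->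
  exists2 T, runs P ans (init m) (L, T) & counters (upd (fun=> 0) 0 m) T.
Proof.
move=> pl; have E0 := pl 0 isT; have E1 := pl 1 isT.
rewrite /= ?addn0 ?addn1 in E0 E1.
pose tp i := (nseq i true, head false (nseq (m - i) true), behead (nseq (m - i)
  true)).
have scan i : i <= m ->
    runs P ans (0, upd (fun=> blank_tape) 0 (tp 0))
      (0, upd (fun=> blank_tape) 0 (tp i)).
  elim: i => [|i IHi] im; first exact: runs_refl.
  apply: runs_trans (IHi (ltnW im)) _.
  apply: (runs_act_upd E0 (b := true) (d := ToRight) (q' := 0)).
    by rewrite /tp /=; case: (m - i) (subn_gt0 i m) => //; rewrite im.
  rewrite /tp /= -(subnSK im) /=; case: (m - i.+1) => [|k] /=; exact: runs_refl.
exists (upd (fun=> blank_tape) 0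
         (write_move false ToLeft (write_move false ToRight (tp m)))).
  have -> : init m = (0, upd (fun=> blank_tape) 0 (tp 0)).
    by rewrite /init /tp subn0.
  apply: runs_trans (scan m (leqnn m)) _.
  apply: (runs_act_upd E0 (b := false) (d := ToRight) (q' := 1)).
    by rewrite /tp subnn.
  apply: (runs_act_upd E1 (b := false) (d := ToLeft) (q' := L)).
    by case: (scanned _).
  exact: runs_refl.
apply: counters_upd; first by move=> t; exists 0, 0.
by apply: counter_jump; exists 0, 0; rewrite /tp subnn cats0.
Qed.

Lemma run_tail ans P k :
  placed P L (tail 0 k) ->
  forall j i s T, j + i = k -> counters s T -> 
  exists2 T', runs P ans (L + j, T) (2, T') & counters (upd s 2 (s 2 + i.+1)) T'.
Proof.
move=> pl j i; elim: i j => [|i IHi] j s T jik sT.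
  have E : nth Stop P (L + j) = inc 2.
    rewrite pl; last by rewrite size_cat size_map size_iota /=; lia.
    have -> : j = k by lia.
    by rewrite nth_cat size_map size_iota ltnn subnn.
  exists (upd T 2 (write_move true ToRight (T 2))).
    apply: (runs_act E (b := true) (d := ToRight) (q' := 2)).
      by case: (scanned _).
    exact: runs_refl.
  by rewrite addn1; exact: counters_upd sT (counter_right (sT 2)).
have E : nth Stop P (L + j) = inc (L + j.+1).
  rewrite pl; last by rewrite size_cat size_map size_iota /=; lia.
  rewrite nth_cat size_map size_iota.
  have jk : j < k by lia.
  by rewrite jk (nth_map 0) ?size_iota // nth_iota.
have sT' : counters (upd s 2 (s 2).+1) (upd T 2 (write_move true ToRight (T 2))).
  exact: counters_upd sT (counter_right (sT 2)).
have [T' r sT''] := IHi j.+1 _ _ (etrans (addSnnS _ _) jik) sT'.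
exists T'.
  apply: (runs_act E (b := true) (d := ToRight) (q' := L + j.+1)) r.
  by case: (scanned _).
by rewrite upd_upd upd_same addSnnS in sT''.
Qed.

Lemma run_prog ans k m s' :
  exec ans body (upd (upd (fun=> 0) 0 m) 2 k.+1) s' ->
  computes ans (CodeSeq.code (map enc_instr (prog k))) m (s' 0).
Proof.
move=> eb; rewrite /computes /computes_in machine_of_code.
have plall : placed (prog k) 0 (prog k) by move=> i _; rewrite add0n.
have /placed_cat[plf plt] := plall.
rewrite add0n size_front in plt.
have /placed_cat[pl0 /placed_cat[plb pls]] := plf.
have [T1 r1 sT1] := run_input ans m pl0.
have [T2 r2 sT2] := run_tail ans plt (erefl (0 + k)) sT1.
rewrite addn0 in r2.
have [T3 r3 sT3] := exec_runs eb plb sT2.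
have [t st] := runs_trans r1 (runs_trans r2 r3).
exists t, (2 + size (code_of body 2), T3); split=> //.
  by have := pls 0 isT; rewrite addn0.
by rewrite (counter_ones (sT3 0)).
Qed.

Lemma pure_prog :
  exists g, pure g (fun k => CodeSeq.code (map enc_instr (prog k))).
Proof.
pose Target := iter L (Comp Succ) Id.
have tT : pure Target (addn L).
  by rewrite /Target; elim: L => //= n IHn; apply: pure_comp pure_succ IHn.
pose IncTo := ConsOf (Const 2) (ConsOf (Const 1) (ConsOf (Const 1) (ConsOf Target
   (ConsOf (Const 1) (ConsOf (Const 1) (ConsOf Target (Const 0))))))).
have tI : pure IncTo (fun j => enc_instr (inc (L + j))).
  by rewrite /IncTo; pure_by x; rewrite -[RHS]/(CodeSeq.code [:: 2; 1; 1;
    L + x; 1; 1; L + x]) !code_cons.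
pose Step := Pair (Comp Pred Fst) (ConsOf (Comp IncTo Fst) Snd).
have [c0 c0E] : exists c0, c0 = CodeSeq.code [:: enc_instr (inc 2)] by eexists.
pose Tail := Comp Snd (Comp (Iter Step) (Pair Id (Pair Id (Const c0)))).
have tt : pure Tail (fun k => CodeSeq.code (map enc_instr (tail 0 k))).
  rewrite /Tail /Step; eapply pure_eq.
    refine (pure_comp pure_snd (pure_comp (pure_iter (pure_pair
      (pure_comp pure_pred pure_fst)
      (pure_cons_of (pure_comp tI pure_fst) pure_snd)))
      (pure_pair pure_id (pure_pair pure_id (@pure_const c0))))).
  move=> k; rewrite !projE.
  have E i : i <= k ->
      iter i (fun x => npair (proj0 x).-1
         (codecons (enc_instr (inc (L + proj0 x))) (proj1 x))) (npair k c0) =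
      npair (k - i) (CodeSeq.code (map enc_instr (tail (k - i) i))).
    elim: i => [|i IHi] ik; first by rewrite subn0 c0E; exact: erefl.
    rewrite iterS (IHi (ltnW ik)) !projE -(subnSK ik) succnK.
    have -> j : tail j i.+1 = inc (L + j.+1) :: tail j.+1 i by exact: erefl.
    rewrite map_cons code_cons; exact: erefl.
  rewrite (E k (leqnn k)) projE subnn; exact: erefl.
exists (foldr (fun a g => ConsOf (Const a) g) Tail (map enc_instr front)).
apply: (@pure_eq _ (fun k =>
  CodeSeq.code (map enc_instr front ++ map enc_instr (tail 0 k)))); last first.
  move=> k; rewrite /prog map_cat; exact: erefl.
elim: (map enc_instr front) => [|a s IHs] /=; first exact: tt.
apply: pure_eq (pure_cons_of (@pure_const a) IHs) _ => k.
rewrite -code_cons; exact: erefl.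
Qed.

End Layout.

Lemma clos_spec f : exists clos : nat -> nat,
  (exists g : fn, pure g clos) /\
  forall ans k m P, wp ans f (npair m k) P ->
    exists2 v, P v & computes ans (clos k) m v.
Proof.
pose body := RDec 2 ;; rpair 0 2 3 ;; cmd_of f 3 ;; rmove 3 0.
have [g gP] := pure_prog body.
eexists; split; first by exists g; exact: gP.
move=> ans k m P H.
(* [body] starts with a decrement since the tail has loaded k + 1 *)
pose s2 := upd (upd (fun=> 0) 0 m) 2 k.+1.
pose s3 := upd (upd (upd (upd s2 2 k) 0 0) 2 0) 3 (npair m k).
have cl : clean s3 3.
  split=> // i i3; rewrite /s3 /s2 /upd; repeat (case: eqP => ?; try lia).
have := @wp_exec ans f 3 s3 P; rewrite {1}/s3 upd_same => /(_ H cl)[v Pv ev].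
have eb : exec ans body s2 (upd (upd (upd s3 3 v) 3 0) 0 v).
  apply: ESeq; first exact: EDec.
  apply: ESeq; first exact: exec_pair.
  apply: ESeq; first exact: ev.
  by apply: (exec_eq (exec_move _ _ _)).
exists v => //.
exact: run_prog eb.
Qed.

(** [clos f k] is an index of the function that sends m to f <m, k>. It comes
    from a choice operator, which keeps its value out of reach of reduction. *)
Definition clos f : nat -> nat := projT1 (cid (clos_spec f)).
Definition Lam f : fn := projT1 (cid (projT2 (cid (clos_spec f))).1).

Lemma pure_lam f : pure (Lam f) (clos f).
Proof. by rewrite /Lam /clos; case: cid => c /= [[g gP] H]; case: cid. Qed.

Lemma wp_clos ans f k m P : wp ans f (npair m k) P ->
  exists2 v, P v & computes ans (clos f k) m v.
Proof. by rewrite /clos; case: cid => c /= [_ H]; apply: H. Qed.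
Opaque Double.

(** * Arithmetic and sequences *)

Definition Not := Comp (Iter (Const 0)) (Pair Id (Const 1)).

Lemma pure_not : pure Not (fun x => x == 0).
Proof. by rewrite /Not; pure_by x; rewrite !projE; case: x => //= n; elim: n. Qed.
Hint Resolve pure_not : pure.
Opaque Not.

(** Each branch is iterated 0 or 1 times, so the branch that is not taken is
    not started: it may diverge or query the oracle. *)
Definition If c f g :=
  Comp (Comp (Iter g) (Pair Fst (Comp (Iter f) Snd)))
    (Comp (Pair (Comp Not Fst) (Pair (Comp Not (Comp Not Fst)) Snd)) (Pair c Id)).

Lemma wp_if ans c f g x (P : nat -> Prop) :
  wp ans c x (fun b => if b == 0 then wp ans g x P else wp ans f x P) ->
  wp ans (If c f g) x P.
Proof.
move=> /=; apply: wp_mono => b H.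
rewrite !projE; apply: pure_not; apply: pure_not; apply: pure_not.
rewrite !projE; case: eqP H => _ /= H; first by rewrite !projE.
by apply: wp_mono H => v; rewrite !projE.
Qed.

Lemma pure_if c f g C F G : pure c C -> pure f F -> pure g G ->
  pure (If c f g) (fun x => if C x == 0 then G x else F x).
Proof.
move=> cC fF gG ans x P H; apply: wp_if; apply: cC.
by case: eqP H => _ H; [apply: gG | apply: fF].
Qed.
Hint Resolve pure_if : pure.
Opaque If.

Definition Odd := Comp (Iter Not) (Pair Id (Const 0)).

Lemma pure_odd : pure Odd odd.
Proof.
by rewrite /Odd; pure_by x; rewrite !projE; elim: x => //= n ->; case: odd.
Qed.
Hint Resolve pure_odd : pure.
Opaque Odd.

(** Two counters are increased in turn. *)
Definition Half := Comp Fst (Comp (Iter (Pair Snd (Comp Succ Fst)))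
  (Pair Id (Const 0))).

Lemma pure_half : pure Half half.
Proof.
rewrite /Half; pure_by x; rewrite !projE.
have -> : iter x (fun y => npair (proj1 y) (proj0 y).+1) 0 =
          npair x./2 (uphalf x); last by rewrite projE.
by elim: x => // n IHn; rewrite iterS IHn !projE uphalfE.
Qed.
Hint Resolve pure_half : pure.
Opaque Half.

Definition Add := Iter Succ.

Lemma pure_add : pure Add (fun x => proj0 x + proj1 x).
Proof.
by rewrite /Add; pure_by x; elim: (proj0 x) => //= n ->.
Qed.
Hint Resolve pure_add : pure.
Opaque Add.

Definition Nth := Comp Fst (Iter Snd).

(** Every number is an infinite sequence, by repeated unpairing; as 0 is the
    pair of 0 and 0, finite sequences continue with zeros. *)
Definition nthp (s i : nat) := proj0 (iter i proj1 s).

Lemma pure_nth : pure Nth (fun x => nthp (proj1 x) (proj0 x)).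
Proof. by rewrite /Nth; pure_by x. Qed.
Hint Resolve pure_nth : pure.
Opaque Nth.

(** To change item i, walk to it while stacking the items passed, and walk
    back. *)
Definition zip_right (z : nat) :=
  npair (npair (proj0 (proj1 z)) (proj0 z)) (proj1 (proj1 z)).
Definition zip_left (z : nat) :=
  npair (proj1 (proj0 z)) (npair (proj0 (proj0 z)) (proj1 z)).
Fixpoint set_nthp (i v s : nat) : nat :=
  if i is j.+1 then npair (proj0 s) (set_nthp j v (proj1 s))
  else npair v (proj1 s).

Lemma nthp_set i v s j : nthp (set_nthp i v s) j = if j == i then v else nthp s j.
Proof.
elim: i s j => [|i IHi] s [|j]; rewrite /nthp ?iterSr /= !projE //.
by have := IHi (proj1 s) j; rewrite /nthp eqSS.
Qed.

Lemma zip_set i v l s :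
  let z := iter i zip_right (npair l s) in
  iter i zip_left (npair (proj0 z) (npair v (proj1 (proj1 z)))) =
  npair l (set_nthp i v s).
Proof.
elim: i l s => [|i IHi] l s; first by rewrite /= !projE.
have := IHi (npair (proj0 s) l) (proj1 s).
rewrite iterSr {3}/zip_right !projE /= => ->.
by rewrite /zip_left !projE.
Qed.

Definition SetNth :=
  Comp Snd (Comp (Iter (Pair (Comp Snd Fst) (Pair (Comp Fst Fst) Snd)))
    (Pair Fst (Comp
      (Pair (Comp Fst Snd) (Pair Fst (Comp Snd (Comp Snd Snd))))
      (Pair (Comp Fst Snd)
        (Comp (Iter (Pair (Pair (Comp Fst Snd) Fst) (Comp Snd Snd)))
          (Pair Fst (Pair (Const 0) (Comp Snd Snd)))))))).

Lemma pure_set_nth :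
  pure SetNth (fun x => set_nthp (proj0 x) (proj0 (proj1 x)) (proj1 (proj1 x))).
Proof.
rewrite /SetNth; pure_by x; rewrite !projE.
set i := proj0 x; set v := proj0 (proj1 x).
by rewrite -(projE.2 0 (set_nthp i v _)) -(zip_set i v).

Qed.
Hint Resolve pure_set_nth : pure.
Opaque SetNth.

(** A nonzero code is 2^a (2m + 1), for the head a and the code m of the tail.
    Evenness is tested as many times as the code says, which is more than a
    times. *)
Definition Uncons :=
  Comp (Pair Fst (Comp Half Snd))
    (Comp (Iter (If (Comp Odd Snd) Id (Pair (Comp Succ Fst) (Comp Half Snd))))
      (Pair Id (Pair (Const 0) Id))).

Definition uncons (n : nat) : nat :=
  let s := CodeSeq.decode n in npair (head 0 s) (CodeSeq.code (behead s)).

Lemma pure_uncons : pure Uncons uncons.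
Proof.
rewrite /Uncons; pure_by x; rewrite !projE.
rewrite -(CodeSeq.decodeK x); case: (CodeSeq.decode x) => [|a s].
  by rewrite /uncons CodeSeq.codeK code_nil /= !projE.
rewrite /uncons CodeSeq.codeK /= code_consE.
move: (CodeSeq.code s) => m.
have E i k b : iter (i + k) (fun x0 => if odd (proj1 x0) == 0 :> nat then
     npair (proj0 x0).+1 (proj1 x0)./2 else x0) (npair b (2 ^ i * m.*2.+1)) =
     npair (b + i) m.*2.+1.
  elim: i b => [|i IHi] b.
    rewrite mul1n addn0; elim: k => // k IHk.
    by rewrite iterS IHk !projE /= odd_double.
  rewrite addSn iterSr !projE expnS -mulnA mul2n odd_double /= doubleK IHi.
  by rewrite addSnnS.
have ak : 2 ^ a * m.*2.+1 = a + (2 ^ a * m.*2.+1 - a).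
  have : a < 2 ^ a by apply: ltn_expl.
  nia.
have {E}E := E a (2 ^ a * m.*2.+1 - a) 0; rewrite -ak add0n in E.
by rewrite E !projE /= uphalf_double.
Qed.
Hint Resolve pure_uncons : pure.
Opaque Uncons.

Definition Tails := Iter (Comp Snd Uncons).

Definition tails (x : nat) : nat :=
  CodeSeq.code (drop (proj0 x) (CodeSeq.decode (proj1 x))).

Lemma pure_tails : pure Tails tails.
Proof.
rewrite /Tails; pure_by x; rewrite /tails.
move: (proj0 x) (proj1 x) => i n; elim: i n => [|i IHi] n.
  by rewrite drop0 CodeSeq.decodeK.
rewrite iterSr IHi /uncons projE CodeSeq.codeK.
by case: (CodeSeq.decode n).
Qed.
Hint Resolve pure_tails : pure.
Opaque Tails.

Definition Item := Comp Fst (Comp Uncons Tails).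

Definition item (x : nat) : nat := nth 0 (CodeSeq.decode (proj1 x)) (proj0 x).

Lemma pure_item : pure Item item.
Proof.
rewrite /Item; pure_by x; rewrite /item /uncons /tails CodeSeq.codeK projE.
by rewrite -nth0 nth_drop addn0.
Qed.
Hint Resolve pure_item : pure.
Opaque Item.

Definition Items n :=
  If (Comp Tails (Pair (Const n.+1) Id)) (Const 0)
    (If (Comp Tails (Pair (Const n) Id)) (Const 1) (Const 0)).

Lemma code_eq0 s : (CodeSeq.code s == 0) = nilp s.
Proof.
case: s => [|a s]; first by rewrite code_nil.
by rewrite code_consE muln_eq0 expn_eq0.
Qed.

Lemma pure_items n : pure (Items n) (fun x => size (CodeSeq.decode x) == n.+1).
Proof.
rewrite /Items; pure_by x; rewrite /tails !projE !code_eq0 /nilp !size_drop.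
rewrite !subn_eq0; set z := size _.
by case: (leqP z n.+1); case: (leqP z n); case: (z =P n.+1) => //=; lia.
Qed.
Hint Resolve pure_items : pure.
Opaque Items.

(** * The universal machine *)

(** The nearest symbol comes first, and the infinitely many blanks after the
    last recorded symbol are the zeros at the end of every finite sequence. *)
Definition bits_code (l : seq bool) : nat := foldr (fun (b : bool) n =>
  npair b n) 0 l.

Definition tape_code (w : tape) : nat :=
  let: (l, a, r) := w in npair (bits_code l) (npair a (bits_code r)).

Lemma head_bits l : proj0 (bits_code l) = head false l.
Proof. by case: l => [|b l] /=; rewrite ?proj00 ?projE. Qed.

Lemma behead_bits l : proj1 (bits_code l) = bits_code (behead l).
Proof. by case: l => [|b l] /=; rewrite ?proj10 ?projE. Qed.

Definition Count :=
  Comp Snd (While Fst (Pair (Comp Snd Fst) (Comp Add (Pair (Comp Fst Fst) Snd)))).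

Lemma wp_count ans l a (P : nat -> Prop) :
  P (a + count id l) -> wp ans Count (npair (bits_code l) a) P.
Proof.
move=> H; exists (size l).
elim: l a H => [|b l IHl] a H; rewrite /= !projE; first by rewrite addn0 in H.
case E: (npair b _) => [|n].
  have E0 := head_bits (b :: l); have E1 := behead_bits (b :: l).
  rewrite /= E ?proj00 ?proj10 in E0 E1.
  have cz : count id l = 0.
    move: E1; clear; elim: l => //= c l IHl E.
    have E0 := head_bits (c :: l); have E1 := behead_bits (c :: l).
    rewrite /= -E ?proj00 ?proj10 in E0 E1.
    by rewrite -E0 IHl.
by move: H; rewrite /= -E0 cz !addn0.
apply: pure_add; rewrite !projE; apply: IHl.
by rewrite [b + a]addnC -addnA.
Qed.

Definition Ones :=
  Comp Count (Pair (Comp Snd Snd)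
    (Comp Add (Pair (Comp Fst Snd) (Comp Count (Pair Fst (Const 0)))))).

Lemma wp_ones ans w (P : nat -> Prop) :
  P (ones w) -> wp ans Ones (tape_code w) P.
Proof.
case: w => [[l a] r] H; rewrite /Ones; cbn -[Count]; rewrite !projE.
apply: wp_count; apply: pure_add; rewrite !projE; apply: wp_count.
by rewrite add0n [a + _]addnC.
Qed.
Opaque Ones.

Definition Move :=
  If (Comp Odd (Comp Snd Snd))
    (Pair (Pair (Comp Odd (Comp Fst Snd)) (Comp Fst Fst)) (Comp Snd (Comp Snd
      Fst)))
    (Pair (Comp Snd (Comp Fst Fst)) (Pair (Comp Fst (Comp Fst Fst))
      (Pair (Comp Odd (Comp Fst Snd)) (Comp Snd (Comp Snd Fst))))).

Definition tape_move (w b d : nat) : nat :=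
  let l := proj0 w in let r := proj1 (proj1 w) in
  if odd d then npair (npair (odd b) l) r
  else npair (proj1 l) (npair (proj0 l) (npair (odd b) r)).

Lemma pure_move :
  pure Move (fun x => tape_move (proj0 x) (proj0 (proj1 x)) (proj1 (proj1 x))).
Proof. by rewrite /Move; pure_by x; rewrite /tape_move;
  case: (odd (proj1 (proj1 x))). Qed.
Hint Resolve pure_move : pure.
Opaque Move.

Lemma tape_moveE w b d :
  tape_move (tape_code w) b d =
  tape_code (write_move (odd b) (if odd d then ToRight else ToLeft) w).
Proof.
case: w => [[l a] r]; rewrite /tape_move /= !projE; case: (odd d) => /=.
  by rewrite -head_bits -behead_bits npairK.
by rewrite head_bits behead_bits.
Qed.

Definition field k := Comp Item (Pair (Const k) Fst).

(** The input is <i, <q, T>>, for the instruction i, the state q and the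
    tapes T; the scanned tape is put in front of it. Items 1 to 3 of the
    instruction are the action on a blank and items 4 to 6 the action on a 1. *)
Definition ActStep :=
  let J k := Comp (field k) Snd in
  let on k := If (Comp Fst (Comp Snd Fst)) (J (3 + k)) (J k) in
  Comp (Pair (on 3)
          (Comp SetNth (Pair (J 0) (Pair
             (Comp Move (Pair Fst (Pair (on 1) (on 2)))) (Comp Snd (Comp Snd
               Snd))))))
    (Pair (Comp Nth (Pair (field 0) (Comp Snd Snd))) Id).

Definition act_step (x : nat) : nat :=
  let i := nth 0 (CodeSeq.decode (proj0 x)) in let T := proj1 (proj1 x) in
  let w := nthp T (i 0) in
  let on k := if proj0 (proj1 w) == 0 then i k else i (3 + k) in
  npair (on 3) (set_nthp (i 0) (tape_move w (on 1) (on 2)) T).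

Lemma pure_act_step : pure ActStep act_step.
Proof.
rewrite /ActStep /field; pure_by x; rewrite /act_step /item !projE.
by [].
Qed.
Hint Resolve pure_act_step : pure.
Opaque ActStep.

Definition AskStep :=
  Pair (If (Comp Ora (Comp Ones (Comp Nth (Pair (Const 1) (Comp Snd Snd)))))
          (field 0) (field 1))
    (Comp Snd Snd).

Definition coded (c : config) (z : nat) : Prop :=
  proj0 z = c.1 /\ forall t, nthp (proj1 z) t = tape_code (c.2 t).

Definition Fetch := Comp Item (Pair (Comp Fst Snd) Fst).
Definition Running := Comp (If (Items 6) (Const 1) (Items 1)) Fetch.
Definition Step :=
  Pair Fst (Comp (If (Comp (Items 6) Fst) ActStep AskStep) (Pair Fetch Snd)).

Lemma nth_machine_of e q :
  nth Stop (machine_of e) q = decode_instr (nth 0 (CodeSeq.decode e) q).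
Proof.
rewrite /machine_of; case: (ltnP q (size (CodeSeq.decode e))) => qs.
  by rewrite (nth_map 0).
by rewrite !nth_default ?size_map.
Qed.

(** Seven items code an action, two a query, and any other number of items a
    halting state. *)
Definition running (s : seq nat) := if size s == 7 then true else size s == 2.

Lemma wp_running ans e z (P : nat -> Prop) :
  P (running (CodeSeq.decode (nth 0 (CodeSeq.decode e) (proj0 z)))) ->
  wp ans Running (npair e z) P.
Proof.
move=> H; rewrite /Running /Fetch.
wp_pure; rewrite /item !projE; move: H; rewrite /running.
by case: eqP => //=; case: eqP.
Qed.
Opaque Running.

Lemma running_stop n : running (CodeSeq.decode n) = false -> decode_instr n =
  Stop.
Proof.
by rewrite /running /decode_instr;
  case: (CodeSeq.decode n) => [|? [|? [|? [|? [|? [|? [|? [|? ?]]]]]]]] //=.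
Qed.

Lemma stop_running n : decode_instr n = Stop -> running (CodeSeq.decode n) =
  false.
Proof.
by rewrite /running /decode_instr;
  case: (CodeSeq.decode n) => [|? [|? [|? [|? [|? [|? [|? [|? ?]]]]]]]] //=.
Qed.

Lemma wp_step ans e c c' z (P : nat -> Prop) :
  step (machine_of e) ans c c' -> coded c z ->
  (forall z', coded c' z' -> P (npair e z')) ->
  wp ans Step (npair e z) P.
Proof.
move=> st [zq zT] H; cbn -[ActStep AskStep Fetch If Items]; rewrite !projE.
rewrite /Fetch /=; apply: pure_item; rewrite /item !projE zq.
move: st; rewrite /step nth_machine_of; set n := nth _ _ _ => st.
apply: wp_if => /=; rewrite !projE; apply: pure_items.
move: st; rewrite /decode_instr.
case E: (CodeSeq.decode n) => [|t [|b0 [|d0 [|q0 [|b1 [|d1 [|q1 [|? ?]]]]]]]] //=.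
  case=> b ab E'; subst c'.
  apply: wp_if => /=; rewrite !projE; apply: pure_nth; rewrite !projE zT.
  apply: wp_ones; exists b => //.
  by case: b {ab} H => H; rewrite /= ?projE; apply: pure_item;
    rewrite /item ?projE E;
    apply: H; split; rewrite /= ?projE.
move=> st; apply: pure_act_step; apply: H.
rewrite /act_step !projE E zT /=.
have sc : proj0 (proj1 (tape_code (c.2 t))) = scanned (c.2 t).
  by case: (c.2 t) => [[l a] r]; rewrite /= !projE.
move: st; rewrite sc; case: (scanned _) => /= E'; subst c'; split=> [|u] /=;
  rewrite !projE // nthp_set zT;
  by case: eqP => // _; rewrite tape_moveE.
Qed.
Opaque Step.

Definition Run := While Running Step.

Definition Unary := Iter (Pair (Const 1) Id).

Lemma pure_unary : pure Unary (fun x => iter (proj0 x) (npair 1) (proj1 x)).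
Proof. by rewrite /Unary; pure_by x. Qed.
Opaque Unary.

(** Simulates the machine until it halts and counts the 1s on tape 0. *)
Definition Univ :=
  Comp (Comp Ones (Comp Nth (Pair (Const 0) (Comp Snd Snd))))
    (Comp Run
      (Pair Fst (Pair (Const 0) (Pair (Pair (Const 0)
         (Comp Unary (Pair Snd (Const 0)))) (Const 0))))).

Lemma wp_univ ans e m v (P : nat -> Prop) :
  computes ans e m v -> P v -> wp ans Univ (npair e m) P.
Proof.
move=> [t [c [st stop out]]] Pv.
have loop z c0 : coded c0 z -> steps (machine_of e) ans t c0 c ->
    wp ans Run (npair e z) (fun y => exists2 z', coded c z' & y = npair e z').
  move=> cz st'; exists t; elim: t c0 z cz st' {st} => [|t IHt] c0 z cz /=.
    move=> E; subst c0; apply: wp_running; rewrite cz.1.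
    rewrite (stop_running (n := nth 0 _ _)) -?nth_machine_of //=.
    by exists z.
  move=> [c1 st1 st2]; apply: wp_running; rewrite cz.1.
  have -> : running (CodeSeq.decode (nth 0 (CodeSeq.decode e) c0.1)) = true.
    apply/negbNE/negP => /negbTE/running_stop; rewrite -nth_machine_of => E.
    by move: st1; rewrite /step E.
  by apply: (wp_step st1 cz) => z' cz'; apply: IHt cz' st2.
rewrite /Univ; cbn -[Run Ones Nth]; rewrite !projE.
apply: pure_unary; rewrite !projE.
set z0 := npair 0 (npair (npair 0 _) 0).
have cz0 : coded (init m) z0.
  rewrite /z0; clear z0 loop st; split; rewrite ?projE //= => u; rewrite ?projE.
  case: u => [|u] /=; last first.
    rewrite /nthp iterSr projE.
    have -> : iter u proj1 0 = 0 by elim: u => //= u ->; rewrite proj10.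
    by rewrite proj00 !npair00.
  rewrite /nthp /= !projE.
  have -> : iter m (npair 1) 0 = bits_code (nseq m true) by elim: m => //= m ->.
  by congr npair; case: m => //=; rewrite npair00.
have := loop z0 (init m) cz0 st; apply: wp_mono => _ [z' [_ zT] ->].
rewrite !projE; apply: pure_nth; rewrite !projE zT; apply: wp_ones.
by rewrite out.
Qed.
Opaque Univ.

(** * Forced equality and membership *)

Lemma val_at_mono s t f h : prefix s t -> val_at f s h -> val_at f t h.
Proof. by case: f => J el dom mono st [i di ->]; exists i => //;
  apply: mono st di. Qed.

Lemma keq_mono s t f g : prefix s t -> keq s f g -> keq t f g.
Proof.
move=> st H; case: H st => {}s {}f {}g fg gf st.
by split=> u tu h vh; [apply: fg vh | apply: gf vh]; apply: prefix_trans tu.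
Qed.

Lemma kmem_mono s t h f : prefix s t -> kmem s h f -> kmem t h f.
Proof.
move=> st H; case: H st => {}s {}h {}f h' vh hh st.
by apply: (KMem (val_at_mono st vh)); apply: keq_mono hh.
Qed.

Lemma keq_refl s f : keq s f f.
Proof.
elim: f s => J el IH dom mono s.
by split=> t _ h [i di ->]; apply: (@KMem _ _ _ (el i)) => //; exists i.
Qed.

Lemma keq_sym s f g : keq s f g -> keq s g f.
Proof. by case=> {}s {}f {}g fg gf; split. Qed.

Lemma val_mem s f h : val_at f s h -> kmem s h f.
Proof. by move=> vh; apply: KMem vh (keq_refl _ _). Qed.

(** By induction on the first set; the inclusion of the last set in the first
    uses the induction hypothesis for the symmetric equalities. *)
Lemma keq_trans s f g h : keq s f g -> keq s g h -> keq s f h.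
Proof.
elim: f s g h => J el IH dom mono s g h fg gh.
inversion fg as [? ? ? fg1 fg2]; inversion gh as [? ? ? gh1 gh2]; subst.
split=> t st x vx.
  case: (vx) => i di xi; subst x.
  have := fg1 t st _ vx => m; inversion m as [? ? ? y vy xy]; subst.
  have := gh1 t st _ vy => m'; inversion m' as [? ? ? z vz yz]; subst.
  by apply: (KMem vz); apply: IH xy yz.
have := gh2 t st _ vx => m; inversion m as [? ? ? y vy xy]; subst.
have := fg2 t st _ vy => m'; inversion m' as [? ? ? z vz yz]; subst.
apply: (KMem vz); case: vz => i di E; subst z.
by apply: keq_sym; apply: IH (keq_sym yz) (keq_sym xy).
Qed.

Lemma kmem_eqr s x f g : keq s f g -> kmem s x f -> kmem s x g.
Proof.
move=> fg m; inversion m as [? ? ? y vy xy]; subst.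
inversion fg as [? ? ? fg1 _]; subst.
have := fg1 s (prefix_refl s) _ vy => m'; inversion m' as [? ? ? z vz yz]; subst.
by apply: (KMem vz); apply: keq_trans xy yz.
Qed.

Lemma kmem_const J (el : J -> kset) s x :
  kmem s x (kconst el) <-> exists j, keq s x (el j).
Proof.
split=> [m|[j xj]].
  by inversion m as [? ? ? y vy xy]; subst; case: vy xy => j _ -> xy; exists j.
by apply: KMem xj; exists j.
Qed.

Lemma kmem_upair s x a b : kmem s x (kupair a b) <-> keq s x a \/ keq s x b.
Proof.
rewrite /kupair kmem_const; split=> [[[] H]|[] H]; [by left|by right| |].
  by exists true.
by exists false.
Qed.

Lemma kmem_adjoin s x a y : kmem s x (kadjoin a y) <-> kmem s x a \/ keq s x y.
Proof.
case: a => J el dom mono; split=> [m|[m|xy]].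
- inversion m as [? ? ? z vz xz]; subst.
  case: vz xz => -[j|] dj -> xz; last by right.
  by left; apply: KMem xz; exists j.
- inversion m as [? ? ? z vz xz]; subst; case: vz xz => j dj -> xz.
  by apply: KMem xz; exists (Some j).
- by apply: KMem xy; exists None.
Qed.

Lemma kmem_empty s x : ~ kmem s x kempty.
Proof. by move=> /kmem_const[[]]. Qed.

Lemma knat_inj s m n : keq s (knat m) (knat n) -> m = n.
Proof.
suff H p q : keq s (knat p) (knat q) -> p <= q.
  by move=> mn; apply/eqP; rewrite eqn_leq (H _ _ mn) (H _ _ (keq_sym mn)).
have mem a b : a < b -> kmem s (knat a) (knat b).
  elim: b => // b IHb; rewrite ltnS leq_eqVlt /= kmem_adjoin.
  by case/orP=> [/eqP->|/IHb]; [right; apply: keq_refl | left].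
have le a b : kmem s (knat a) (knat b) -> exists2 c, c < b & keq s (knat a)
  (knat c).
  elim: b => [/kmem_empty//|b IHb] /= /kmem_adjoin[/IHb[c cb]|]; last by exists b.
  by exists c => //; apply: ltnW.
elim: p {-2}p (leqnn p) q => [|k IHk] p pk q pq; first by move: pk;
  rewrite leqn0 => /eqP->.
rewrite leqNgt; apply/negP => qp.
have /le[c cq qc] := kmem_eqr pq (mem _ _ qp).
have qk : q <= k by lia.
by have := IHk q qk c qc; rewrite leqNgt cq.
Qed.

(** The proof for Kuratowski pairs takes place at the single node [s], where
    an element of an unordered pair equals one of its two members. *)
Lemma kpair_inj s a b c d : keq s (kpair a b) (kpair c d) -> keq s a c /\ keq s
  b d.
Proof.
move=> E.
have in1 x y : kmem s (kupair x x) (kpair x y).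
  by apply/kmem_upair; left; apply: keq_refl.
have in2 x y : kmem s (kupair x y) (kpair x y).
  by apply/kmem_upair; right; apply: keq_refl.
have inl x y : kmem s x (kupair x y) by apply/kmem_upair; left; apply: keq_refl.
have inr x y : kmem s y (kupair x y) by apply/kmem_upair; right; apply: keq_refl.
have ac : keq s a c.
  have := kmem_eqr E (in1 a b); rewrite kmem_upair => -[] F; apply: keq_sym.
    by have := kmem_eqr (keq_sym F) (inl c c); rewrite kmem_upair => -[].
  by have := kmem_eqr (keq_sym F) (inl c d); rewrite kmem_upair => -[].
split=> //.
have bcd : keq s b c \/ keq s b d.
  have := kmem_eqr E (in2 a b); rewrite kmem_upair => -[] F;
  by have := kmem_eqr F (inr a b); rewrite kmem_upair => -[]; tauto.
have dab : keq s d a \/ keq s d b.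
  have := kmem_eqr (keq_sym E) (in2 c d); rewrite kmem_upair => -[] F;
  by have := kmem_eqr F (inr c d); rewrite kmem_upair => -[]; tauto.
case: bcd => // bc; case: dab => [da|/keq_sym//].
by apply: keq_trans bc _; apply: keq_trans (keq_sym ac) _; apply: keq_sym.
Qed.

Inductive kacc : node -> kset -> Prop :=
  | KAcc s a : (forall t, prefix s t -> forall x, kmem t x a -> kacc t x) ->
    kacc s a.

(** A set that is forced equal to [a] has the elements of [a] up to forced
    equality, and these are structural subterms of [a]. *)
Lemma kacc_all s a : kacc s a.
Proof.
suff : forall s b, keq s b a -> kacc s b by apply; apply: keq_refl.
move=> {s}; elim: a => J el IH dom mono s b ba.
split=> t st x /(kmem_eqr (keq_mono st ba)) m.
by inversion m as [? ? ? z vz xz]; subst; case: vz xz => j _ ->; apply: IH.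
Qed.

(** The induction principle for names. The second coordinate of an element
    lies three membership steps below the set, so the statement is carried
    along for three levels at once. *)
Lemma realizer_pair_ind (Q : node -> kset -> Prop) :
  (forall s a, (forall t, prefix s t -> forall f c,
     kmem t (kpair (knat f) c) a -> Q t c) -> Q s a) ->
  forall s a, Q s a.
Proof.
move=> H s a.
suff : Q s a /\ (forall t, prefix s t -> forall x, kmem t x a -> Q t x /\
    (forall u, prefix t u -> forall y, kmem u y x -> Q u y)) by case.
elim: (kacc_all s a) => {}s {}a _ IH; split; last first.
  move=> t st x m; have [Qx Qy] := IH t st x m; split=> // u tu y my.
  by have [] := Qy u tu y my.
apply: H => t st f c m; have [_ Qp] := IH t st _ m.
have [|_ Qu] := Qp t (prefix_refl t) (kupair (knat f) c).
  by apply/kmem_upair; right; apply: keq_refl.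
by apply: (Qu t (prefix_refl t)); apply/kmem_upair; right; apply: keq_refl.
Qed.

(** All names constructed below have, at every node, the same elements up to
    forced equality, namely tagged elements of a family; the lemmas on [lists]
    are the only facts about their construction that are used. *)
Definition lists (a : kset) (I : Type) (P : I -> Prop) (tag : I -> nat)
    (el : I -> kset) : Prop :=
  forall t x, kmem t x a <-> exists2 i, P i & keq t x (kpair (knat (tag i)) (el
    i)).

Lemma lists_elim a I P tag el t f c : @lists a I P tag el ->
  kmem t (kpair (knat f) c) a -> exists i, [/\ P i, f = tag i & keq t c (el i)].
Proof. by move=> la /la[i Pi /kpair_inj[/knat_inj fi ci]]; exists i. Qed.

Lemma lists_intro a I P tag el t i : @lists a I P tag el -> P i ->
  kmem t (kpair (knat (tag i)) (el i)) a.
Proof. by move=> la Pi; apply/la; exists i => //; apply: keq_refl. Qed.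

Lemma is_name_mono s t a : prefix s t -> is_name s a -> is_name t a.
Proof.
move=> st H; case: H st => {}s {}a H st; split=> u tu; apply: H.
exact: prefix_trans tu.
Qed.

Lemma lists_name a I P tag el s : @lists a I P tag el ->
  (forall i, P i -> is_name s (el i)) -> is_name s a.
Proof.
move=> la nel; split=> t st x /la[i Pi xi]; exists (tag i), (el i); split=> //.
exact: is_name_mono st (nel i Pi).
Qed.

Lemma lists_const I (tag : I -> nat) (el : I -> kset) :
  lists (kconst (fun i => kpair (knat (tag i)) (el i))) (fun=> True) tag el.
Proof. by move=> t x; rewrite kmem_const; split=> -[i]; [exists i|exists i]. Qed.

Lemma lists_nat n : lists (nat_name n) (fun m => m < n) id nat_name.
Proof.
elim: n => [|n IHn] t x /=; first by split=> [/kmem_empty|[]].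
rewrite kmem_adjoin; split=> [[/IHn[i ni xi]|xn]|[i]].
- by exists i => //; apply: ltnW.
- by exists n.
- rewrite ltnS leq_eqVlt => /orP[/eqP->|ni] xi; [by right|left].
  by apply/IHn; exists i.
Qed.

Lemma lists_omega : lists omega_name (fun=> True) id nat_name.
Proof. exact: lists_const. Qed.

Lemma is_name_eq s a b : keq s a b -> is_name s a -> is_name s b.
Proof.
move=> ab H; case: H ab => {}s {}a H ab; split=> t st x xb; apply: H => //.
by apply: kmem_eqr xb; apply: keq_sym; apply: keq_mono ab.
Qed.

Lemma is_name_mem s a t f c : is_name s a -> prefix s t ->
  kmem t (kpair (knat f) c) a -> is_name t c.
Proof.
case=> {}s {}a H st /(H t st)[e [c' [/kpair_inj[_ cc] nc]]].
by apply: is_name_eq nc; apply: keq_sym.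
Qed.

Lemma is_name_nat s n : is_name s (nat_name n).
Proof.
elim: n {-2}n (leqnn n) => [|k IHk] n nk;
  apply: (lists_name (lists_nat n)) => i ni.
  by move: ni nk; case: n.
by apply: IHk; rewrite -ltnS; apply: leq_trans nk.
Qed.

(** * Application, recursion, and the realizers of equality *)

Definition App t u := Comp Univ (Pair t u).
Definition LetIn t u := Comp u (Pair t Id).

(** In the body of a closure the environment is a nested pair whose components
    are numbered from the innermost binder. *)
Notation v0 := Fst.
Notation v1 := (Comp Fst Snd).
Notation v2 := (Comp Fst (Comp Snd Snd)).
Notation v3 := (Comp Fst (Comp Snd (Comp Snd Snd))).
Notation v4 := (Comp Fst (Comp Snd (Comp Snd (Comp Snd Snd)))).

Lemma wp_app ans t u x (P : nat -> Prop) :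
  wp ans t x (fun a => wp ans u x (fun b =>
    exists k, computes ans a b k /\ P k)) ->
  wp ans (App t u) x P.
Proof.
apply: wp_mono => a; apply: wp_mono => b [k [abk Pk]].
exact: wp_univ abk Pk.
Qed.
Opaque App.

(** Only outputs that exist are talked about, hence a realizer computed by a
    program exists in particular. *)
Lemma wp_exists ans f x P : wp ans f x P -> exists v, P v.
Proof.
move=> H; have [||v Pv _] := @wp_exec ans f 2 (upd (fun=> 0) 2 x) P.
- by rewrite upd_same.
- by split=> // -[|[|[|i]]].
by exists v.
Qed.

Lemma clos_app ans f k m (P : nat -> Prop) :
  wp ans f (npair m k) P -> exists v, computes ans (clos f k) m v /\ P v.
Proof. by move/wp_clos => [v Pv c]; exists v. Qed.

(** Naming the postcondition protects the formula in it from simplification. *)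
Ltac clos_start Q := apply: clos_app;
  match goal with |- wp _ _ _ ?P => set (Q := P) end.

(** Recursive closures by self-application: if w is the closure [FixW t] then
    w applied to w is the closure [FixT t] whose environment starts with w;
    inside, [App v1 v1] evaluates to that closure again. *)
Definition FixT t := Comp t (Pair Fst (Pair (App v1 v1) (Comp Snd Snd))).
Definition FixW t := Lam (FixT t).
Definition fixc t e := clos (FixT t) (npair (clos (FixW t) e) e).

Lemma fix_app ans t e m (P : nat -> Prop) :
  wp ans t (npair m (npair (fixc t e) e)) P ->
  exists v, computes ans (fixc t e) m v /\ P v.
Proof.
move=> H; apply: clos_app; rewrite /FixT /= !projE; apply: wp_app;
  rewrite /= !projE.
apply: clos_app; apply: pure_lam; exact: H.
Qed.

Section Realizability.
Variable R : kset.

Lemma kanswer_mono s t p b : prefix s t -> kanswer R s p b -> kanswer R t p b.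
Proof.
move=> st; case: b => [|H u tu] /=; first exact: kmem_mono.
by apply: H; apply: prefix_trans tu.
Qed.

Lemma steps_ans (ans ans' : oracle_answer) P n c c' :
  (forall p b, ans p b -> ans' p b) -> steps P ans n c c' -> steps P ans' n c c'.
Proof.
move=> H; elim: n c => //= n IHn c [c1 s1 /IHn s2]; exists c1 => //.
move: s1; rewrite /step; case: (nth Stop P c.1) => // y n' [b /H ab ->].
by exists b.
Qed.

Lemma kapp_mono s t e m k : prefix s t -> kapp R s e m k -> kapp R t e m k.
Proof.
move=> st [n [c [sc stop out]]]; exists n, c; split=> //.
by apply: steps_ans sc => p b; apply: kanswer_mono.
Qed.

Lemma rmemP s e a b : rmem R s e a b <->
  exists c, kmem s (kpair (knat (proj0 e)) c) b /\ req R s (proj1 e) a c.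
Proof.
split=> [m|[c [cb ac]]]; last exact: RMem cb ac.
by inversion m as [? ? ? ? c cb ac]; subst; exists c.
Qed.

Lemma reqP s e a b : req R s e a b <->
  (forall t, prefix s t -> forall f c, kmem t (kpair (knat f) c) a ->
     exists k, kapp R t (proj0 e) f k /\ rmem R t k c b) /\
  (forall t, prefix s t -> forall f c, kmem t (kpair (knat f) c) b ->
     exists k, kapp R t (proj1 e) f k /\ rmem R t k c a).
Proof.
split=> [m|[H1 H2]]; last by apply: REq.
by inversion m.
Qed.

Lemma req_mono s t e a b : prefix s t -> req R s e a b -> req R t e a b.
Proof.
move=> st /reqP[H1 H2]; apply/reqP.
by split=> u tu; [apply: H1 | apply: H2]; apply: prefix_trans tu.
Qed.

Lemma rmem_mono s t e a b : prefix s t -> rmem R s e a b -> rmem R t e a b.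
Proof.
move=> st /rmemP[c [cb ac]]; apply/rmemP; exists c.
by split; [apply: kmem_mono cb | apply: req_mono ac].
Qed.

Lemma realizes_mono p e s t : prefix s t -> realizes R p e s -> realizes R p e t.
Proof.
elim: p e s t => [a b|a b||p IHp q IHq|p IHp q IHq|p IHp q IHq|p IHp|p IHp] e s
  t st //=.
- exact: rmem_mono.
- exact: req_mono.
- by move=> [/(IHp _ _ _ st) ? /(IHq _ _ _ st) ?].
- by move=> [[? /(IHp _ _ _ st) ?]|[? /(IHq _ _ _ st) ?]]; [left|right].
- by move=> H u tu; apply: H; apply: prefix_trans tu.
- by move=> H u tu; apply: H; apply: prefix_trans tu.
- by move=> [a [na pa]]; exists a; split;
  [apply: is_name_mono na | apply: IHp pa].
Qed.

Lemma rmem_keq s e a b b' : keq s b b' -> rmem R s e a b -> rmem R s e a b'.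
Proof.
move=> bb /rmemP[c [cb ac]]; apply/rmemP; exists c; split=> //.
exact: kmem_eqr cb.
Qed.

(** Realizers reach a set only through its elements, so forced equals may be
    substituted without an induction. *)
Lemma req_keq s e a b a' b' : keq s a a' -> keq s b b' -> req R s e a b -> req
  R s e a' b'.
Proof.
move=> aa bb /reqP[H1 H2]; apply/reqP; split=> t st f c m.
  have [k [ak mk]] := H1 t st f c (kmem_eqr (keq_sym (keq_mono st aa)) m).
  by exists k; split=> //; apply: rmem_keq mk; apply: keq_mono bb.
have [k [ak mk]] := H2 t st f c (kmem_eqr (keq_sym (keq_mono st bb)) m).
by exists k; split=> //; apply: rmem_keq mk; apply: keq_mono aa.
Qed.

Lemma rmem_lists s e a b I P tag el : @lists b I P tag el ->
  rmem R s e a b <-> exists i, [/\ P i, proj0 e = tag i & req R s (proj1 e) a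
    (el i)].
Proof.
move=> lb; rewrite rmemP;
  split=> [[c [/(lists_elim lb)[i [Pi ei ci]] ac]]|[i [Pi ei ai]]].
  by exists i; split=> //; apply: req_keq ac => //; apply: keq_refl.
by exists (el i); rewrite ei; split=> //; apply: lists_intro.
Qed.

Lemma req_lists s e a b (I J : Type) P tag el P' tag' el' :
  @lists a I P tag el -> @lists b J P' tag' el' ->
  (forall t i, prefix s t -> P i ->
    exists k, kapp R t (proj0 e) (tag i) k /\ rmem R t k (el i) b) ->
  (forall t i, prefix s t -> P' i ->
    exists k, kapp R t (proj1 e) (tag' i) k /\ rmem R t k (el' i) a) ->
  req R s e a b.
Proof.
move=> la lb H1 H2; apply/reqP; split=> t st f c.
  move=> /(lists_elim la)[i [Pi -> ci]]; have [k [ak mk]] := H1 t i st Pi.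
  exists k; split=> //; move/rmemP: mk => [d [db ad]]; apply/rmemP; exists d.
  by split=> //; apply: req_keq ad; [apply: keq_sym | apply: keq_refl].
move=> /(lists_elim lb)[i [Pi -> ci]]; have [k [ak mk]] := H2 t i st Pi.
exists k; split=> //; move/rmemP: mk => [d [db ad]]; apply/rmemP; exists d.
by split=> //; apply: req_keq ad; [apply: keq_sym | apply: keq_refl].
Qed.

(** One realizer serves all sets: it sends the tag f to the pair of f and
    itself. *)
Definition ReflStep := Pair v0 (Pair v1 v1).
Definition reflr := npair (fixc ReflStep 0) (fixc ReflStep 0).

Lemma req_refl s a : req R s reflr a a.
Proof.
move: s a; apply: realizer_pair_ind => s a IH.
have H t f c : prefix s t -> kmem t (kpair (knat f) c) a ->
    exists k, kapp R t (fixc ReflStep 0) f k /\ rmem R t k c a.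
  move=> st m; apply: fix_app; rewrite /= !projE; apply/rmemP; exists c.
  by rewrite !projE; split=> //; apply: IH m.
by apply/reqP; rewrite /reflr !projE; split=> t st f c; apply: H.
Qed.

Definition Symm := Pair Snd Fst.
Definition Sym t := Comp Symm t.
Definition symr e := npair (proj1 e) (proj0 e).

Lemma pure_symm : pure Symm symr. Proof. by []. Qed.

Lemma req_sym s e a b : req R s e a b -> req R s (symr e) b a.
Proof. by move=> /reqP[H1 H2]; apply/reqP; rewrite /symr !projE. Qed.

Lemma mem_refl s f c a : kmem s (kpair (knat f) c) a -> rmem R s (npair f
  reflr) c a.
Proof.
by move=> m; apply/rmemP; exists c; rewrite !projE; split=> //; apply: req_refl.
Qed.

(** The environment is <argument, <<e, f>, self>>. [TransL] sends a tag of a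
    first through e and then through f, and composes the two equalities met on
    the way by a recursive call; [TransR] goes from c to a in the same manner,
    composing the symmetric equalities and reversing the result. *)
Definition TransL :=
  LetIn (App (Comp Fst (Comp Fst v1)) v0)
    (LetIn (App (Comp Fst (Comp Snd v2)) (Comp Fst v0))
       (Pair (Comp Fst v0) (App v4 (Pair (Comp Snd v1) (Comp Snd v0))))).
Definition TransR :=
  LetIn (App (Comp Snd (Comp Snd v1)) v0)
    (LetIn (App (Comp Snd (Comp Fst v2)) (Comp Fst v0))
       (Pair (Comp Fst v0)
          (Sym (App v4 (Pair (Sym (Comp Snd v0)) (Sym (Comp Snd v1))))))).
Definition TransBody := Pair (Lam TransL) (Lam TransR).
Definition trans_self := fixc TransBody 0.
Definition transr e f :=
  let env := npair (npair e f) (npair trans_self 0) in npair (clos TransL env)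
    (clos TransR env).
Definition Trans := Comp TransBody (Pair Id (Pair (Const trans_self) (Const 0))).

Lemma pure_trans : pure Trans (fun p => transr (proj0 p) (proj1 p)).
Proof.
move=> ans x P H; rewrite /Trans /=; apply: pure_lam; apply: pure_lam.
by move: H; rewrite /transr npairK.
Qed.

Lemma trans_self_app ans e f (P : nat -> Prop) :
  P (transr e f) -> exists k, computes ans trans_self (npair e f) k /\ P k.
Proof. by move=> H; apply: fix_app; rewrite /=; apply: pure_lam;
  apply: pure_lam. Qed.

(** By induction on [a] alone: the recursive call in [TransR] is about elements
    of [a] too, thanks to the two reversals. *)
Lemma req_trans s e f a b c :
  req R s e a b -> req R s f b c -> req R s (transr e f) a c.
Proof.
move: s a e f b c.
apply: (realizer_pair_ind (Q := fun s a => forall e f b c,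
  req R s e a b -> req R s f b c -> req R s (transr e f) a c)).
move=> s a IH e f b c ab bc; apply/reqP; rewrite /transr !projE.
have := ab => /reqP[ab1 ab2]; have := bc => /reqP[bc1 bc2]; split=> t st g x m.
  apply: clos_app; rewrite /TransL /=; apply: wp_app; rewrite /= !projE.
  have [k [ak /rmemP[y [yb xy]]]] := ab1 t st g x m.
  exists k; split=> //; apply: wp_app; rewrite /= !projE.
  have [l [al /rmemP[z [zc yz]]]] := bc1 t st _ y yb.
  exists l; split=> //; apply: wp_app; rewrite /= !projE.
  apply: trans_self_app; apply/rmemP; exists z; rewrite !projE; split=> //.
  exact: IH m _ _ _ _ xy yz.
apply: clos_app; rewrite /TransR /=; apply: wp_app; rewrite /= !projE.
have [k [ak /rmemP[y [yb xy]]]] := bc2 t st g x m.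
exists k; split=> //; apply: wp_app; rewrite /= !projE.
have [l [al /rmemP[z [zc yz]]]] := ab2 t st _ y yb.
exists l; split=> //; apply: wp_app; rewrite /= !projE.
have := IH t st _ _ zc _ _ _ _ (req_sym yz) (req_sym xy).
move=> zx; apply: trans_self_app; move: zx; rewrite /symr;
  move: (transr _ _) => q zx.
by apply/rmemP; exists z; rewrite !projE; split=> //; apply: req_sym zx.
Qed.
Opaque transr.

End Realizability.
Opaque transr Trans Symm.

(** * Pairs in the realizability model *)

Hint Resolve pure_lam pure_trans : pure.

Lemma pure_sym t T : pure t T -> pure (Sym t) (fun x => symr (T x)).
Proof. by move=> tT ans x P H; apply: tT; apply: pure_symm. Qed.
Hint Resolve pure_sym : pure.

Section Pairs.
Variable R : kset.
Notation K := (kanswer R).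

Lemma mem_eql s e k x y b : req R s e x y -> rmem R s k y b ->
  rmem R s (npair (proj0 k) (transr e (proj1 k))) x b.
Proof.
move=> xy /rmemP[c [cb yc]]; apply/rmemP; exists c; rewrite !projE; split=> //.
exact: req_trans xy yc.
Qed.

Definition MemEq :=
  LetIn (App (Comp Fst Snd) (Comp Fst Fst))
    (Pair (Comp Fst v0) (Comp Trans (Pair (Comp Snd v1) (Comp Snd v0)))).

Lemma wp_mem_eq s k e x a b : rmem R s k x a -> req R s e a b ->
  wp (K s) MemEq (npair k e) (fun v => rmem R s v x b).
Proof.
move=> /rmemP[c [ca xc]] /reqP[ab _]; rewrite /MemEq /=; apply: wp_app;
  rewrite /= !projE.
have [l [al lb]] := ab s (prefix_refl s) _ _ ca.
by exists l; split=> //; rewrite !projE; apply: pure_trans; rewrite !projE;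
  apply: mem_eql xc lb.
Qed.
Opaque MemEq.

(** All positive numbers tag [b]. This makes the realizers of membership in
    the unordered pair the same numbers as the realizers of the disjunction in
    [f_upair]. *)
Definition upair_name (a b : kset) : kset :=
  kconst (fun m => kpair (knat m) (if m is 0 then a else b)).

Lemma lists_upair a b :
  lists (upair_name a b) (fun=> True) id (fun m => if m is 0 then a else b).
Proof. exact: lists_const. Qed.

Lemma is_name_upair s a b : is_name s a -> is_name s b -> is_name s (upair_name
  a b).
Proof. by move=> na nb; apply: (lists_name (lists_upair a b)) => -[|i] _. Qed.

Lemma rmem_upair s k c x y :
  rmem R s k c (upair_name x y) <-> realizes R (c =' x ∨' c =' y)%fml k s.
Proof.
rewrite (rmem_lists _ _ _ _ (lists_upair x y)) /=;
  split=> [[[|i] [_ -> ci]]|[[k0 cx]|[k0 cy]]].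
- by left.
- by right.
- by exists 0.
by exists (proj0 k); split=> //; case: (proj0 k) k0.
Qed.

Definition upair_ir e := npair (clos MemEq e) (clos (Comp MemEq (Pair v0 (Sym
  Snd))) e).

Lemma upair_intro s e x y z : req R s e z (upair_name x y) ->
  realizes R (f_upair z x y) (upair_ir e) s.
Proof.
move=> zxy t st w nw /=; rewrite /upair_ir !projE; split=> u tu k.
  move=> kz; have E := req_mono (prefix_trans st tu) zxy.
  by apply: clos_app; apply: wp_mono (wp_mem_eq kz E) => v /rmem_upair.
have E := req_sym (req_mono (prefix_trans st tu) zxy).
move=> /(rmem_upair _ _ w x y) kw; apply: clos_app; rewrite /= !projE.
by apply: pure_symm; apply: wp_mem_eq kw E.
Qed.

Definition UpairI := Pair (Lam MemEq) (Lam (Comp MemEq (Pair v0 (Sym Snd)))).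
Lemma pure_upair_i : pure UpairI upair_ir.
Proof. by rewrite /UpairI; pure_by x. Qed.
Opaque upair_ir UpairI.

Definition upair_er r :=
  npair (clos (App (Comp Fst Snd) (Pair Fst (Const reflr))) r)
        (clos (App (Comp Snd Snd) (Pair Fst (Const reflr))) r).

Lemma upair_elim s r x y z : is_name s x -> is_name s y -> is_name s z ->
  realizes R (f_upair z x y) r s -> req R s (upair_er r) z (upair_name x y).
Proof.
move=> nx ny nz /= H; apply/reqP; rewrite /upair_er !projE; split=> t st f c m.
  have nc := is_name_mem nz st m.
  have [H1 _] := H t st c nc.
  have [k [ak mk]] := H1 t (prefix_refl t) _ (mem_refl _ m).
  apply: clos_app; apply: wp_app; rewrite /= !projE; exists k; split=> //.
  by apply/rmem_upair.
have nc := is_name_mem (is_name_upair nx ny) st m.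
have [_ H1] := H t st c nc.
have [k [ak mk]] := H1 t (prefix_refl t) _ ((rmem_upair _ _ _ _ _).1 (mem_refl
  _ m)).
by apply: clos_app; apply: wp_app; rewrite /= !projE; exists k.
Qed.

Definition UpairE := Pair (Lam (App (Comp Fst Snd) (Pair Fst (Const reflr))))
  (Lam (App (Comp Snd Snd) (Pair Fst (Const reflr)))).
Lemma pure_upair_e : pure UpairE upair_er.
Proof. by rewrite /UpairE; pure_by x. Qed.
Opaque upair_er UpairE.

Definition UpairCongr := Pair v0 (If v0 (Comp Snd Snd) v1).
Definition upair_cr e f := npair (clos UpairCongr (npair e f)) (clos UpairCongr
  (npair (symr e) (symr f))).

Lemma upair_congr s e f x x' y y' : req R s e x x' -> req R s f y y' ->
  req R s (upair_cr e f) (upair_name x y) (upair_name x' y').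
Proof.
move=> xx yy.
have H t e' f' a a' b b' i : req R t e' a a' -> req R t f' b b' ->
    exists k, kapp R t (clos UpairCongr (npair e' f')) i k /\
      rmem R t k (if i is 0 then a else b) (upair_name a' b').
  move=> aa bb; apply: clos_app; rewrite /UpairCongr /= !projE; apply: wp_if;
    rewrite /= !projE.
  case: i => [|i] /=; rewrite ?projE;
    apply/(rmem_lists _ _ _ _ (lists_upair _ _)).
    by exists 0; rewrite !projE.
  by exists i.+1; rewrite !projE.
apply: (req_lists (lists_upair _ _) (lists_upair _ _)) => t i st _;
  rewrite /upair_cr !projE;
  apply: H; try apply: req_sym; apply: req_mono st _ => //.
Qed.

Definition UpairC := Pair (Lam UpairCongr) (Comp (Lam UpairCongr) (Pair (Sym
  Fst) (Sym Snd))).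
Lemma pure_upair_c : pure UpairC (fun p => upair_cr (proj0 p) (proj1 p)).
Proof. by rewrite /UpairC; pure_by x; rewrite /upair_cr npairK. Qed.
Opaque upair_cr UpairC.
Hint Resolve pure_upair_i pure_upair_e pure_upair_c : pure.

Definition pair_name x y := upair_name (upair_name x x) (upair_name x y).
Definition pair_cr e f := upair_cr (upair_cr e e) (upair_cr e f).

Lemma pair_congr s e f x x' y y' : req R s e x x' -> req R s f y y' ->
  req R s (pair_cr e f) (pair_name x y) (pair_name x' y').
Proof. by move=> xx yy; do 2 apply: upair_congr. Qed.

Lemma is_name_pair s a b : is_name s a -> is_name s b -> is_name s (pair_name a
  b).
Proof. by move=> na nb; do 2 apply: is_name_upair. Qed.

Lemma realizes_and p q a b s :
  realizes R p a s -> realizes R q b s -> realizes R (p ∧' q)%fml (npair a b) s.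
Proof. by rewrite /= !projE. Qed.

Lemma realizes_orl p q b s :
  realizes R p b s -> realizes R (p ∨' q)%fml (npair 0 b) s.
Proof. by move=> H; left; rewrite !projE. Qed.

Lemma realizes_orr p q a b s : a <> 0 ->
  realizes R q b s -> realizes R (p ∨' q)%fml (npair a b) s.
Proof. by move=> a0 H; right; rewrite !projE. Qed.

Lemma realizes_all p e s :
  (forall t a, prefix s t -> is_name t a -> realizes R (p a) e t) ->
  realizes R (All p) e s.
Proof. by move=> H t st a na; apply: H. Qed.

Lemma realizes_imp p q f e s :
  (forall t k, prefix s t -> realizes R p k t ->
    wp (K t) f (npair k e) (fun v => realizes R q v t)) ->
  realizes R (p ⇒' q)%fml (clos f e) s.
Proof. by move=> H t st k pk; apply: clos_app; apply: H. Qed.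

Lemma realizes_ex p a e s :
  is_name s a -> realizes R (p a) e s -> realizes R (Ex p) e s.
Proof. by exists a. Qed.

Definition pair_ir e := npair (upair_ir reflr) (npair (upair_ir reflr)
  (upair_ir e)).

(** With [pair_elim]: being an ordered pair of [x] and [y] amounts to being
    equal to [pair_name x y], so that the formula [f_pair] can be dropped in
    favour of an equality of names. *)
Lemma pair_intro s e x y p : is_name s x -> is_name s y ->
  req R s e p (pair_name x y) -> realizes R (f_pair p x y) (pair_ir e) s.
Proof.
move=> nx ny E; exists (upair_name x x); split; first exact: is_name_upair.
exists (upair_name x y); split; first exact: is_name_upair.
apply: realizes_and; first exact: upair_intro (req_refl _ _ _).
apply: realizes_and; first exact: upair_intro (req_refl _ _ _).
exact: upair_intro E.
Qed.

Definition PairC := Comp UpairC (Pair (Comp UpairC (Pair Fst Fst)) UpairC).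
Lemma pure_pair_c : pure PairC (fun p => pair_cr (proj0 p) (proj1 p)).
Proof. by rewrite /PairC; pure_by x; rewrite !projE. Qed.

Definition PairI := Pair (Const (upair_ir reflr)) (Pair (Const (upair_ir
  reflr)) UpairI).
Lemma pure_pair_i : pure PairI pair_ir.
Proof. by rewrite /PairI; pure_by x. Qed.
Opaque pair_ir PairI pair_cr PairC.

Definition pair_er r :=
  transr (upair_er (proj1 (proj1 r))) (upair_cr (upair_er (proj0 r)) (upair_er
    (proj0 (proj1 r)))).

Lemma pair_elim s r x y p : is_name s x -> is_name s y -> is_name s p ->
  realizes R (f_pair p x y) r s -> req R s (pair_er r) p (pair_name x y).
Proof.
move=> nx ny np [u [nu [v [nv [Hu [Hv Hp]]]]]].
apply: req_trans (upair_elim nu nv np Hp) _.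
by apply: upair_congr; apply: upair_elim.
Qed.

Definition PairE := Comp Trans (Pair (Comp UpairE (Comp Snd Snd))
  (Comp UpairC (Pair (Comp UpairE Fst) (Comp UpairE v1)))).
Lemma pure_pair_e : pure PairE pair_er.
Proof. by rewrite /PairE; pure_by x; rewrite !projE. Qed.
Opaque pair_er PairE.

Lemma rmem_inv s k x a I P tag el : @lists a I P tag el -> rmem R s k x a ->
  exists i, [/\ P i, proj0 k = tag i & req R s (proj1 k) x (el i)].
Proof. by move=> la /(rmem_lists _ _ _ _ la). Qed.

(** The member {x} of the first pair equals {x'} or {x', y'}. In both, x' has
    tag 0, so x' belongs to {x} and equals x. *)
Definition Inj1 :=
  LetIn (App Fst (Const 0)) (Sym (Comp Snd (App (Comp Snd (Comp Snd v0)) (Const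
    0)))).

Lemma req_mem s e a b I P tag el i : @lists a I P tag el -> req R s e a b -> P
  i ->
  exists k, kapp R s (proj0 e) (tag i) k /\ rmem R s k (el i) b.
Proof.
move=> la /reqP[ab _] Pi; apply: (ab s (prefix_refl s)).
exact: lists_intro.
Qed.

Lemma wp_inj1 s e x y x' y' : req R s e (pair_name x y) (pair_name x' y') ->
  wp (K s) Inj1 e (fun v => req R s v x x').
Proof.
move=> E; rewrite /Inj1 /=; apply: wp_app => /=.
have [k [ak mk]] := req_mem (i := 0) (lists_upair _ _) E I.
exists k; split=> //; apply: wp_app; rewrite /= !projE.
have [m [_ _ um]] := rmem_inv (lists_upair _ _) mk.
have x'u : exists l, kapp R s (proj1 (proj1 k)) 0 l /\ rmem R s l x'
  (upair_name x x).
  have um' := req_sym um; case: m um um' => [|m] um um';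
  have := req_mem (i := 0) (lists_upair _ _) um' I; by rewrite /symr !projE.
have [l [al /(rmem_inv (lists_upair _ _))[n [_ _ xl]]]] := x'u.
exists l; split=> //; apply: pure_symm; apply: req_sym.
by case: n xl.
Qed.
Opaque Inj1.

Definition Both a b := If a b (Const 0).

(** The member {x, y} equals {x'} or {x', y'}, so y equals y' or x'. In the
    second case, {x', y'} equals {x} or {x, y}, so y' equals y or x; if it
    equals x then y = x' = x = y'. *)
Definition Inj2 :=
  LetIn Inj1
  (LetIn (App (Comp Fst Snd) (Const 1))
  (LetIn (App (Comp Fst (Comp Snd v0)) (Const 1))
  (* environment: j, k, xx, e *)
  (If (Both (Comp Fst v1) (Comp Fst v0))
    (Comp Snd v0)
    (LetIn (App (Comp Snd (Comp Snd (Comp Snd Snd))) (Const 1))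
    (LetIn (App (Comp Fst (Comp Snd v0)) (Const 1))
    (* environment: j', k', j, k, xx, e *)
    (If (Both (Comp Fst v1) (Comp Fst v0))
      (Sym (Comp Snd v0))
      (Comp Trans (Pair (Comp Snd v2)
        (Comp Trans (Pair (Sym v4) (Sym (Comp Snd v0)))))))))))).

Lemma wp_if_both ans a b A B f g x (P : nat -> Prop) : pure a A -> pure b B ->
  (if (A x != 0) && (B x != 0) then wp ans f x P else wp ans g x P) ->
  wp ans (If (Both a b) f g) x P.
Proof.
move=> aA bB H; apply: wp_if; apply: wp_if; apply: aA.
case: eqP H => _ /= H; first by [].
by apply: bB; case: eqP H.
Qed.

(** A positive tag in an unordered pair means the second member, so y equals
    y' when both tags are positive, and otherwise x'. *)
Lemma mem_second s e x y x' y' : req R s e (pair_name x y) (pair_name x' y') ->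
  exists k, kapp R s (proj0 e) 1 k /\
    exists j, kapp R s (proj0 (proj1 k)) 1 j /\
    req R s (proj1 j) y (if (proj0 k != 0) && (proj0 j != 0) then y' else x').
Proof.
move=> E.
have [k [ak /(rmem_inv (lists_upair _ _))[m [_ km um]]]] :=
  req_mem (i := 1) (lists_upair _ _) E I.
exists k; split=> //; rewrite km.
have [j [aj hj]] := req_mem (i := 1) (lists_upair _ _) um I.
exists j; split=> //; move: hj.
by case: m {um km} => [|m] /(rmem_inv (lists_upair _ _))[[|n] [_ -> yn]].
Qed.

Lemma wp_inj2 s e x y x' y' : req R s e (pair_name x y) (pair_name x' y') ->
  wp (K s) Inj2 e (fun v => req R s v y y').
Proof.
move=> E; rewrite /Inj2 /=; apply: wp_mono (wp_inj1 E) => xx xxE.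
apply: wp_app; rewrite /= !projE.
have [k [ak [j [aj jy]]]] := mem_second E.
exists k; split=> //; apply: wp_app; rewrite /= !projE.
exists j; split=> //.
eapply wp_if_both; [solve [eauto 100 with pure]..|]; cbv beta; rewrite !projE.
case: ifP jy => _ jy; first by rewrite /= !projE.
rewrite /=; apply: wp_app; rewrite /= !projE.
have [k' [ak' [j' [aj' jy']]]] := mem_second (req_sym E).
rewrite /symr projE in ak'.
exists k'; split=> //; apply: wp_app; rewrite /= !projE.
exists j'; split=> //.
eapply wp_if_both; [solve [eauto 100 with pure]..|]; cbv beta; rewrite !projE.
case: ifP jy' => _ jy'; rewrite /= !projE; first by apply: pure_symm;
  apply: req_sym.
apply: pure_symm; apply: pure_symm; apply: pure_trans; apply: pure_trans;
  rewrite !projE.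
apply: req_trans jy _; apply: req_trans (req_sym xxE) _; exact: req_sym.
Qed.
Opaque Inj2.

End Pairs.
Hint Resolve pure_pair_i pure_pair_c pure_pair_e : pure.
Opaque MemEq upair_ir UpairI upair_er UpairE upair_cr UpairC pair_cr PairC
  pair_ir PairI pair_er PairE Inj1 Inj2.

(** * Bits and binary functions in the realizability model *)

Section Functions.
Variable R : kset.
Notation K := (kanswer R).

(** Realizes that 1 is the successor of an empty set, the right half of
    [f_bit]. *)
Definition one_succr :=
  npair 0 (npair (clos (Pair (Const 1) (Comp Snd Fst)) 0)
                 (clos (Pair (Const 0) (Comp Snd Fst)) 0)).

Lemma one_succr_realizes s :
  realizes R (∃' z, f_empty z ∧' f_succ (nat_name 1) z)%fml one_succr s.
Proof.
have no t k a : ~ rmem R t k a (nat_name 0) by move=> /(rmem_inv (lists_nat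
  0))[i []].
exists (nat_name 0); split; first exact: is_name_nat.
apply: realizes_and => [t st z nz u tu f /no//|].
move=> t st z nz; apply: realizes_and => u tu k.
  move=> /(rmem_inv (lists_nat 1))[i [i1 _ zi]].
  apply: clos_app; rewrite /= !projE; right; split=> //.
  by move: zi; case: i i1.
move=> H; apply: clos_app; rewrite /= !projE.
apply/(rmem_lists _ _ _ _ (lists_nat 1)); exists 0; rewrite !projE; split=> //.
by case: H => -[] => // _ /no.
Qed.

Lemma bit_intro s (b : bool) : realizes R (f_bit (nat_name b)) (npair b
  one_succr) s.
Proof.
case: b; first by apply: realizes_orr => //; exact: one_succr_realizes.
apply: realizes_orl.
by move=> t st z nz u tu f /(rmem_inv (lists_nat 0))[i []].
Qed.

(** One realizer for both values of the bit: if y is empty then nothing is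
    ever asked of it, and if y is 1 then the tag 0 and any realizer of the
    equality of two empty sets will do. *)
Definition bit_er k :=
  npair (clos (Const 0) 0)
    (clos (App (Comp Snd (Comp Snd (Comp Snd Snd))) (Const (npair 1 0))) k).

Lemma bit_elim s k y : is_name s y -> realizes R (f_bit y) k s ->
  req R s (bit_er k) y (nat_name (proj0 k != 0)).
Proof.
move=> ny; rewrite /f_bit /=.
have emp e t z : realizes R (f_empty z) e t -> is_name t z ->
    forall u f c, prefix t u -> ~ kmem u (kpair (knat f) c) z.
  move=> H nz u f c tu m.
  by have [k' [_ []]] := H u tu c (is_name_mem nz tu m) u (prefix_refl u) _
    (mem_refl R m).
case=> [[-> H]|[/eqP k0 [z [nz [Hz Hs]]]]]; rewrite ?k0 /=.
  apply/reqP; split=> t st f c m; first by case: (emp _ _ _ H ny _ _ _ st m).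
  by have [i []] := lists_elim (lists_nat 0) m.
have zero t c e : prefix s t -> req R t e c z -> forall e', req R t e' c
  (nat_name 0).
  move=> st /reqP[H _] e'; apply/reqP; split=> u tu f d m.
    have [l [_ /rmemP[d' [md _]]]] := H u tu f d m.
    by case: (emp _ _ _ Hz nz _ _ _ (prefix_trans st tu) md).
  by have [i []] := lists_elim (lists_nat 0) m.
apply/reqP; rewrite /bit_er !projE; split=> t st f c m.
  have nc := is_name_mem ny st m.
  have [H1 _] := Hs t st c nc.
  have [l [_ Hl]] := H1 t (prefix_refl t) _ (mem_refl R m).
  apply: clos_app; apply/(rmem_lists _ _ _ _ (lists_nat 1)); exists 0.
  rewrite proj00 proj10; split=> //.
  case: Hl => -[_]; last by move=> cz; exact: (zero _ _ _ st cz).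
  by move=> /rmemP[d [md _]]; case: (emp _ _ _ Hz nz _ _ _ st md).
have [i [i1 _ ci]] := lists_elim (lists_nat 1) m.
case: i i1 ci => // _ ci; apply: clos_app; apply: wp_app; rewrite /= !projE.
have nc := is_name_mem (is_name_nat s 1) st m.
have [_ H1] := Hs t st c nc.
have [|l [al ml]] := H1 t (prefix_refl t) (npair 1 0); last by exists l.
right; rewrite !projE; split=> //; apply/reqP; split=> u tu g d md.
  have := kmem_eqr (keq_mono tu ci) md.
  by move=> /(lists_elim (lists_nat 0))[i []].
by case: (emp _ _ _ Hz nz _ _ _ (prefix_trans st tu) md).
Qed.

Definition BitE := Pair (Const (clos (Const 0) 0))
  (Lam (App (Comp Snd (Comp Snd (Comp Snd Snd))) (Const (npair 1 0)))).
Lemma pure_bit_e : pure BitE bit_er.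
Proof. by rewrite /BitE; pure_by x. Qed.
Opaque bit_er BitE.

Definition pair_in_er a := transr (symr (pair_er (proj0 a))) (proj1 (proj1 a)).
Definition PairInE := Comp Trans (Pair (Sym (Comp PairE Fst)) (Comp Snd Snd)).
Lemma pure_pair_in_e : pure PairInE pair_in_er.
Proof. by rewrite /PairInE; pure_by x; rewrite !projE. Qed.

Lemma pair_in_elim s a x y g I P tag el : @lists g I P tag el ->
  is_name s x -> is_name s y -> is_name s g -> realizes R (f_pair_in x y g) a s ->
  exists i, P i /\ req R s (pair_in_er a) (pair_name x y) (el i).
Proof.
move=> lg nx ny ng [p [np [Hp /(rmem_inv lg)[i [Pi _ pi]]]]].
exists i; split=> //; apply: req_trans pi; apply: req_sym.
exact: pair_elim Hp.
Qed.
Opaque pair_in_er PairInE.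
Hint Resolve pure_bit_e pure_pair_in_e : pure.

Definition SingleValued := Comp Trans (Pair (Comp Inj2 (Comp PairInE (Comp Fst
  v0)))
  (Sym (Comp Inj2 (Comp PairInE (Comp Snd v0))))).

(** By injectivity of pairs, equal first coordinates give a realizer of the
    equality of [A i] and [A j], and the hypothesis turns it into an identity
    of names for the second coordinates. *)
Lemma single_valued s g I (P : I -> Prop) tag A B :
  lists g P tag (fun i => pair_name (A i) (B i)) -> is_name s g ->
  (forall t e i j, P i -> P j -> req R t e (A i) (A j) -> B i = B j) ->
  realizes R (f_single_valued g) (clos SingleValued 0) s.
Proof.
move=> lg ng AB t st x nx t1 tt1 y ny t2 tt2 z nz u tu k [H1 H2].
have {}nx := is_name_mono (prefix_trans tt1 (prefix_trans tt2 tu)) nx.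
have {}ny := is_name_mono (prefix_trans tt2 tu) ny.
have {}nz := is_name_mono tu nz.
have {}ng := is_name_mono (prefix_trans st (prefix_trans tt1 (prefix_trans tt2
  tu))) ng.
have [i [Pi ei]] := pair_in_elim lg nx ny ng H1.
have [j [Pj ej]] := pair_in_elim lg nx nz ng H2.
apply: clos_app; rewrite /SingleValued /= !projE.
apply: pure_pair_in_e; apply: wp_mono (wp_inj2 ei) => v yv.
apply: pure_pair_in_e; apply: wp_mono (wp_inj2 ej) => w zw.
apply: pure_symm; apply: pure_trans; rewrite !projE; apply: req_trans yv _.
have [v1 xv] := wp_exists (wp_inj1 ei).
have [w1 xw] := wp_exists (wp_inj1 ej).
rewrite (AB _ _ i j Pi Pj (req_trans (req_sym xv) xw)).
exact: (req_sym zw).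
Qed.

Definition Injective := Comp Trans (Pair (Comp Inj1 (Comp PairInE (Comp Fst v0)))
  (Sym (Comp Inj1 (Comp PairInE (Comp Snd v0))))).

Lemma injective_rel s g I (P : I -> Prop) tag A B :
  lists g P tag (fun i => pair_name (A i) (B i)) -> is_name s g ->
  (forall t e i j, P i -> P j -> req R t e (B i) (B j) -> A i = A j) ->
  realizes R (f_injective g) (clos Injective 0) s.
Proof.
move=> lg ng AB t st x nx t1 tt1 y ny t2 tt2 z nz u tu k [H1 H2].
have {}nx := is_name_mono (prefix_trans tt1 (prefix_trans tt2 tu)) nx.
have {}ny := is_name_mono (prefix_trans tt2 tu) ny.
have {}nz := is_name_mono tu nz.
have {}ng := is_name_mono (prefix_trans st (prefix_trans tt1 (prefix_trans tt2
  tu))) ng.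
have [i [Pi ei]] := pair_in_elim lg nx nz ng H1.
have [j [Pj ej]] := pair_in_elim lg ny nz ng H2.
apply: clos_app; rewrite /Injective /= !projE.
apply: pure_pair_in_e; apply: wp_mono (wp_inj1 ei) => v yv.
apply: pure_pair_in_e; apply: wp_mono (wp_inj1 ej) => w zw.
apply: pure_symm; apply: pure_trans; rewrite !projE; apply: req_trans yv _.
have [v1 xv] := wp_exists (wp_inj2 ei).
have [w1 xw] := wp_exists (wp_inj2 ej).
rewrite (AB _ _ i j Pi Pj (req_trans (req_sym xv) xw)).
exact: (req_sym zw).
Qed.

Lemma nat_name_inj s e i j : req R s e (nat_name i) (nat_name j) -> i = j.
Proof.
suff H m : forall i j s e, i <= m -> req R s e (nat_name i) (nat_name j) -> i
  <= j.
  move=> E; apply/eqP; rewrite eqn_leq (H i i j s e) // (H j j i s (symr e)) //.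
  exact: req_sym.
elim: m => [|m IHm] {}i {}j {}s {}e; first by rewrite leqn0 => /eqP->.
move=> im E; rewrite leqNgt; apply/negP => ji.
have [k [_ /(rmem_inv (lists_nat j))[l [lj _ jl]]]] := req_mem (lists_nat i) E ji.
have jm : j <= m by rewrite -ltnS; apply: leq_trans ji im.
by have := IHm j l s _ jm jl; rewrite leqNgt lj.
Qed.

Definition fun_name (D : nat -> Prop) (b : nat -> bool) : kset :=
  kconst (fun i : {i | D i} =>
    kpair (knat (sval i)) (pair_name (nat_name (sval i)) (nat_name (b (sval
      i))))).

Lemma lists_fun D b :
  lists (fun_name D b) D id (fun i => pair_name (nat_name i) (nat_name (b i))).
Proof.
move=> t x; rewrite kmem_const; split=> [[[i Di] xi]|[i Di xi]];
  first by exists i.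
by exists (exist D i Di).
Qed.

Lemma fun_name_ext D b c : (forall i, D i -> b i = c i) -> fun_name D b =
  fun_name D c.
Proof.
move=> bc; rewrite /fun_name; congr (@kconst _ _); apply/funext => -[i Di] /=.
by rewrite bc.
Qed.

Lemma is_name_fun s D b : is_name s (fun_name D b).
Proof.
apply: (lists_name (lists_fun D b)) => i _.
by apply: is_name_pair; apply: is_name_nat.
Qed.

Definition FunValues := Pair (Pair (Comp Fst v0) (Const reflr))
  (Pair (Pair (App Snd (Comp Fst v0)) (Const one_succr)) (Comp PairI (Comp Snd
    v0))).
Definition FunTotal := Pair
  (Comp PairI (Comp PairC (Pair (Sym (Comp Snd v0)) (Const reflr))))
  (Pair (Comp Fst v0) (Const reflr)).
Definition fun_ir beta := npair (clos FunValues beta) (npair (clos FunTotal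
  beta) (clos SingleValued 0)).
Definition FunI := Pair (Lam FunValues) (Pair (Lam FunTotal) (Const (clos
  SingleValued 0))).
Lemma pure_fun_i : pure FunI fun_ir.
Proof. by rewrite /FunI; pure_by x. Qed.

(** An index of the function is all that has to be known to realize that its
    graph is a binary function. *)
Lemma binary_fun_intro s beta D (b : nat -> bool) d : lists d D id nat_name ->
  (forall i, D i -> kapp R s beta i (b i)) ->
  realizes R (f_binary_fun (fun_name D b) d) (fun_ir beta) s.
Proof.
move=> ld Hb; apply: realizes_and; last apply: realizes_and.
- apply: realizes_all => t p st np; apply: realizes_imp => u k tu.
  move=> /(rmem_inv (lists_fun D b))[i [Di ki pi]].
  set Q := (X in wp _ _ _ X).
  rewrite /FunValues /= !projE; apply: wp_app; rewrite /= !projE ki.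
  exists (b i); split; first exact: kapp_mono (prefix_trans st tu) (Hb i Di).
  apply: pure_pair_i; rewrite /Q.
  apply: (realizes_ex (is_name_nat u i)).
  apply: (realizes_ex (is_name_nat u (b i))).
  apply: realizes_and; last apply: realizes_and.
  + apply/(rmem_lists _ _ _ _ ld); exists i; rewrite !projE; split=> //.
    exact: req_refl.
  + exact: bit_intro.
  + by apply: pair_intro pi; apply: is_name_nat.
- apply: realizes_all => t x st nx; apply: realizes_imp => u k tu.
  move=> /(rmem_inv ld)[i [Di ki xi]].
  set Q := (X in wp _ _ _ X).
  rewrite /FunTotal /= !projE.
  apply: pure_symm; apply: pure_pair_c; apply: pure_pair_i; rewrite !projE ki /Q.
  apply: (realizes_ex (is_name_nat u (b i))).
  apply: (realizes_ex (is_name_pair (is_name_nat u i) (is_name_nat u (b i)))).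
  apply: realizes_and.
    apply: pair_intro; [exact: is_name_mono nx|exact: is_name_nat|].
    by apply: pair_congr; [exact: (req_sym xi)|exact: req_refl].
  apply/(rmem_lists _ _ _ _ (lists_fun D b)); exists i; rewrite !projE;
    split=> //.
  exact: req_refl.
- apply: (single_valued (lists_fun D b)); first exact: is_name_fun.
  by move=> t e i j _ _ /nat_name_inj->.
Qed.
Opaque fun_ir FunI.

End Functions.
Opaque bit_er BitE pair_in_er PairInE fun_ir FunI.
Hint Resolve pure_bit_e pure_pair_in_e pure_fun_i : pure.

(** * Reading a finite sequence of the model *)

Lemma wp_iter_ind ans f n y (I : nat -> nat -> Prop) (P : nat -> Prop) :
  I 0 y -> (forall i z, i < n -> I i z -> wp ans f z (I i.+1)) ->
  (forall z, I n z -> P z) -> wp ans (Iter f) (npair n y) P.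
Proof.
rewrite /= !projE; elim: n I y => [|n IHn] I y I0 IS IP; first exact: IP.
apply: wp_mono (IS 0 y isT I0) => z Iz.
by apply: (IHn (fun i => I i.+1)) => // i w ni; apply: (IS i.+1).
Qed.

(** Sequences of length n correspond to the numbers below 2^n. The first term
    is the most significant digit, so a sequence is read from left to right by
    doubling and adding. *)
Fixpoint num (b : nat -> bool) (n : nat) : nat :=
  if n is m.+1 then (num b m).*2 + b m else 0.

Definition digit (n j i : nat) : bool := odd (iter (n - i.+1) half j).

Lemma num_lt b n : num b n < 2 ^ n.
Proof. by elim: n => //= n IHn; rewrite expnS; case: (b n); lia. Qed.

Lemma eq_num b c n : (forall i, i < n -> b i = c i) -> num b n = num c n.
Proof.
elim: n => //= n IHn H; rewrite (IHn) ?H // => i ni.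
by apply: H; apply: ltnW.
Qed.

Lemma digitS n j i : i < n -> digit n.+1 j i = digit n j./2 i.
Proof. by move=> ni; rewrite /digit subSS -(subnSK ni) iterSr. Qed.

Lemma digit_last n j : digit n.+1 j n = odd j.
Proof. by rewrite /digit subnn. Qed.

Lemma num_digit n j : j < 2 ^ n -> num (digit n j) n = j.
Proof.
elim: n j => [|n IHn] j /=; first by rewrite ltnS leqn0 => /eqP->.
move=> jn; rewrite digit_last (eq_num (c := digit n j./2)) => [|i];
  last exact: digitS.
rewrite IHn; first by rewrite addnC odd_double_half.
by rewrite expnS in jn; lia.
Qed.

Lemma digit_num b n i : i < n -> digit n (num b n) i = b i.
Proof.
elim: n => // n IHn; rewrite ltnS leq_eqVlt => /orP[/eqP->|ni].
  by rewrite digit_last /= oddD odd_double oddb.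
by rewrite digitS //= addnC half_bit_double IHn.
Qed.

Section Reading.
Variable R : kset.
Notation K := (kanswer R).

(** The environment is <i, <r, e>>, where r realizes that S is a binary
    function on d and e that d = n. Totality gives an element <i, y> of S, and
    the first clause of [f_binary_fun] gives for the same element a pair
    <x, y'> with a bit y'; by injectivity x = i. The output is the bit and a
    realizer for the standard pair of i and the bit to belong to S. *)
Definition Entry :=
  LetIn (App (Comp Fst (Comp Snd v1)) (App (Comp Snd (Comp Snd Snd)) v0))
  (LetIn (App (Comp Fst v2) (Comp Snd v0))
    (Pair (Comp Not (Comp Not (Comp Fst (Comp Fst (Comp Snd v0)))))
      (Pair (Comp Fst (Comp Snd v1))
        (Comp Trans (Pair
          (Sym (Comp Trans (Pair (Comp PairE (Comp Snd (Comp Snd v0)))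
            (Comp PairC (Pair
              (Comp Inj1 (Comp Trans (Pair (Sym (Comp PairE (Comp Snd (Comp Snd
                v0))))
                 (Comp PairE (Comp Fst v1)))))
              (Comp BitE (Comp Fst (Comp Snd v0))))))))
          (Comp Snd (Comp Snd v1))))))).

Section Elim.
Variables (s : node) (S d : kset) (r e n : nat).
Hypothesis nS : is_name s S.
Hypothesis Hr : realizes R (f_binary_fun S d) r s.
Hypothesis He : req R s e d (nat_name n).

Lemma binary_fun_member t k p : prefix s t -> is_name t p -> rmem R t k p S ->
  exists w, kapp R t (proj0 r) k w /\ exists x y, [/\ is_name t x, is_name t y,
    rmem R t (proj0 w) x d, req R t (bit_er (proj0 (proj1 w))) y
       (nat_name (proj0 (proj0 (proj1 w)) != 0)) &
    req R t (pair_er (proj1 (proj1 w))) p (pair_name x y)].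
Proof.
move=> st np pS; have [H _] := Hr.
have [w [aw [x [nx [y [ny [xd [by_ pxy]]]]]]]] := H t st p np t (prefix_refl t)
  k pS.
exists w; split=> //; exists x, y; split=> //; first exact: bit_elim.
exact: pair_elim.
Qed.

Lemma wp_entry t i : prefix s t -> i < n ->
  wp (K t) Entry (npair i (npair r e)) (fun v => exists b : bool,
    proj0 v = b /\ rmem R t (proj1 v) (pair_name (nat_name i) (nat_name b)) S).
Proof.
move=> st ni; set Q := (X in wp _ _ _ X); rewrite /Entry /=.
apply: wp_app; rewrite /= !projE; apply: wp_app; rewrite /= !projE.
have [q [aq qd]] := req_mem (lists_nat n) (req_sym (req_mono st He)) ni.
rewrite /symr projE in aq; exists q; split=> //.
have [_ [H2 _]] := Hr.
have [u [au [y [ny [p [np [Hp pS]]]]]]] :=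
  H2 t st _ (is_name_nat t i) t (prefix_refl t) q qd.
exists u; split=> //; apply: wp_app; rewrite /= !projE.
have [w [aw [x [y' [nx ny' xd yb pxy]]]]] := binary_fun_member st np pS.
exists w; split=> //; rewrite !projE.
apply: pure_not; apply: pure_not.
apply: pure_pair_e; apply: pure_pair_e; apply: pure_symm; apply: pure_pair_e;
  apply: pure_trans; rewrite !projE.
have E := req_trans (req_sym pxy) (pair_elim (is_name_nat t i) ny np Hp).
apply: wp_mono (wp_inj1 E) => v xi.
apply: pure_bit_e; apply: pure_pair_c; apply: pure_trans; apply: pure_symm;
  apply: pure_trans; rewrite /Q !projE.
exists (proj0 (proj0 (proj1 w)) != 0); split;
  first by case: (proj0 (proj0 (proj1 w)) == 0).
have E2 := req_trans pxy (pair_congr xi yb).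
exact: mem_eql (req_sym E2) pS.
Qed.

Opaque Entry.

Definition valued t i b :=
  exists k, rmem R t k (pair_name (nat_name i) (nat_name (nat_of_bool b))) S.

Lemma valued_unique t i b c : prefix s t -> valued t i b -> valued t i c -> b = c.
Proof.
move=> st [k Hk] [l Hl]; have [_ [_ H]] := Hr.
have pin m (a : bool) : rmem R t m (pair_name (nat_name i) (nat_name a)) S ->
    realizes R (f_pair_in (nat_name i) (nat_name a) S) (npair (pair_ir reflr)
      m) t.
  move=> Hm; apply: (@realizes_ex _ _ (pair_name (nat_name i) (nat_name a))).
    by apply: is_name_pair; apply: is_name_nat.
  apply: realizes_and; last exact: Hm.
  by apply: pair_intro; [exact: is_name_nat|exact: is_name_nat|exact: req_refl].
have [v [_ E]] := H t st _ (is_name_nat t i) t (prefix_refl t) _ (is_name_nat t b)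
  t (prefix_refl t) _ (is_name_nat t c) t (prefix_refl t) _
  (realizes_and (pin _ _ Hk) (pin _ _ Hl)).
by have := nat_name_inj E; case: b {Hk E}; case: c {Hl}.
Qed.

(** The bits are already determined at [s], because they are computed there
    from the realizer. *)
Lemma valued_exists : exists b : nat -> bool, forall i, i < n -> valued s i (b i).
Proof.
have H i : exists b : bool, i < n -> valued s i b.
  case: (ltnP i n) => ni; last by exists false.
  have [v [b [_ vb]]] := wp_exists (wp_entry (prefix_refl s) ni).
  by exists b => _; exists (proj1 v).
by have [b Hb] := choice H; exists b.
Qed.

Lemma valued_mono t u i b : prefix t u -> valued t i b -> valued u i b.
Proof. by move=> tu [k Hk]; exists k; apply: rmem_mono Hk. Qed.

Definition SeqIncluded :=
  LetIn (App (Comp Fst v1) (Pair v0 (Const reflr)))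
  (LetIn (Comp MemEq (Pair (Comp Fst v0) (Comp Snd (Comp Snd Snd))))
    (Pair (Comp Fst v0) (Comp Trans (Pair (Comp PairE (Comp Snd (Comp Snd v1)))
       (Comp PairC (Pair (Comp Snd v0) (Comp BitE (Comp Fst (Comp Snd v1))))))))).
Definition seq_eqr p := npair (clos SeqIncluded p) (clos (Comp Snd Entry) p).
Definition SeqEq := Pair (Lam SeqIncluded) (Lam (Comp Snd Entry)).
Lemma pure_seq_eq : pure SeqEq seq_eqr. Proof. by rewrite /SeqEq; pure_by x. Qed.

(** So the model has no finite binary sequences besides the standard ones, and
    the equality is realized by a number computed from the realizers. *)
Lemma binary_fun_eq b : (forall i, i < n -> valued s i (b i)) ->
  req R s (seq_eqr (npair r e)) S (fun_name (fun i => i < n) b).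
Proof.
move=> Hb; apply/reqP; rewrite /seq_eqr !projE; split=> t st f c m; last first.
  have [i [ni -> ci]] := lists_elim (lists_fun _ _) m.
  apply: clos_app => /=; have := wp_entry st ni; apply: wp_mono => v [b' [_ vb]].
  have E : b' = b i.
    apply: (valued_unique st (i := i)); first by exists (proj1 v).
    exact: (valued_mono st (Hb i ni)).
  rewrite -E in ci; move/rmemP: vb => [x [xS cx]]; apply/rmemP; exists x;
    split=> //.
  by apply: req_keq cx; [apply: keq_sym|apply: keq_refl].
have nc := is_name_mem nS st m.
have [w [aw [x [y [nx ny xd yb cxy]]]]] := binary_fun_member st nc (mem_refl R m).
clos_start Q; rewrite /SeqIncluded /=; apply: wp_app; rewrite /= !projE.
exists w; split=> //; rewrite !projE.
apply: wp_mono (wp_mem_eq xd (req_mono st He)) =>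
  l /(rmem_inv (lists_nat n))[i [ni li xi]].
rewrite !projE; apply: pure_pair_e; apply: pure_bit_e; apply: pure_pair_c;
  apply: pure_trans; rewrite !projE.
have E := req_trans cxy (pair_congr xi yb).
rewrite /Q; apply/(rmem_lists _ _ _ _ (lists_fun _ b)).
exists i; rewrite !projE; split=> //.
suff <- : (proj0 (proj0 (proj1 w)) != 0) = b i by exact: E.
apply: (valued_unique st (i := i)); last exact: (valued_mono st (Hb i ni)).
eexists; exact: mem_eql (req_sym E) (mem_refl R m).
Qed.

Definition ReadStep := Pair (Comp Succ v0) (Pair
  (Comp Add (Pair (Comp Double v1) (Comp Fst (Comp Entry (Pair v0 (Comp Snd
    Snd))))))
  (Comp Snd Snd)).
Definition ReadLoop := Iter ReadStep.
Definition Read :=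
  Comp v1 (Comp ReadLoop (Pair Fst (Pair (Const 0) (Pair (Const 0) Snd)))).

Lemma wp_read b (P : nat -> Prop) : (forall i, i < n -> valued s i (b i)) ->
  P (num b n) -> wp (K s) Read (npair n (npair r e)) P.
Proof.
move=> Hb H; rewrite /Read; cbn -[ReadLoop]; rewrite !projE /ReadLoop.
pose I i z := z = npair i (npair (num b i) (npair r e)).
apply: (wp_iter_ind (I := I)) => // [i _ ni ->|_ ->]; last by rewrite /= !projE.
rewrite /ReadStep /= !projE; apply: pure_double.
apply: wp_mono (wp_entry (prefix_refl s) ni) => v [b' [vb vS]].
apply: pure_add; rewrite !projE vb /I /=;
  congr (npair _ (npair (_ + nat_of_bool _) _)).
apply: (valued_unique (prefix_refl s) (i := i)); last exact: Hb.
by exists (proj1 v).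
Qed.

End Elim.
End Reading.
Opaque Entry Read seq_eqr SeqEq.
Hint Resolve pure_seq_eq : pure.

(** * The search for a level half of which lies outside the tree *)

Definition Sub := Iter Pred.
Lemma pure_sub : pure Sub (fun x => proj1 x - proj0 x).
Proof.
rewrite /Sub; pure_by x; elim: (proj0 x) => [|m /= ->]; first by rewrite subn0.
by rewrite subnS.
Qed.
Opaque Sub.
Hint Resolve pure_sub : pure.

Definition Digit := Comp Odd (Comp (Iter Half)
  (Pair (Comp Sub (Pair (Comp Succ v0) v1)) (Comp Snd Snd))).

Lemma pure_digit :
  pure Digit (fun x => digit (proj0 (proj1 x)) (proj1 (proj1 x)) (proj0 x)).
Proof.
by rewrite /Digit; pure_by x; rewrite !projE.
Qed.
Opaque Digit.

Definition seq_name n j := fun_name (fun i => i < n) (digit n j).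

Definition SeqFun := Comp FunI (Lam Digit).
Definition seq_funr x := fun_ir (clos Digit x).
Lemma pure_seq_fun : pure SeqFun seq_funr. Proof. by rewrite /SeqFun;
  pure_by x. Qed.
Opaque SeqFun.
Hint Resolve pure_seq_fun : pure.

Definition FinSeq := Pair (Pair Fst (Const reflr)) SeqFun.
Definition fin_seqr x := npair (npair (proj0 x) reflr) (seq_funr x).
Lemma pure_fin_seq : pure FinSeq fin_seqr. Proof. by rewrite /FinSeq;
  pure_by x. Qed.
Opaque FinSeq.
Hint Resolve pure_fin_seq : pure.

Definition Pow2 := Comp (Iter Double) (Pair Id (Const 1)).
Lemma pure_pow2 : pure Pow2 (expn 2).
Proof.
rewrite /Pow2; pure_by x; rewrite !projE.
by elim: x => //= n ->; rewrite expnS mul2n.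
Qed.
Opaque Pow2.
Hint Resolve pure_pow2 : pure.

Definition list_code := foldr npair 0.

Lemma nthp_list_code l i : nthp (list_code l) i = nth 0 l i.
Proof.
elim: l i => [|a l IHl] [|i]; rewrite /nthp ?iterSr /= ?projE ?proj00 //.
  by rewrite proj10; elim: i => [|i]; rewrite ?iterSr ?proj00 ?proj10.
exact: IHl.
Qed.

Section Search.
Variable R : kset.
Notation K := (kanswer R).

Lemma kapp_digit s n j i : kapp R s (clos Digit (npair n j)) i (digit n j i).
Proof.
have [v [Hv E]] : exists v, kapp R s (clos Digit (npair n j)) i v /\ v = digit
  n j i.
  by apply: clos_app; apply: pure_digit; rewrite !projE.
by rewrite -E.
Qed.

Lemma binary_fun_seq s n j :
  realizes R (f_binary_fun (seq_name n j) (nat_name n)) (seq_funr (npair n j)) s.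
Proof.
apply: binary_fun_intro => [|i _]; first exact: lists_nat.
exact: kapp_digit.
Qed.

Lemma finite_seq_seq s n j :
  realizes R (f_finite_seq omega_name (seq_name n j)) (fin_seqr (npair n j)) s.
Proof.
apply: (realizes_ex (is_name_nat s n)); rewrite /fin_seqr projE.
apply: realizes_and; last exact: binary_fun_seq.
apply/(rmem_lists _ _ _ _ lists_omega); exists n; rewrite !projE; split=> //.
exact: req_refl.
Qed.

Lemma seq_name_inj s e n i j : i < 2 ^ n -> j < 2 ^ n ->
  req R s e (seq_name n i) (seq_name n j) -> i = j.
Proof.
move=> ni nj E; rewrite -(num_digit ni) -(num_digit nj); apply: eq_num => m mn.
have [k [_ /(rmem_inv (lists_fun _ _))[m' [_ _ p]]]] := req_mem (lists_fun _ _)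
  E mn.
have [v mm] := wp_exists (wp_inj1 p); have [w dd] := wp_exists (wp_inj2 p).
have := nat_name_inj dd; rewrite -(nat_name_inj mm).
by case: (digit n i m); case: (digit n j m).
Qed.

(** The state is <j, <L, <c, <n, g>>>>: among the sequences numbered below j,
    those rejected by the decision procedure g are listed in L, the last one
    first, and c is their number. *)
Definition CollectStep :=
  LetIn (App (Comp Snd (Comp Snd (Comp Snd Snd))) (Comp FinSeq (Pair v3 v0)))
   (Pair (Comp Succ v1)
     (If (Comp Fst v0)
        (Pair (Pair v1 v2) (Pair (Comp Succ v3) (Comp Snd (Comp Snd (Comp Snd
          Snd)))))
        (Comp Snd Snd))).
Definition CollectLoop := Iter CollectStep.
Definition Collect := Comp CollectLoop (Pair (Comp Pow2 Fst)
  (Pair (Const 0) (Pair (Const 0) (Pair (Const 0) Id)))).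
Definition TooFew := Comp Sub (Pair (Comp Double (Comp v2 Collect)) (Comp Pow2
  Fst)).
Definition SearchLoop := While TooFew (Pair (Comp Succ Fst) Snd).
Definition Search :=
  Comp (Pair Fst (Comp v1 Collect)) (Comp SearchLoop (Pair (Const 0) Id)).

Section Decidable.
Variables (s : node) (T : kset) (g : nat).
Hypothesis Hg : realizes R (f_decidable omega_name T) g s.

Definition inside n j := exists k, rmem R s k (seq_name n j) T.
Definition outside n j := ~~ `[< inside n j >].
Definition outs n i := rev [seq j <- iota 0 i | outside n j].

Lemma outs_size n i : outs n i.+1 =
  if outside n i then i :: outs n i else outs n i.
Proof.
rewrite /outs -addn1 iotaD add0n filter_cat rev_cat /=.
by case: ifP.
Qed.

Lemma decide n j : exists a, [/\ kapp R s g (fin_seqr (npair n j)) a,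
  (proj0 a != 0) = outside n j &
  proj0 a = 0 -> rmem R s (proj1 a) (seq_name n j) T].
Proof.
have [a [ag Ha]] := Hg (prefix_refl s) (is_name_fun _ _ _) (prefix_refl s)
  (finite_seq_seq s n j).
exists a; split=> //.
  rewrite /outside; case: Ha => -[].
    move=> -> H; rewrite eqxx /=; apply/esym/negbTE; rewrite negbK; apply/asboolP.
    by exists (proj1 a).
  move=> /eqP-> H; apply/esym; apply/asboolP => -[k Hk].
  by have [v [_ []]] := H s (prefix_refl s) k Hk.
by move=> a0; case: Ha => -[].
Qed.

(** Rejection realizes a negation, which later nodes inherit. *)
Lemma outside_never n j t k : outside n j -> prefix s t ->
  ~ rmem R t k (seq_name n j) T.
Proof.
move=> o st Hk; have [a [ag E _]] := decide n j.
have [a' [ag' Ha]] := Hg (prefix_refl s) (is_name_fun _ _ _) (prefix_refl s)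
  (finite_seq_seq s n j).
case: Ha => -[a0 H].
  by move: o; rewrite /outside => /asboolP; apply; exists (proj1 a').
by have [v [_ []]] := H t st k Hk.
Qed.

Lemma wp_collect n (P : nat -> Prop) :
  P (npair (2 ^ n) (npair (list_code (outs n (2 ^ n)))
       (npair (size (outs n (2 ^ n))) (npair n g)))) ->
  wp (K s) Collect (npair n g) P.
Proof.
move=> H; rewrite /Collect; cbn -[CollectLoop]; rewrite !projE.
apply: pure_pow2; rewrite /CollectLoop.
pose I i z := z = npair i (npair (list_code (outs n i)) (npair (size (outs n
  i)) (npair n g))).
apply: (wp_iter_ind (I := I)) => // [i _ ni ->|_ -> //].
have [a [ag ao _]] := decide n i.
rewrite /CollectStep /=; apply: wp_app; rewrite /= !projE.
apply: pure_fin_seq; exists a; split=> //; rewrite !projE.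
apply: wp_if; rewrite /= !projE /I outs_size -ao.
by case: eqP.
Qed.

Lemma wp_too_few n (P : nat -> Prop) :
  P (2 ^ n - (size (outs n (2 ^ n))).*2) -> wp (K s) TooFew (npair n g) P.
Proof.
move=> H; rewrite /TooFew; cbn -[Collect]; apply: wp_collect; rewrite !projE.
by apply: pure_double; apply: pure_pow2; apply: pure_sub; rewrite !projE.
Qed.

Definition enough n := 2 ^ n <= (size (outs n (2 ^ n))).*2.

Lemma wp_search (P : nat -> Prop) : (exists n, enough n) ->
  (forall n, enough n -> P (npair n (list_code (outs n (2 ^ n))))) ->
  wp (K s) Search g P.
Proof.
move=> [N HN] HP; rewrite /Search; cbn -[SearchLoop Collect].
suff H : wp (K s) SearchLoop (npair 0 g) (fun v =>
  exists2 n, enough n & v = npair n g).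
  apply: wp_mono H => _ [n en ->]; apply: wp_collect; rewrite !projE; exact: HP.
exists N; move: HN; rewrite -{1}(add0n N); elim: N 0 => [|k IHk] m eN;
  apply: wp_too_few.
  rewrite addn0 in eN; move/eqP: (eN) => ->; by exists m.
case E: (_ - _) => [|d]; first by exists m => //; apply/eqP.
by rewrite /= !projE; apply: IHk; rewrite addSnnS.
Qed.

End Decidable.
End Search.
Opaque Collect Search seq_funr.

(** * The injection from the sequences outside the tree *)

(** The environment is <k, <n, L>>, L listing the sequences outside the tree.
    Sequence j is sent to the parity of j and to item j/2 of L; the latter
    exists because 2^n is at most twice the length of L. *)
Definition HalfValues := Pair (Comp SeqFun (Pair v1 (Comp Fst v0)))
  (Pair (Pair (Comp Odd (Comp Fst v0)) (Const one_succr))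
  (Pair (Comp SeqFun (Pair v1 (Comp Nth (Pair (Comp Half (Comp Fst v0)) (Comp
    Snd Snd)))))
  (Pair (Const 0) (Pair (Const (pair_ir reflr)) (Comp PairI (Comp Snd v0)))))).
Definition HalfTotal :=
  LetIn (Comp Read (Pair v1 (Pair v0 (Const reflr))))
   (Pair (Comp PairI (Comp PairC (Pair (Sym (Comp SeqEq (Pair v1 (Const
     reflr)))) (Const reflr))))
     (Pair v0 (Const reflr))).
Definition Answer := Pair (Pair Fst (Const reflr))
  (Pair (Lam HalfValues) (Pair (Lam HalfTotal) (Const (npair (clos SingleValued
    0) (clos Injective 0))))).

Section HalfOutside.
Variable R : kset.
Notation K := (kanswer R).
Variables (s : node) (T : kset) (g : nat).
Hypothesis Hg : realizes R (f_decidable omega_name T) g s.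
Notation outside := (outside R s T).
Notation outs := (outs R s T).

Section Injection.
Variable n : nat.
Hypothesis n_enough : enough R s T n.
Let L := outs n (2 ^ n).
Let A i := seq_name n i.
Let q (i : nat) := pair_name (nat_name (odd i)) (seq_name n (nth 0 L i./2)).
Let rel := kconst (fun i : {i | i < 2 ^ n} =>
  kpair (knat (sval i)) (pair_name (A (sval i)) (q (sval i)))).

Lemma lists_rel : lists rel (fun i => i < 2 ^ n) id (fun i =>
  pair_name (A i) (q i)).
Proof.
move=> t x; rewrite kmem_const; split=> [[[i Di] xi]|[i Di xi]];
  first by exists i.
by exists (exist (fun i => i < 2 ^ n) i Di).
Qed.

Lemma is_name_q t i : is_name t (q i).
Proof. by apply: is_name_pair; [exact: is_name_nat|exact: is_name_fun]. Qed.

Lemma is_name_el t i : is_name t (pair_name (A i) (q i)).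
Proof. by apply: is_name_pair; [exact: is_name_fun|exact: is_name_q]. Qed.

Lemma is_name_rel t : is_name t rel.
Proof. by apply: (lists_name lists_rel) => i _; apply: is_name_el. Qed.

Lemma nth_outs i : i < 2 ^ n ->
  outside n (nth 0 L i./2) /\ nth 0 L i./2 < 2 ^ n.
Proof.
move=> i2; have iL : i./2 < size L.
  by rewrite ltn_half_double; apply: leq_trans i2 n_enough.
have := mem_nth 0 iL; rewrite {2}/L /outs mem_rev mem_filter mem_iota add0n.
by case/andP=> -> /andP[_ ->].
Qed.

Lemma half_realized : realizes R (f_half_outside T (nat_name n))
  (npair (clos HalfValues (npair n (list_code L))) (npair (clos HalfTotal
    (npair n (list_code L)))
    (npair (clos SingleValued 0) (clos Injective 0)))) s.
Proof.
apply: (realizes_ex (is_name_rel s)).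
apply: realizes_and; last apply: realizes_and; last apply: realizes_and.
- apply: realizes_all => t p st np; apply: realizes_imp => u k tu.
  move=> /(rmem_inv lists_rel)[i [i2 ki pi]].
  set Q := (X in wp _ _ _ X); rewrite /HalfValues /= !projE.
  apply: pure_seq_fun; apply: pure_odd; apply: pure_half; apply: pure_nth;
    apply: pure_seq_fun.
  apply: pure_pair_i; rewrite !projE ki nthp_list_code /Q.
  apply: (realizes_ex (is_name_fun u _ _)).
  apply: (realizes_ex (is_name_nat u (odd i))).
  apply: (realizes_ex (is_name_fun u _ _)).
  apply: (realizes_ex (is_name_q u i)).
  apply: realizes_and; first exact: binary_fun_seq.
  apply: realizes_and; first exact: bit_intro.
  apply: realizes_and; first exact: binary_fun_seq.
  apply: realizes_and.
    (* a negation that holds at all later nodes is realized by any number *)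
    move=> w uw k' Hk'; have [o _] := nth_outs i2.
    by case: (outside_never Hg o (prefix_trans (prefix_trans st tu) uw) Hk').
  apply: realizes_and.
    by apply: pair_intro; [exact: is_name_nat|exact: is_name_fun|exact: req_refl].
  by apply: pair_intro pi; [exact: is_name_fun|exact: is_name_q].
- apply: realizes_all => t S st nS; apply: realizes_imp => u r tu Hr.
  set Q := (X in wp _ _ _ X); rewrite /HalfTotal /= !projE.
  have {}nS := is_name_mono tu nS.
  have E := req_refl R u (nat_name n).
  have [b Hb] := valued_exists Hr E.
  apply: (wp_read Hr E Hb).
  rewrite /= !projE; apply: pure_seq_eq; apply: pure_symm; apply: pure_pair_c;
    apply: pure_pair_i.
  rewrite !projE /Q; set j := num b n.
  have jn : j < 2 ^ n := num_lt b n.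
  apply: (realizes_ex (is_name_q u j)).
  apply: (realizes_ex (is_name_el u j)).
  apply: realizes_and.
    apply: pair_intro => //; first exact: is_name_q.
    apply: pair_congr; last exact: req_refl.
    apply: req_sym; have := binary_fun_eq nS Hr E Hb.
    by rewrite (@fun_name_ext _ b (digit n j)) // => i ni; rewrite digit_num.
  apply/(rmem_lists _ _ _ _ lists_rel); exists j; rewrite !projE; split=> //.
  exact: req_refl.
- apply: (single_valued lists_rel); first exact: is_name_rel.
  by move=> t e i j i2 j2 /(seq_name_inj i2 j2)->.
- apply: (injective_rel lists_rel); first exact: is_name_rel.
  move=> t e i j i2 j2 E.
  have [v /nat_name_inj oi] := wp_exists (wp_inj1 E).
  have [w lij] := wp_exists (wp_inj2 E).
  have [_ li] := nth_outs i2; have [_ lj] := nth_outs j2.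
  have := seq_name_inj li lj lij.
  move=> /eqP; rewrite nth_uniq; last first.
  + by rewrite rev_uniq filter_uniq // iota_uniq.
  + by rewrite ltn_half_double; apply: leq_trans j2 n_enough.
  + by rewrite ltn_half_double; apply: leq_trans i2 n_enough.
  move=> /eqP ij; congr seq_name;
    rewrite -(odd_double_half i) -(odd_double_half j) ij.
  by congr (_ + _).
Qed.

End Injection.

Lemma wp_answer : (exists n, enough R s T n) ->
  wp (K s) (Comp Answer Search) g (fun v => realizes R
    (∃' n, n ∈' omega_name ∧' f_half_outside T n)%fml v s).
Proof.
move=> H; set Q := (X in wp _ _ _ X); rewrite /=.
apply: (wp_search Hg H) => n en; rewrite /Answer /=.
apply: pure_lam; apply: pure_lam; rewrite !projE /Q.
apply: (realizes_ex (is_name_nat s n)).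
apply: realizes_and; last exact: half_realized.
apply/(rmem_lists _ _ _ _ lists_omega); exists n; rewrite !projE; split=> //.
exact: req_refl.
Qed.

End HalfOutside.
Opaque Answer.

(** * Trees large at all levels have positive measure *)

(** Weak Koenig's lemma: extend towards a side on which arbitrarily long
    elements remain. *)
Lemma konig (T : set (seq bool)) : binary_tree T ->
  (forall n, exists2 t, T t & size t = n) -> exists p, branches T p.
Proof.
move=> bT inf.
pose big s := forall n, exists2 t, T t & prefix s t /\ n <= size t.
have big0 : big [::].
  by move=> n; have [t Tt tn] := inf n; exists t => //; rewrite tn prefix0s.
have bigS s : big s -> big (rcons s true) \/ big (rcons s false).
  move=> H; case: (pselect (big (rcons s true))) => [|/existsNP[n Hn]];
    first by left.
  right=> m; have [t Tt [/prefixP[u tu] mt]] := H (maxn (size s).+1 (maxn m n)).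
  move: mt; rewrite !geq_max => /and3P[st mt nt].
  case: u tu => [|b u] tu; first by move: st; rewrite tu cats0 ltnn.
  have sbt : prefix (rcons s b) t.
    by apply/prefixP; exists u; rewrite tu cat_rcons.
  case: b tu sbt => tu sbt; last by exists t.
  by case: Hn; exists t.
pose next s := if `[< big (rcons s true) >] then rcons s true else rcons s false.
pose S n := iter n next [::].
have bigS' n : big (S n).
  elim: n => //= n IHn; rewrite /next; case: asboolP => // H.
  by case: (bigS _ IHn).
have sizeS n : size (S n) = n.
  by elim: n => //= n IHn; rewrite /next; case: ifP; rewrite size_rcons IHn.
exists (fun n => last true (S n.+1)) => n.
suff -> : mkseq (fun n => last true (S n.+1)) n = S n.
  by have [t Tt [st _]] := bigS' n 0; apply: bT st Tt.
elim: n => // n IHn; rewrite mkseqS IHn -[S n.+1]/(next (S n)) /next.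
by case: ifP => _; rewrite last_rcons.
Qed.

Lemma card_extensions N (s : seq bool) : size s <= N ->
  #|[set t : N.-tuple bool | prefix s t]| <= 2 ^ (N - size s).
Proof.
move=> sN; set A := [set t | _].
pose f (t : N.-tuple bool) := [tuple of drop (size s) t].
have fI : {in A &, injective f}.
  move=> t u; rewrite !inE !prefixE => /eqP st /eqP su /(congr1 val) /= E.
  apply: val_inj => /=;
    rewrite -(cat_take_drop (size s) t) -(cat_take_drop (size s) u).
  by congr cat; first by rewrite st su.
rewrite -(card_in_imset fI); apply: leq_trans (max_card _) _.
by rewrite card_tuple card_bool.
Qed.

Section Measure.
Import Order.TTheory GRing.Theory Num.Theory.

(** Let cylinders cover the branches. By compactness some level N of the tree
    is covered: otherwise the elements of the tree extending no string of the
    cover form a tree with a branch. At level N a string of length l has at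
    most 2^(N - l) extensions, and more than half of all sequences are in the
    tree, so the measures of the cylinders add up to at least 1/2. *)
Lemma coin_measure_pos (T : set (seq bool)) : binary_tree T ->
  (forall n, 2 ^ n < (#|[set t : n.-tuple bool | `[< T t >]]|).*2) ->
  (0 < coin_measure (branches T))%E.
Proof.
move=> bT big.
apply: (@lt_le_trans _ _ (2%:R^-1 : Rdefinitions.R)%R%:E).
  by rewrite lte_fin invr_gt0 ltr0n.
apply: le_ereal_inf_tmp => _ [s cover <-].
pose bad : set (seq bool) := [set t | T t /\ forall k, ~~ prefix (s k) t]%classic.
have bad_tree : binary_tree bad.
  move=> u t ut [Tt nt]; split; first exact: bT Tt.
  by move=> k; apply: contra (nt k) => /prefix_trans; apply.
have [N HN] : exists N, forall t, T t -> size t = N -> exists k, prefix (s k) t.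
  apply: contrapT => /forallNP H.
  have [|p pbad] := konig bad_tree.
    move=> n; have /existsNP[t /not_implyP[Tt /not_implyP[tn nk]]] := H n.
    exists t => //; split=> // k; apply/negP => st; apply: nk; by exists k.
  have [|k _ pk] := cover p; first by move=> n; have [] := pbad n.
  have [_ /(_ k)] := pbad (size (s k)).
  by rewrite pk prefix_refl.
pose A := [set t : N.-tuple bool | `[< T t >]].
have kP (t : N.-tuple bool) : exists k, t \in A -> prefix (s k) t.
  case tA: (t \in A); last by exists 0.
  have [k kt] : exists k, prefix (s k) t.
    by apply: HN; rewrite ?size_tuple //; move: tA; rewrite inE => /asboolP.
  by exists k.
have [k kA] := choice kP.
pose M := (\max_(t : N.-tuple bool) k t).+1.
have cardA : #|A| <= \sum_(i < M | size (s i) <= N) 2 ^ (N - size (s i)).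
  apply: (@leq_trans (\sum_(i < M | size (s i) <= N)
    #|[set t : N.-tuple bool | prefix (s i) t]|)); last first.
    by apply: leq_sum => i; apply: card_extensions.
  have sub : A \subset \bigcup_(i < M | size (s i) <= N)
      [set t : N.-tuple bool | prefix (s i) t].
    apply/fintype.subsetP => t tA.
    have ktM : k t < M by rewrite ltnS leq_bigmax.
    apply/bigcupP; exists (Ordinal ktM); last by rewrite inE; apply: kA.
    by have /size_prefix := kA t tA; rewrite size_tuple.
  apply: leq_trans (subset_leq_card sub) _.
  elim/big_rec2: _ => [|i a B _ H]; first by rewrite cards0.
  by apply: leq_trans (leq_card_setU _ _) _; rewrite leq_add2l.
have H := @nneseries_lim_ge _
  (fun i => ((2%:R^-1 : Rdefinitions.R) ^+ size (s i))%R%:E) xpredT 0 M.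
apply: (le_trans _ (H _)); last first.
  by move=> n _ _; rewrite lee_fin exprn_ge0 // invr_ge0 ler0n.
rewrite sumEFin lee_fin big_mkord.
have pos n : (0 < 2%:R ^+ n :> Rdefinitions.R)%R by rewrite exprn_gt0 // ltr0n.
apply: (@le_trans _ _ (\sum_(i < M | (size (s i) <= N)%N)
   (2%:R^-1 : Rdefinitions.R) ^+ size (s i))%R); last first.
  rewrite [leRHS](bigID (fun i : 'I_M => size (s i) <= N)) /= lerDl.
  by apply: sumr_ge0 => i _; rewrite exprn_ge0 // invr_ge0 ler0n.
rewrite -(ler_pM2l (pos N)) mulr_sumr.
have E (i : 'I_M) : size (s i) <= N ->
    (2%:R ^+ N * 2%:R^-1 ^+ size (s i) = (2 ^ (N - size (s i)))%:R
      :> Rdefinitions.R)%R.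
  move=> iN; rewrite natrX -[in X in (2%:R ^+ X * _)%R](subnK iN) exprD -mulrA
    -exprMn.
  by rewrite divff ?expr1n ?mulr1 // pnatr_eq0.
rewrite (eq_bigr _ E) -natr_sum ler_pdivrMr ?ltr0n // -natrX -natrM ler_nat.
by rewrite muln2; apply: ltnW; apply: leq_trans (big N) _; rewrite leq_double.
Qed.

End Measure.

(** * The oracle at a node *)

Lemma computable_clos ans f (h : nat -> nat) :
  (forall x, wp ans f x (fun v =>
    v = h x)) -> exists e, forall x, computes ans e x (h x).
Proof.
move=> H; exists (clos (Comp f Fst) 0) => x.
have [|v [c E]] := @clos_app ans (Comp f Fst) 0 x (fun v => v = h x).
  by rewrite /= projE; apply: H.
by rewrite -E.
Qed.

Definition decides (O : set nat) (q : fn) (A : set nat) : Prop :=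
  forall x, wp (answer O) q x (fun v => v = (x \in A)).

Lemma decides_turing O A : turing_le A O -> exists q, decides O q A.
Proof.
move=> [e He]; exists (Comp Univ (Pair (Const e) Id)) => x /=.
exact: wp_univ (He x) _.
Qed.

Lemma decides_eq O q A B : decides O q A -> A = B -> decides O q B.
Proof. by move=> H <-. Qed.

(** The first N values are kept in a table. *)
Lemma decides_prepend O A N :
  (exists q, decides O q (fun x => A (N + x))) -> exists q, decides O q A.
Proof.
elim: N A => [|N IHN] A [q Hq]; first by exists q; apply: decides_eq Hq _;
  apply/funext => x; rewrite add0n.
have [|q' Hq'] := IHN (fun x => A x.+1).
  by exists q; apply: decides_eq Hq _; apply/funext => x; rewrite addSn.
exists (If Id (Comp q' Pred) (Const (0 \in (A : set nat)))) => x.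
by apply: wp_if => /=; case: x => [|x] /=; first done; exact: Hq'.
Qed.

Lemma decides_finite_change O A B :
  finite_set ((B `\` A) `|` (A `\` B))%classic ->
  (exists q, decides O q A) -> exists q, decides O q B.
Proof.
move=> /finite_seqP[s sE] [q Hq].
pose N := (\max_(x <- s) x).+1.
apply: (@decides_prepend _ _ N).
exists (Comp q (iter N (Comp Succ) Id)) => x.
have add n : pure (iter n (Comp Succ) Id) (addn n).
  by elim: n => //= n IHn ans y P H; apply: IHn; exact: H.
apply: add; apply: wp_mono (Hq _) => v ->; congr nat_of_bool.
rewrite /in_mem /=; apply: asbool_equiv_eq.
have big : ~ ((B `\` A) `|` (A `\` B))%classic (N + x).
  rewrite sE => /= /leq_bigmax_seq => /(_ xpredT id isT).
  by rewrite /N; lia.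
split=> H; apply: contrapT => H'; apply: big; [right|left]; by split.
Qed.

Lemma decides_columns O k (F : nat -> set nat) :
  (forall m, m < k -> exists q, decides O q (F m)) ->
  exists Q, forall m x, m < k -> wp (answer O) Q (npair m x) (fun v =>
    v = (x \in F m)).
Proof.
elim: k F => [|k IHk] F H; first by exists Id.
have [Q HQ] := IHk (fun m => F m.+1) (fun m mk => H m.+1 mk).
have [q Hq] := H 0 isT.
exists (If Fst (Comp Q (Pair (Comp Pred Fst) Snd)) (Comp q Snd)) => m x mk.
apply: wp_if; rewrite /= !projE; case: m mk => [|m] mk /=; first exact: Hq.
exact: HQ.
Qed.

Section Oracle.
Variable Xi : nat -> nat -> set nat.
Hypothesis Xi_all : forall m x, exists i, Xi m i x.
Notation R := (oracle Xi).

Lemma oracle_domP p s : oracle_dom Xi p s <->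
  proj0 p < size s /\ Xi (proj0 p) (nth 0 s (proj0 p)) (proj1 p).
Proof.
elim/last_ind: s => [|s i IHs].
  by split=> [H|[]] //; inversion H as [? [|??] ?|? [|??]].
rewrite size_rcons nth_rcons ltnS; split=> [H|[]].
  inversion H as [p' s' j H' E1 E2|x s' j H' E1 E2].
    move/rcons_inj: E2 => [? ?]; subst.
    by move: H'; rewrite IHs => -[ps]; rewrite ps ltnW.
  move/rcons_inj: E2 => [? ?]; subst.
  by rewrite !projE ltnn eqxx.
rewrite leq_eqVlt => /orP[/eqP E|ps]; last first.
  by rewrite ps => H; apply: OracleOld; apply/IHs.
rewrite E ltnn eqxx => H; rewrite -(npairK p) E.
exact: OracleNew.
Qed.

Lemma kmem_oracle s p : kmem s (knat p) R <-> oracle_dom Xi p s.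
Proof.
split=> [m|d]; last by apply: (KMem (h' := knat p)); [exists p|exact: keq_refl].
inversion m as [? ? ? y vy xy]; subst.
by case: vy xy => i di -> /knat_inj->.
Qed.

(** Only the columns below the length of the node are decided, because every
    number can still be put into any of the later columns. *)
Lemma kanswer_oracle s p b : kanswer R s p b <->
  proj0 p < size s /\ answer (Xi (proj0 p) (nth 0 s (proj0 p))) (proj1 p) b.
Proof.
have pre t : prefix s t -> proj0 p < size s -> nth 0 t (proj0 p) = nth 0 s
  (proj0 p).
  by move=> /prefixP[u ->] ps; rewrite nth_cat ps.
case: b => /=; first by rewrite kmem_oracle oracle_domP.
split=> [H|[ps H] t st]; last first.
  by rewrite kmem_oracle oracle_domP pre // => -[].
have ps : proj0 p < size s.
  rewrite ltnNge; apply/negP => sp; have [i Hi] := Xi_all (proj0 p) (proj1 p).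
  pose t := s ++ nseq (proj0 p - size s) 0 ++ [:: i].
  have sz : size (s ++ nseq (proj0 p - size s) 0) = proj0 p.
    by rewrite size_cat size_nseq subnKC.
  apply: (H t); first exact: prefix_prefix.
  rewrite kmem_oracle oracle_domP /t catA size_cat sz addn1 ltnSn nth_cat sz ltnn.
  by rewrite subnn.
split=> // H'; apply: (H s (prefix_refl s)).
by rewrite kmem_oracle oracle_domP.
Qed.

Lemma kapp_relativize s O Q g x k (P : nat -> Prop) :
  (forall m x, m < size s -> wp (answer O) Q (npair m x)
     (fun v => v = (x \in Xi m (nth 0 s m)))) ->
  kapp R s g x k -> P k ->
  wp (answer O) (relativize Q Univ) (npair g x) P.
Proof.
move=> HQ Hk Pk; apply: (wp_relativize (ans := kanswer R s));
  last exact: wp_univ Hk Pk.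
move=> p b /kanswer_oracle[ps Hb]; have := HQ _ (proj1 p) ps; rewrite npairK.
apply: wp_mono => v ->; congr nat_of_bool.
rewrite /in_mem /=; case: b Hb => /= Hb; first exact: asboolT.
exact: asboolF.
Qed.

End Oracle.

(** Consumes one bit of the code: <c, <n, j>> becomes
    <tail, <n + 1, 2j + bit>>. *)
Definition NumStep := LetIn (Comp Uncons v0) (Pair (Comp Snd v0)
  (Pair (Comp Succ v2) (Comp Add (Pair (Comp Double (Comp Snd (Comp Snd Snd)))
    (Comp Fst v0))))).
Definition NumLoop := While Fst NumStep.
Definition SeqNum := Comp Snd (Comp NumLoop (Pair Id (Const 0))).

Lemma wp_seq_num ans (t : seq bool) (P : nat -> Prop) :
  P (npair (size t) (num (nth false t) (size t))) -> wp ans SeqNum (seq_code t) P.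
Proof.
move=> H; rewrite /SeqNum; cbn -[NumLoop]; rewrite -npair00.
exists (size t).
have : forall i, i <= size t -> 
  (fix loop n y := wp ans Fst y (fun b => if b is 0 then wp ans Snd y P else
      if n is n'.+1 then wp ans NumStep y (loop n') else False))
    i (npair (seq_code (drop (size t - i) t))
         (npair (size t - i) (num (nth false t) (size t - i)))); last first.
  by move=> /(_ _ (leqnn _)); rewrite subnn drop0.
elim=> [|i IHi] it.
  by rewrite subn0 drop_size /seq_code /= code_nil !projE.
set m := size t - i.+1.
have mt : m < size t by rewrite /m; lia.
have mi : size t - i = m.+1 by rewrite /m; lia.
rewrite (drop_nth false mt) /seq_code map_cons; set c := CodeSeq.code (_ :: _).
have : c != 0 by rewrite /c code_eq0.
rewrite /= !projE; case E: c => [|d] // _; rewrite -E.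
apply: pure_uncons; rewrite ?projE /c /uncons CodeSeq.codeK /= ?projE.
apply: pure_double; apply: pure_add; rewrite !projE.
by have := IHi (ltnW it); rewrite mi.
Qed.
Opaque SeqNum.

(** * The search terminates *)

Definition bits_name (t : seq bool) := fun_name (fun i =>
  i < size t) (nth false t).

Lemma bits_nameE t : bits_name t = seq_name (size t) (num (nth false t) (size t)).
Proof. by apply: fun_name_ext => i it; rewrite digit_num. Qed.

Section Termination.
Variables (X : nat -> set nat) (Xi : nat -> nat -> set nat).
Hypothesis X_increasing : forall m n : nat, (m < n)%N -> turing_lt (X m) (X n).
Hypothesis X_path : forall (n : nat) (T : set (seq bool)),
     binary_tree T -> computable_tree (X n) T ->
     (0 < coin_measure (branches T))%E ->
     exists2 p : nat -> bool, branches T p & computable_path (X n.+1) p.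
Hypothesis Xi_list : forall (n : nat) (A : set nat),
     (exists i : nat, Xi n i = A) <->
     finite_set ((A `\` X n) `|` (X n `\` A))%classic.
Notation R := (oracle Xi).
Notation K := (kanswer R).

Lemma Xi_all m x : exists i, Xi m i x.
Proof.
have [|i E] := (Xi_list m (X m `|` [set x])%classic).2; last first.
  by exists i; rewrite E; right.
apply: (sub_finite_set (B := [set x]%classic)); last exact: finite_set1.
by move=> y [[[]//]|[Xy []]]; left.
Qed.

Lemma Xi_self m : exists i, Xi m i = X m.
Proof.
apply/Xi_list; rewrite (_ : (_ `|` _)%classic = set0); first exact: finite_set0.
by apply/seteqP; split=> // y [[]|[]].
Qed.

(** Each column of the oracle that is decided at [s] is a finite change of some
    [X m] with m < size s, hence computable from [X (size s)]. *)
Lemma columns s : exists Q, forall m x, m < size s ->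
  wp (answer (X (size s))) Q (npair m x) (fun v => v = (x \in Xi m (nth 0 s m))).
Proof.
apply: (@decides_columns _ _ (fun m => Xi m (nth 0 s m))) => m ms.
apply: (@decides_finite_change _ (X m)); first by apply/Xi_list;
  exists (nth 0 s m).
by apply: decides_turing; have [] := X_increasing ms.
Qed.

Variables (s : node) (T : kset) (f g h : nat).
Hypothesis Hf : realizes R (f_binary_tree omega_name T) f s.
Hypothesis Hg : realizes R (f_decidable omega_name T) g s.

(** By decidability, the tree that is forced at [s]; later nodes do not add
    sequences to it. *)
Definition tree : set (seq bool) := [set t | exists k, rmem R s k (bits_name t)
  T]%classic.

Lemma treeE t : tree t <-> inside R s T (size t) (num (nth false t) (size t)).
Proof. by rewrite /tree /inside /= bits_nameE. Qed.

Lemma tree_binary : binary_tree tree.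
Proof.
move=> t u tu [k Hk]; have [_ H] := Hf.
have [a [_ Ha]] := H s (prefix_refl s) _ (is_name_fun s _ _) s (prefix_refl s) _
  (is_name_fun s (fun i => i < size t) (nth false t)) s (prefix_refl s) k Hk.
have := finite_seq_seq R s (size t) (num (nth false t) (size t)).
rewrite -bits_nameE => Ft.
have [b [_ Hb]] := Ha s (prefix_refl s) _ Ft.
have sub : realizes R (f_subset (bits_name t) (bits_name u)) (clos Fst 0) s.
  apply: realizes_all => v z sv nz; apply: realizes_imp => w l vw.
  move=> /(rmem_inv (lists_fun _ _))[i [it li zi]].
  rewrite /= projE; apply/(rmem_lists _ _ _ _ (lists_fun _ _)).
  have iu : i < size u by apply: leq_trans it _; apply: size_prefix.
  exists i; split=> //; move: zi; case/prefixP: tu => w' ->.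
  by rewrite nth_cat it.
have [c [_ Hc]] := Hb s (prefix_refl s) _ sub.
by exists c.
Qed.

(** To decide a sequence, run the decision procedure [g] as it would run at
    [s], with a subroutine in place of the oracle. *)
Lemma tree_computable : computable_tree (X (size s)) tree.
Proof.
have [Q HQ] := columns s.
pose F := Comp (Comp Not Fst)
  (Comp (relativize Q Univ) (Pair (Const g) (Comp FinSeq SeqNum))).
exists (clos (Comp F Fst) 0) => t.
have [|v [c E]] := @clos_app (answer (X (size s))) (Comp F Fst) 0 (seq_code t)
  (fun v => v = (t \in tree)); last by rewrite -E.
rewrite /=; rewrite projE; apply: wp_seq_num; apply: pure_fin_seq.
have [a [ag ao _]] := decide Hg (size t) (num (nth false t) (size t)).
apply: (kapp_relativize Xi_all HQ ag).
apply: pure_not; congr nat_of_bool; move: ao; rewrite /outside => /negb_inj ->.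
rewrite /in_mem /=; apply: asbool_equiv_eq; split=> H; exact/treeE.
Qed.

Lemma tree_big n : ~~ enough R s T n ->
  2 ^ n < (#|[set t : n.-tuple bool | `[< tree t >]]|).*2.
Proof.
rewrite /enough -ltnNge => small; set A := [set t | _].
suff : 2 ^ n <= #|A| + size (outs R s T n (2 ^ n)) by lia.
pose ins := [seq j <- iota 0 (2 ^ n) | ~~ outside R s T n j].
have E : size ins + size (outs R s T n (2 ^ n)) = 2 ^ n.
  by rewrite /ins /outs size_rev !size_filter addnC count_predC size_iota.
rewrite -{1}E leq_add2r {E}.
pose F j : n.-tuple bool := [tuple digit n j i | i < n].
have nthF j i : i < n -> nth false (F j) i = digit n j i.
  by move=> ni; rewrite -[i]/(val (Ordinal ni)) -tnth_nth tnth_mktuple.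
have FI : {in ins &, injective F}.
  move=> i j; rewrite !mem_filter !mem_iota /= !add0n =>
    /andP[_ i2] /andP[_ j2] E.
  rewrite -(num_digit i2) -(num_digit j2); apply: eq_num => m mn.
  by rewrite -!nthF // E.
have uF : uniq (map F ins).
  by rewrite map_inj_in_uniq // filter_uniq // iota_uniq.
rewrite -(size_map F) -(card_uniqP uF); apply: subset_leq_card.
apply/fintype.subsetP => x /mapP[j jins ->]; move: jins.
rewrite mem_filter /= negbK => /andP[/asboolP Hj _].
rewrite inE; apply/asboolP; case: Hj => k Hk; exists k.
rewrite /bits_name size_tuple.
by rewrite (@fun_name_ext _ _ (digit n j)) // => i ni; apply: nthF.
Qed.

(** The environment is <_, <r, g>>, where r realizes that some set is a finite
    sequence: ask g about it. *)
Definition PathBody := Comp Snd (App (Comp Snd Snd) v1).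

(** A sequence of the model included in the path is a standard initial segment
    of [p], so it is in T, and [g] cannot reject it: its answer contains a
    realizer of the membership. *)
Lemma path_realized t beta (p : nat -> bool) : prefix s t ->
  (forall i, kapp R t beta i (p i)) -> branches tree p ->
  realizes R (f_path omega_name T (fun_name (fun=> True) p))
    (npair (fun_ir beta) (clos (Lam PathBody) g)) t.
Proof.
move=> st Hbeta brp; apply: realizes_and.
  by apply: binary_fun_intro => [|i _]; [exact: lists_omega|exact: Hbeta].
apply: realizes_all => u S tu nS; apply: realizes_imp => v r uv Hr.
apply: pure_lam; apply: realizes_imp => w l vw Hl.
have sw : prefix s w := prefix_trans (prefix_trans st tu) (prefix_trans uv vw).
rewrite /PathBody /=; apply: wp_app; rewrite /= !projE.
have {}Hr := realizes_mono vw Hr.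
have {}nS := is_name_mono (prefix_trans uv vw) nS.
have [a [ag Ha]] := Hg sw nS (prefix_refl w) Hr.
exists a; split=> //.
case: Ha => -[_ Ha]; first exact: Ha.
have [d [nd [/(rmem_inv lists_omega)[m [_ _ dm]] HS]]] := Hr.
have [b Hb] := valued_exists HS dm.
have SE' := binary_fun_eq nS HS dm Hb.
have bp i : i < m -> b i = p i.
  move=> im; have [k Hk] := Hb i im.
  have [q [_ Hq]] := Hl w (prefix_refl w) _
    (is_name_pair (is_name_nat w i) (is_name_nat w (b i))) w (prefix_refl w) k Hk.
  have [i' [_ _ E]] := rmem_inv (lists_fun _ _) Hq.
  have [e1 /nat_name_inj ii] := wp_exists (wp_inj1 E).
  have [e2 /nat_name_inj bb] := wp_exists (wp_inj2 E).
  by move: bb; rewrite -ii; case: (b i); case: (p i).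
have [k Hk] := brp m.
rewrite (@fun_name_ext _ b p) // in SE'.
have E : bits_name (mkseq p m) = fun_name (fun i => i < m) p.
  by rewrite /bits_name size_mkseq; apply: fun_name_ext => i im;
    rewrite nth_mkseq.
rewrite E in Hk.
have [c [_ []]] := Ha w (prefix_refl w) _ (mem_eql SE' (rmem_mono sw Hk)).
Qed.

(** Otherwise the tree has a branch computable from the next real, which a
    later node sees as a path. *)
Lemma search_terminates :
  realizes R (¬' (∃' p, f_path omega_name T p))%fml h s ->
  exists n, enough R s T n.
Proof.
move=> Hh; apply: contrapT => /forallNP none.
have big n : 2 ^ n < (#|[set t : n.-tuple bool | `[< tree t >]]|).*2.
  by apply: tree_big; apply/negP; apply: none.
have [p brp [e He]] :=
  X_path tree_binary tree_computable (coin_measure_pos tree_binary big).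
have [i Ei] := Xi_self (size s).+1.
(* column [(size s).+1] of the oracle is [X (size s).+1] itself at this node *)
pose t := s ++ [:: 0; i].
have st : prefix s t by exact: prefix_prefix.
have ct : size t = (size s).+2 by rewrite size_cat /= addn2.
have nt : nth 0 t (size s).+1 = i by rewrite nth_cat ltnNge leqnSn /= subSnn.
pose F := Comp (relativize (Comp Ora (Pair (Const (size s).+1) Id)) Univ)
  (Pair (Const e) Id).
have [|beta Hb] := @computable_clos (kanswer R t) F (fun m => nat_of_bool (p m)).
  move=> m; rewrite /F /=; apply: (wp_relativize (ans := answer (X (size s).+1))).
    move=> x b Hx; exists b => //; apply/(kanswer_oracle Xi_all).
    by rewrite !projE ct ltnSn nt Ei.
  exact: wp_univ (He m) _.
have [c [_ []]] := Hh t st _ (@realizes_ex _ _ _ _ _ (is_name_fun t _ _)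
  (path_realized st Hb brp)).
Qed.

End Termination.

(** The environment is <h, <g, f>>: [g] decides T. *)
Definition Realizer := Comp (Comp Answer Search) v1.

Theorem lemma3 (X : nat -> set nat) (Xi : nat -> nat -> set nat)
  (X_increasing : forall m n : nat, (m < n)%N -> turing_lt (X m) (X n))
  (X_path : forall (n : nat) (T : set (seq bool)),
     binary_tree T -> computable_tree (X n) T ->
     (0 < coin_measure (branches T))%E ->
     exists2 p : nat -> bool, branches T p & computable_path (X n.+1) p)
  (X_kleene : forall (n : nat) (p : nat -> bool),
     branches kleene_tree p -> ~ computable_path (X n) p)
  (Xi_list : forall (n : nat) (A : set nat),
     (exists i : nat, Xi n i = A) <->
     finite_set ((A `\` X n) `|` (X n `\` A))%classic) :
  forces_app (oracle Xi) [::] (WDFAN omega_name).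
Proof.
exists (clos (Lam (Lam Realizer)) 0).
apply: realizes_all => s0 T _ nT; apply: realizes_imp => s1 f s01 Hf.
apply: pure_lam; apply: realizes_imp => s2 g s12 Hg.
apply: pure_lam; apply: realizes_imp => s3 h s23 Hh.
have {}Hf := realizes_mono (prefix_trans s12 s23) Hf.
have {}Hg := realizes_mono s23 Hg.
have := wp_answer Hg (search_terminates X_increasing X_path Xi_list Hf Hg Hh).
by rewrite /Realizer; move=> H; rewrite -[v1]/(Comp Fst Snd) /= !projE.
Qed.
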